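(* Let $n\ge 2$, $k_1,k_2\ge0$ and $0\le\alpha\le n-1$. The number of NBC bases of the gain graph $K_n^{[-k_2,k_1+k_2]}$ with activity $\alpha$ equals the number of $(k_1+1,k_2)$-decreasing $(k_1+1+k_2)$-colored rooted trees on $[n]$ having exactly $\alpha$ edges of the form $(n,i)$ colored $1$. In particular, the number of bounded regions of the arrangement associated with $K_n^{[-k_2,k_1+k_2]}$ (taken in the hyperplane $x_1+\cdots+x_n=0$) equals the number of such trees with no edge of the form $(n,i)$ colored $1$.
   Context: For integers $a\le b$, $K_n^{[a,b]}$ is the gain graph (over $\mathbb Z$) with vertex set $[n]$ and, for every $1\le i<j\le n$ and every integer $g\in[a,b]$, one edge from $i$ to $j$ with gain $g$ (gain $-g$ in the reverse direction), corresponding to the hyperplane $x_j-x_i=g$ in $\mathbb R^n$; the associated arrangement consists of all these hyperplanes. A circle is balanced if the sum of the gains along it, in a fixed direction, is $0$. Fix a linear order on the edges. A broken circuit is a balanced circle minus its smallest edge. An NBC set is an edge set forming a forest of the underlying multigraph (no circles, no two parallel edges) containing no broken circuit; an NBC basis is an NBC set which is a spanning tree. For an NBC basis $B$, $e\in B$ is active if $e$ is the smallest edge among all $f$ with $(B\setminus\{e\})\cup\{f\}$ a spanning tree; the activity of $B$ is the number of active edges (the counts do not depend on the order). A $k$-colored rooted tree on $[n]$ is a set of $n-1$ triples $(u,w,c)$, $u\neq w\in[n]$, $c\in[k]$ (edge from parent $u$ to child $w$ with color $c$), each vertex a child at most once, with no cycle. For a vertex $v$ with at least one child let $c_v$ be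 the minimal color of edges from $v$ to its children. With $k=k_1'+k_2'$, the tree is $(k_1',k_2')$-decreasing if for every vertex $v$ with a child and $c_v\le k_1'$, every child $w$ joined to $v$ by an edge of color $c_v$ satisfies $w<v$. An edge of the form $(n,i)$ is one whose parent is $n$. *)

(* Defs.v *)
From HB Require Import structures.
From mathcomp Require Import all_boot all_order all_algebra.
From mathcomp Require Import all_classical all_reals all_analysis.
Set Implicit Arguments. Unset Strict Implicit. Unset Printing Implicit Defensive.
Import Order.TTheory GRing.Theory Num.Theory.
Import numFieldNormedType.Exports.
Local Open Scope classical_set_scope.

(* Gain graph K_n^{[a, a+N-1]}.  Vertices are 'I_n (vertex v of the   *)
(* paper, 1 <= v <= n, is the ordinal v-1; the order is preserved).   *)
(* An edge is a triple (i, j, c) with i < j and c : 'I_N; its gain    *)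
(* (in the direction i -> j) is a + c.  So the gains range over the   *)
(* integer interval [a, a+N-1], one edge for each pair i<j and gain.  *)

Definition gedge (n N : nat) := {e : 'I_n * 'I_n * 'I_N | (e.1.1 < e.1.2)%N}.

Section GainGraph.
Variables (n N : nat) (a : int).
Local Notation E := (gedge n N).

Definition esrc (e : E) : 'I_n := (val e).1.1.
Definition edst (e : E) : 'I_n := (val e).1.2.
Definition egain (e : E) : int := (a + ((val e).2 : nat)%:Z)%R.

Definition joins (e : E) (u v : 'I_n) : bool :=
  ((esrc e == u) && (edst e == v)) || ((esrc e == v) && (edst e == u)).

(* gain of e traversed starting from its endpoint u *)
Definition ogain (e : E) (u : 'I_n) : int :=
  if esrc e == u then egain e else (- egain e)%R.

(* a closed walk v_0 e_0 v_1 e_1 ... v_{m-1} e_{m-1} v_0 with m >= 2,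
   distinct vertices and distinct edges, e_t joining v_t and v_{t+1 mod m} *)
Definition circle_walk (s : seq 'I_n) (es : seq E) : bool :=
  [&& (2 <= size s)%N, uniq s, uniq es &
      all2 (fun e p => joins e p.1 p.2) es (zip s (rot 1 s))].

Definition is_circle (C : {set E}) : Prop :=
  exists s es, circle_walk s es /\ C = [set e in es]%SET.

Definition balanced_circle (C : {set E}) : Prop :=
  exists s es, [/\ circle_walk s es, C = [set e in es]%SET &
                   (\sum_(p <- zip es s) ogain p.1 p.2)%R = 0%R].

(* forest of the underlying multigraph: contains no circle
   (in particular no two parallel edges) *)
Definition forest (S : {set E}) : Prop :=
  ~ exists C : {set E}, C \subset S /\ is_circle C.

Definition adj (S : {set E}) : rel 'I_n :=
  fun u v => [exists e in S, joins e u v].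

Definition spanning_tree (B : {set E}) : Prop :=
  forest B /\ forall u v : 'I_n, connect (adj B) u v.

Variable ord : E -> nat. (* the linear order on edges: e < f iff ord e < ord f *)

Definition NBC_set (S : {set E}) : Prop :=
  forest S /\
  ~ exists (C : {set E}) (e : E), [/\ balanced_circle C, e \in C,
                    (forall f, f \in C -> ord e <= ord f)%N &
                    C :\ e \subset S].

Definition NBC_basis (B : {set E}) : Prop := NBC_set B /\ spanning_tree B.

Definition active (B : {set E}) (e : E) : Prop :=
  e \in B /\ forall f, spanning_tree (f |: (B :\ e)) -> (ord e <= ord f)%N.

Definition activity (B : {set E}) : nat := #|[set e in B | `[< active B e >]]%SET|.

End GainGraph.

Section Arrangement.
Variables (R : realType) (n N : nat) (a : int).
Local Notation E := (gedge n N).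

Definition hyperplane (e : E) : set 'rV[R]_n :=
  [set x | x ord0 (edst e) - x ord0 (esrc e) = (egain a e)%:~R]%R.

Definition arr_complement : set 'rV[R]_n :=
  [set x : 'rV[R]_n | (\sum_i x ord0 i = 0)%R] `\` \bigcup_(e in [set: E]) hyperplane e.

Definition region (Rg : set 'rV[R]_n) : Prop :=
  exists x, arr_complement x /\ Rg = connected_component (arr_complement) x.

Definition bounded_regions : set (set 'rV[R]_n) :=
  [set Rg | region Rg /\ bounded_set Rg].

End Arrangement.

(* k-colored rooted trees on [n]: triples (u, w, c) : 'I_n*'I_n*'I_k, *)
(* parent u, child w, color c (color c of the paper is the ordinal    *)
(* c-1).                                                              *)
Section Trees.
Variables (n k : nat).
Local Notation TE := ('I_n * 'I_n * 'I_k)%type.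

Definition parent_rel (T : {set TE}) : rel 'I_n :=
  fun u w => [exists c : 'I_k, (u, w, c) \in T].

Definition colored_rooted_tree (T : {set TE}) : bool :=
  [&& #|T| == n.-1,
      [forall t in T, t.1.1 != t.1.2],
      [forall t in T, forall t' in T, (t.1.2 == t'.1.2) ==> (t == t')] &
      [forall u, forall w, parent_rel T u w ==> ~~ connect (parent_rel T) w u]].

(* (k1', k - k1')-decreasing: if t = (v, w, c) has c = c_v (the minimal
   color of edges from v) and c_v <= k1' (i.e. ordinal < k1'), then w < v *)
Definition decreasing (k1' : nat) (T : {set TE}) : bool :=
  [forall t in T,
     ((t.2 < k1')%N && [forall t' in T, (t'.1.1 == t.1.1) ==> (t.2 <= t'.2)%N])
       ==> (t.1.2 < t.1.1)%N].

(* number of edges (n, i) (parent is the vertex n, i.e. ordinal n-1) of color 1 *)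
Definition n_edges_col1 (T : {set TE}) : nat :=
  #|[set t in T | ((t.1.1 : nat) == n.-1) && ((t.2 : nat) == 0)]%SET|.

End Trees.

(* Main.v *)
(** Write [P(X)] for the sum of [X^activity] over the NBC bases and [T(X)] for
    the sum of [X^(n_edges_col1)] over the decreasing trees.

    Every NBC set is uniquely [B \ A] with [B] an NBC basis and [A] a set of
    active edges of [B], so [P(1 + y)] is the sum of [y^(n-1-|S|)] over the NBC
    sets [S].  For a potential [x] with values in [Z/q] ([q] large) or in the
    reals, toggling the smallest satisfied edge shows that the signed count of
    the NBC sets of satisfied edges is [1] if [x] satisfies no edge and [0]
    otherwise.  Summing over [Z/q] gives [(-1)^(n-1) q P(1 - q)] as the number
    of proper colorings.  Placing the vertices around the cycle of length [q],
    only consecutive vertices interact, and this number is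
    [q sum_j A_j C(q - 1 - n k2 - k1 (j + 1), n - 1)] where [A_j] counts the
    permutations of [n - 1] letters with [j] ascents.

    For trees, the condition at a vertex is a signed sum of conditions that are
    multiplicative over the child edges; Pitman's double counting turns the sum
    over trees into products of linear factors, and an operator identity sums
    these to the same Eulerian expression, now evaluated at [X].  Hence
    [P(1 - q) = T(1 - q)] for all large [q], and [P = T].

    The bounded regions are counted by deletion and restriction on relatively
    bounded sign cells: their number is, up to sign, the sum of [(-1)^|A|] over
    the consistent edge sets [A], which equals the sum over the NBC sets, i.e.
    [P(0)] up to sign. *)

Require Import Defs.
From HB Require Import structures.
From mathcomp Require Import all_boot all_order all_algebra.
From mathcomp Require Import all_classical all_reals all_analysis.
From mathcomp Require Import zify ring lra.
Set Implicit Arguments. Unset Strict Implicit. Unset Printing Implicit Defensive.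
Import Order.TTheory GRing.Theory Num.Theory.
Import numFieldNormedType.Exports.

(** * Refined Eulerian polynomials *)

(** Both sides reduce to the sum over j of [A_j] times a rising factorial translated by [k1 * j],
    but the numbers [A_j] arise differently. On the graph side j counts the steps around the cycle
    from a smaller to a larger label, each of which costs [k1] extra positions. On the tree side no
    permutation is visible: the [A_j] come from the recurrence of the Eulerian numbers, produced by
    commuting multiplication by the variable with an operator whose umbral image is the shift by
    [k1]. The colors granted by the types of all vertices shift every linear factor, also those of
    vertices added later. A second, formal variable postpones these shifts until all factors are
    present.

    Evaluation at 1 - q is dictated by the colorings: y = -q makes 1 + y = 1 - q, and a rising
    factorial at a negative integer is a binomial coefficient up to sign. The modulus has to exceed
    the gain of any circle, so that balance modulo q is balance over the integers. *)

Section EulerianPolynomials.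
Local Open Scope ring_scope.

(** Eulerian polynomial of the permutations of r letters by ascents, through its differential
    recurrence. *)
Fixpoint euler_poly (r : nat) : {poly rat} :=
  if r is r'.+1 then
    (1 + r'%:R *: 'X) * euler_poly r' + 'X * (1 - 'X) * (euler_poly r')^`()
  else 1.

(* Ascent enumerator of the words on r + l + 1 letters whose first letter
   is larger than exactly r of the others. *)
Fixpoint reuler_poly (r l : nat) : {poly rat} :=
  if l is l'.+1 then
    'X * (1 - 'X) * (reuler_poly r l')^`()
    + (r + l').+1%:R *: ('X * reuler_poly r l')
  else euler_poly r.

(** Exchanging the first letter with the next smaller value changes the ascents only if the two
    stand side by side; then a descent becomes an ascent, and the word from the second letter on is
    counted by [reuler_poly r l]. *)
Lemma reuler_polySl r l :
  reuler_poly r.+1 l = reuler_poly r l.+1 + (1 - 'X) * reuler_poly r l.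
Proof.
elim: l => [|l IHl] /=.
  rewrite addn0 -!mul_polyC -natr1 polyCD !polyC_natr; ring.
rewrite IHl derivD derivM derivB derivX derivC /=.
rewrite -!mul_polyC !polyC_natr.
have -> : (r.+1 + l).+1 = (r + l.+1).+1 by lia.
have -> : (r + l.+1).+1%:R = 1 + (r + l).+1%:R :> {poly rat}.
  by rewrite addnS -[in LHS]natr1 addrC.
ring.
Qed.

(** A smallest first letter is followed by an ascent, a largest one by a descent; the rest of the
    word is arbitrary in both cases. *)
Lemma reuler_poly0S m : reuler_poly 0 m.+1 = 'X * reuler_poly m.+1 0.
Proof.
elim: m => [|m IHm]; first by rewrite /= derivC !scale1r scale0r; ring.
have -> : reuler_poly 0 m.+2 = 'X * (1 - 'X) * (reuler_poly 0 m.+1)^`()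
    + m.+2%:R *: ('X * reuler_poly 0 m.+1) by [].
have -> : reuler_poly m.+2 0 = (1 + m.+1%:R *: 'X) * reuler_poly m.+1 0
    + 'X * (1 - 'X) * (reuler_poly m.+1 0)^`() by [].
rewrite IHm; set u := reuler_poly m.+1 0.
rewrite derivM derivX -!mul_polyC !polyC_natr.
have -> : m.+2%:R = 1 + m.+1%:R :> {poly rat} by rewrite -[in LHS]natr1 addrC.
ring.
Qed.

Lemma reuler_poly_telescope M r : (r <= M.+1)%N ->
  (1 - 'X) * (\sum_(i < r) reuler_poly i (M - i))
  = reuler_poly r (M.+1 - r) - reuler_poly 0 M.+1.
Proof.
elim: r => [|r IHr] hr; first by rewrite big_ord0 mulr0 subn0 subrr.
rewrite big_ord_recr mulrDr IHr ?(ltnW hr) //= subSS reuler_polySl.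
by rewrite subSn //; ring.
Qed.

(** Deletion of the first letter: the next one has rank i among the remaining letters, and the lost
    step is an ascent exactly when i is at least r. After multiplication by [1 - 'X] both partial
    sums telescope. *)
Lemma reuler_poly_next r l : (0 < r + l)%N ->
  reuler_poly r l
  = \sum_(i < r + l) (if (i < r)%N then 1 else 'X) * reuler_poly i ((r + l).-1 - i).
Proof.
case E: (r + l)%N => [//|M] _ /=.
have nz : (1 - 'X : {poly rat}) != 0.
  by rewrite -opprB oppr_eq0 polyXsubC_eq0.
apply: (mulfI nz).
have hr : (r <= M.+1)%N by lia.
have El : l = (M.+1 - r)%N by lia.
pose F i := reuler_poly i (M - i).
have -> : \sum_(i < M.+1) (if (i < r)%N then 1 else 'X) * reuler_poly i (M - i)
  = (1 - 'X) * (\sum_(i < r) F i) + 'X * (\sum_(i < M.+1) F i).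
  rewrite (big_ord_widen _ F hr) !mulr_sumr [X in X + _]big_mkcond -big_split /=.
  by apply: eq_bigr => i _; rewrite /F; case: ifP => _; ring.
rewrite mulrDr [_ * ('X * _)]mulrCA !reuler_poly_telescope // subnn.
rewrite reuler_poly0S -El; ring.
Qed.

(** Separates the number of ascents from the cost of an ascent: multiplying the polynomial by ['X]
    replaces [phi j] by [phi j.+1]. *)
Definition poly_pair (V : lmodType rat) (u : {poly rat}) (phi : nat -> V) : V :=
  \sum_(j < size u) u`_j *: phi j.

Lemma poly_pair_widen (V : lmodType rat) (u : {poly rat}) (phi : nat -> V) m :
  (size u <= m)%N -> poly_pair u phi = \sum_(j < m) u`_j *: phi j.
Proof.
move=> hm; rewrite /poly_pair (big_ord_widen _ (fun j => u`_j *: phi j) hm).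
rewrite big_mkcond; apply: eq_bigr => j _; case: ltnP => // h.
by rewrite nth_default ?scale0r.
Qed.

Lemma poly_pairD (V : lmodType rat) (u v : {poly rat}) (phi : nat -> V) :
  poly_pair (u + v) phi = poly_pair u phi + poly_pair v phi.
Proof.
pose m := maxn (size u) (size v).
rewrite (@poly_pair_widen _ (u + v) _ m) ?size_polyD //.
rewrite (@poly_pair_widen _ u _ m) ?leq_maxl // (@poly_pair_widen _ v _ m) ?leq_maxr //.
by rewrite -big_split; apply: eq_bigr => j _; rewrite coefD scalerDl.
Qed.

Lemma poly_pair0 (V : lmodType rat) (phi : nat -> V) : poly_pair 0 phi = 0.
Proof. by rewrite /poly_pair size_poly0 big_ord0. Qed.

Lemma poly_pair_sum (V : lmodType rat) (I : Type) (s : seq I) (P : pred I)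
    (u : I -> {poly rat}) (phi : nat -> V) :
  poly_pair (\sum_(i <- s | P i) u i) phi = \sum_(i <- s | P i) poly_pair (u i) phi.
Proof.
apply: (big_morph (fun w => poly_pair w phi)) => [v w|]; first exact: poly_pairD.
exact: poly_pair0.
Qed.

Lemma poly_pairMX (V : lmodType rat) (u : {poly rat}) (phi : nat -> V) :
  poly_pair ('X * u) phi = poly_pair u (phi \o succn).
Proof.
rewrite (@poly_pair_widen _ _ _ (size u).+1); last first.
  by rewrite (leq_trans (size_polyMleq _ _)) ?size_polyX.
rewrite big_ord_recl coefXM eqxx scale0r add0r.
by apply: eq_bigr => j _; rewrite coefXM.
Qed.

Lemma poly_pair1 (V : lmodType rat) (phi : nat -> V) : poly_pair 1 phi = phi 0.
Proof.
by rewrite (@poly_pair_widen _ _ _ 1) ?size_poly1 // big_ord1 coefC scale1r.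
Qed.

Lemma eq_poly_pair (V : lmodType rat) (u : {poly rat}) (phi psi : nat -> V) :
  phi =1 psi -> poly_pair u phi = poly_pair u psi.
Proof. by move=> e; apply: eq_bigr => j _; rewrite e. Qed.

End EulerianPolynomials.

Lemma big_ffun_ord_recr (V : nmodType) (T : finType) (m : nat)
    (G : {ffun 'I_m.+1 -> T} -> V) :
  (\sum_(f : {ffun 'I_m.+1 -> T}) G f
   = \sum_(t : T) \sum_(f : {ffun 'I_m -> T})
       G [ffun i => if unlift ord_max i is Some j then f j else t])%R.
Proof.
rewrite pair_big /=.
pose ext (q : T * {ffun 'I_m -> T}) : {ffun 'I_m.+1 -> T} :=
  [ffun i => if unlift ord_max i is Some j then q.2 j else q.1].
pose res (f : {ffun 'I_m.+1 -> T}) : T * {ffun 'I_m -> T} :=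
  (f ord_max, [ffun j => f (lift ord_max j)]).
rewrite (reindex ext); first by apply: eq_bigr => -[].
exists res => [[t f]|f] _.
  congr pair; first by rewrite ffunE unlift_none.
  by apply/ffunP => j; rewrite !ffunE liftK.
by apply/ffunP => i; rewrite ffunE /=; case: unliftP => [j|] -> //; rewrite ffunE.
Qed.

(** * Shift operators on rising factorials and the umbral map *)

Section RisingOperators.
Variable k : nat.
Local Open Scope ring_scope.
Local Notation A := {poly rat}.
Local Notation AA := {poly {poly rat}}.

Definition shift_poly (c : rat) : A -> A := comp_poly ('X + c%:P).
Definition shift2 (c : rat) : AA -> AA := map_poly (shift_poly c).

HB.instance Definition _ c := GRing.RMorphism.copy (shift_poly c) (comp_poly ('X + c%:P)).
HB.instance Definition _ c := GRing.RMorphism.copy (shift2 c) (map_poly (shift_poly c)).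

Lemma shift_polyC c d : shift_poly c d%:P = d%:P.
Proof. exact: comp_polyC. Qed.

Lemma shift_polyX c : shift_poly c 'X = 'X + c%:P.
Proof. exact: comp_polyX. Qed.

Lemma shift_polyD c d f : shift_poly c (shift_poly d f) = shift_poly (c + d) f.
Proof.
rewrite /shift_poly -comp_polyA comp_polyD comp_polyX comp_polyC.
by rewrite -addrA polyCD.
Qed.

Lemma shift_poly0 f : shift_poly 0 f = f.
Proof. by rewrite /shift_poly addr0 comp_polyXr. Qed.

Lemma shift2K c f : shift2 c (shift2 (- c) f) = f.
Proof.
apply/polyP => i; rewrite !coef_map /= shift_polyD subrr; exact: shift_poly0.
Qed.

Lemma shift2NK c f : shift2 (- c) (shift2 c f) = f.
Proof. by rewrite -{2}[c]opprK shift2K. Qed.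

Lemma shift2X c : shift2 c 'X = 'X.
Proof. exact: map_polyX. Qed.

Lemma shift2C c (f : A) : shift2 c f%:P = (shift_poly c f)%:P.
Proof. exact: map_polyC. Qed.

Definition geom : AA := \sum_(i < k.+1) 'X^i.

Lemma shift2_geom c : shift2 c geom = geom.
Proof.
by rewrite rmorph_sum; apply: eq_bigr => i _; rewrite rmorphXn /= shift2X.
Qed.

Lemma geom_telescope : 'X * geom - geom = 'X^(k.+1) - 1.
Proof. by rewrite subrX1 /geom; ring. Qed.

(* In {poly {poly rat}} the inner variable is shifted, the outer one is a
   formal shift that the umbral map below substitutes. *)
Definition ascent_op (f : AA) : AA := geom * f + (1 - geom) * shift2 (-1) f.
Local Notation E := ascent_op.
Local Notation Y := (('X : A)%:P : AA).

Lemma ascent_opD f g : E (f + g) = E f + E g.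
Proof. by rewrite /E rmorphD /=; ring. Qed.

Lemma ascent_op0 : E 0 = 0.
Proof. by rewrite /E rmorph0 !mulr0 addr0. Qed.

Lemma ascent_opM c f : shift2 (-1) c = c -> E (c * f) = c * E f.
Proof. by move=> hc; rewrite /E rmorphM /= hc; ring. Qed.

Lemma iter_ascent_opD j f g : iter j E (f + g) = iter j E f + iter j E g.
Proof. by elim: j => //= j ->; rewrite ascent_opD. Qed.

Lemma iter_ascent_opM j c f : shift2 (-1) c = c -> iter j E (c * f) = c * iter j E f.
Proof. by move=> hc; elim: j => //= j ->; rewrite ascent_opM. Qed.

Lemma shift2_ascent_op c f : shift2 c (E f) = E (shift2 c f).
Proof.
rewrite /E rmorphD !rmorphM rmorphB rmorph1 /= shift2_geom; congr (_ + _ * _).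
by apply/polyP => i; rewrite !coef_map /= !shift_polyD addrC.
Qed.

Lemma shift2_iter_ascent_op c j f : shift2 c (iter j E f) = iter j E (shift2 c f).
Proof. by elim: j => //= j IHj; rewrite shift2_ascent_op IHj. Qed.

(** The commutator of multiplication by the inner variable with the operator is
    [(1 - geom) * shift2 (-1)], because the shift sends [Y] to [Y - 1]. It commutes with the
    operator, so the power rule yields the factor j + 1. *)
Lemma mulY_iter_ascent_op j f :
  Y * iter j.+1 E f
  = iter j.+1 E (Y * f) + j.+1%:R * (1 - geom) * shift2 (-1) (iter j E f).
Proof.
have step g : Y * E g = E (Y * g) + (1 - geom) * shift2 (-1) g.
  rewrite /E rmorphM /= shift2C shift_polyX polyCD !polyCN polyC1; ring.
elim: j => [|j IHj]; first by rewrite /= step mul1r.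
rewrite [iter j.+2 E f]iterS step IHj ascent_opD ascent_opM; last first.
  by rewrite rmorphM rmorphB rmorph1 /= shift2_geom rmorph_nat.
rewrite -shift2_ascent_op -!iterS -[j.+2%:R]natr1; ring.
Qed.

(** The binomial coefficient of X + N - 1 over N; with this normalization the backward difference
    lowers the index by one. *)
Definition rising_poly (N : nat) : A := N`!%:R^-1 *: \prod_(i < N) ('X + i%:R%:P).

Lemma rising_poly0 : rising_poly 0 = 1.
Proof. by rewrite /rising_poly big_ord0 fact0 invr1 scale1r. Qed.

Lemma rising_polyS N :
  N.+1%:R%:P * rising_poly N.+1 = 'X * shift_poly 1 (rising_poly N).
Proof.
rewrite /rising_poly /shift_poly linearZ /= -/(shift_poly 1).
rewrite -/(shift_poly 1 _) rmorph_prod /= mul_polyC scalerA -scalerAr.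
rewrite factS natrM invfM mulrA divff ?mul1r ?pnatr_eq0 //; congr (_ *: _).
rewrite big_ord_recl addr0; congr (_ * _); apply: eq_bigr => i _.
rewrite rmorphD /= shift_polyX shift_polyC -addrA -polyCD.
by rewrite [bump _ _]add1n -[in LHS]nat1r.
Qed.

Lemma rising_poly_diff N :
  rising_poly N.+1 - shift_poly (-1) (rising_poly N.+1) = rising_poly N.
Proof.
rewrite /rising_poly [shift_poly _ _]linearZ /= -/(shift_poly (-1) _) rmorph_prod /=.
rewrite big_ord_recr [X in _ - _ *: X]big_ord_recl /= -scalerBr.
rewrite [X in _ - _ * X](eq_bigr (fun i : 'I_N => 'X + i%:R%:P)) => [|i _]; last first.
  rewrite rmorphD /= shift_polyX shift_polyC -addrA -polyCD; congr ('X + _%:P).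
  by rewrite [bump _ _]add1n -nat1r addKr.
set u := \prod_(i < N) _; rewrite [shift_poly _ _]rmorphD /= shift_polyX shift_polyC.
have -> : u * ('X + N%:R%:P) - ('X + (-1)%:P + 0%:P) * u = N.+1%:R *: u.
  by rewrite -mul_polyC -natr1 polyCD polyCN polyC0; ring.
by rewrite scalerA factS mulnC natrM invfM mulfVK // pnatr_eq0.
Qed.

(** The factors j + 1 and N - j are those of the recurrence of the Eulerian numbers. The commutator
    term is turned, through [rising_poly_diff], into a difference of two consecutive powers of the
    operator. *)
Lemma mulY_shift_ascent_op j N :
  Y * shift2 1 (iter j.+1 E (rising_poly N)%:P)
  = j.+1%:R * iter j E (rising_poly N.+1)%:P
    + (N.+1%:R - j.+1%:R) * iter j.+1 E (rising_poly N.+1)%:P.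
Proof.
rewrite shift2_iter_ascent_op mulY_iter_ascent_op shift2_iter_ascent_op shift2NK.
rewrite shift2C -polyCM -rising_polyS polyCM iter_ascent_opM; last first.
  by rewrite shift2C shift_polyC.
have -> : j.+1%:R * (1 - geom) * iter j E (rising_poly N)%:P
  = j.+1%:R * (iter j E (rising_poly N.+1)%:P - iter j.+1 E (rising_poly N.+1)%:P).
  rewrite -mulrA; congr (_ * _).
  rewrite -iter_ascent_opM; last by rewrite rmorphB rmorph1 /= shift2_geom.
  rewrite -rising_poly_diff polyCB -shift2C iterSr.
  set b := (rising_poly N.+1)%:P.
  have -> : (1 - geom) * (b - shift2 (-1) b) = b + (-1) * E b by rewrite /E; ring.
  rewrite iter_ascent_opD iter_ascent_opM ?rmorphN ?rmorph1 //; ring.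
rewrite !polyC_natr; ring.
Qed.

Lemma coef_euler_polyS N j :
  (euler_poly N.+1)`_j = j.+1%:R * (euler_poly N)`_j
     + (if j is j'.+1 then (N%:R - j'%:R) * (euler_poly N)`_j' else 0).
Proof.
set u := euler_poly N; rewrite [euler_poly N.+1]/= -/u.
have -> : (1 + N%:R *: 'X) * u + 'X * (1 - 'X) * u^`()
  = u + N%:R *: ('X * u) + 'X * u^`() - 'X * ('X * u^`()).
  by rewrite -!mul_polyC; ring.
rewrite !(coefD, coefZ, coefN, coefXM, coef_deriv).
case: j => [|[|j]] /=; rewrite ?coef_deriv; ring.
Qed.

Lemma size_euler_poly N : (size (euler_poly N) <= N.+1)%N.
Proof.
elim: N => [|N IHN]; first by rewrite size_poly1.
apply/leq_sizeP => -[//|j] hj; rewrite coef_euler_polyS.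
have /leq_sizeP h := IHN; rewrite !h ?mulr0 ?addr0 //; first exact: ltnW.
Qed.

(** One iteration for each vertex other than the largest: the operator and the shift sum over the
    signed types of the vertex ([forest_polyS]), and [Y] starts the linear factor of the vertex
    itself. *)
Definition forest_poly (N : nat) : AA := iter N (fun f => Y * shift2 1 (E f)) 1.

Lemma forest_polyE N :
  forest_poly N = \sum_(j < N.+1) ((euler_poly N)`_j)%:P%:P * iter j E (rising_poly N)%:P.
Proof.
elim: N => [|N IHN].
  by rewrite big_ord1 coefC /= rising_poly0 mul1r.
have -> : forest_poly N.+1 = Y * shift2 1 (E (forest_poly N)) by [].
pose w j : AA := ((euler_poly N)`_j)%:P%:P.
pose F j : AA := iter j E (rising_poly N.+1)%:P.
have wS c j : shift2 c (w j) = w j by rewrite shift2C shift_polyC.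
pose G j : AA := if j is j'.+1 then w j' * ((N.+1%:R - j'.+1%:R) * F j) else 0.
have -> : \sum_(j < N.+2) ((euler_poly N.+1)`_j)%:P%:P * iter j E (rising_poly N.+1)%:P
  = \sum_(j < N.+2) w j * (j.+1%:R * F j) + \sum_(j < N.+2) G j.
  rewrite -big_split; apply: eq_bigr => j _; rewrite coef_euler_polyS -/(F j).
  rewrite /G /w; case: (j : nat) => [|j'].
    by rewrite /= !addr0 !mul1r.
  rewrite /= !polyCD !polyCM !polyCB !polyC_natr; ring.
rewrite IHN (big_morph E ascent_opD ascent_op0) rmorph_sum mulr_sumr.
(* By [mulY_shift_ascent_op] the term j of the old sum feeds the terms j and j + 1 of the new
   one. *)
transitivity (\sum_(j < N.+1)
    (w j * (j.+1%:R * F j) + w j * ((N.+1%:R - j.+1%:R) * F j.+1))).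
  apply: eq_bigr => j _; rewrite -/(w j) ascent_opM ?wS // -mulrDr.
  by rewrite rmorphM /= wS mulrCA -mulY_shift_ascent_op.
rewrite big_split; congr (_ + _).
  rewrite [RHS]big_ord_recr /= /w.
  have /leq_sizeP -> // := size_euler_poly N.
  by rewrite !polyC0 mul0r addr0.
by rewrite [RHS]big_ord_recl add0r.
Qed.

(** The outer variable becomes the shift by one. This is no ring morphism, since shifts do not
    commute with the inner variable; hence the separate rules for constants and for powers of the
    outer variable. *)
Definition umbral (f : AA) : A := \sum_(m < size f) shift_poly m%:R f`_m.

Lemma umbral_widen (f : AA) M : (size f <= M)%N -> umbral f = \sum_(m < M) shift_poly m%:R f`_m.
Proof.
move=> hM; rewrite /umbral (big_ord_widen _ (fun m => shift_poly m%:R f`_m) hM).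
rewrite big_mkcond; apply: eq_bigr => j _; case: ltnP => // h.
by rewrite nth_default ?rmorph0.
Qed.

Lemma umbralD f g : umbral (f + g) = umbral f + umbral g.
Proof.
pose m := maxn (size f) (size g).
rewrite (@umbral_widen (f + g) m) ?size_polyD //.
rewrite (@umbral_widen f m) ?leq_maxl // (@umbral_widen g m) ?leq_maxr //.
by rewrite -big_split; apply: eq_bigr => j _; rewrite coefD rmorphD.
Qed.

Lemma umbralCM (c : rat) f : umbral (c%:P%:P * f) = c%:P * umbral f.
Proof.
rewrite (@umbral_widen _ (size f)); last by rewrite mul_polyC size_scale_leq.
rewrite mulr_sumr; apply: eq_bigr => j _.
by rewrite coefCM rmorphM /= shift_polyC.
Qed.

Lemma umbral0 : umbral 0 = 0.
Proof. by rewrite /umbral size_poly0 big_ord0. Qed.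

Lemma umbral_sum (I : Type) (s : seq I) (P : pred I) (F : I -> AA) :
  umbral (\sum_(i <- s | P i) F i) = \sum_(i <- s | P i) umbral (F i).
Proof. exact: (big_morph umbral umbralD umbral0). Qed.

Lemma umbralC (c : A) : umbral c%:P = c.
Proof.
rewrite (@umbral_widen _ 1) ?size_polyC_leq1 // big_ord1 coefC; exact: shift_poly0.
Qed.

Lemma umbralXM f : umbral ('X * f) = shift_poly 1 (umbral f).
Proof.
rewrite (@umbral_widen _ (size f).+1); last first.
  by rewrite (leq_trans (size_polyMleq _ _)) ?size_polyX.
rewrite big_ord_recl coefXM rmorph0 add0r rmorph_sum.
by apply: eq_bigr => j _; rewrite coefXM /= shift_polyD [bump _ _]add1n -nat1r.
Qed.

Lemma umbralXnM m f : umbral ('X^m * f) = shift_poly m%:R (umbral f).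
Proof.
elim: m => [|m IHm]; first by rewrite mul1r shift_poly0.
by rewrite exprS -mulrA umbralXM IHm shift_polyD nat1r.
Qed.

Lemma umbral_shift2 c f : umbral (shift2 c f) = shift_poly c (umbral f).
Proof.
have hs : (size (shift2 c f) <= size f)%N by rewrite size_poly.
rewrite (umbral_widen hs) rmorph_sum.
by apply: eq_bigr => j _; rewrite coef_map /= !shift_polyD addrC.
Qed.

(* The umbral map identifies multiplication by the outer variable with the
   shift, which makes the geometric sums collapse. *)
Lemma umbral_ascent_op f : umbral (E f) = shift_poly k%:R (umbral f).
Proof.
have umbralN g : umbral (- g) = - umbral g.
  by apply/eqP; rewrite -addr_eq0 -umbralD addNr umbral0.
pose g := shift2 (-1) f.
have -> : E f = geom * shift2 1 g - geom * g + g.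
  by rewrite /g shift2K /E; ring.
rewrite !umbralD umbralN.
have -> : umbral (geom * shift2 1 g) = umbral ('X * geom * g).
  by rewrite -mulrA umbralXM -umbral_shift2 rmorphM /= shift2_geom.
rewrite -umbralN -!umbralD.
have -> : 'X * geom * g - geom * g + g = 'X^(k.+1) * g.
  by rewrite -mulrBl geom_telescope; ring.
by rewrite umbralXnM umbral_shift2 shift_polyD -natr1 addrK.
Qed.

Lemma umbral_forest_poly N :
  umbral (forest_poly N)
  = poly_pair (euler_poly N) (fun j => shift_poly (k * j)%:R (rising_poly N)).
Proof.
rewrite forest_polyE umbral_sum (poly_pair_widen _ (size_euler_poly N)).
apply: eq_bigr => j _; rewrite umbralCM mul_polyC; congr (_ *: _).
elim: (j : nat) => [|i IHi] /=; first by rewrite umbralC muln0 shift_poly0.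
by rewrite umbral_ascent_op IHi shift_polyD -natrD mulnS.
Qed.

End RisingOperators.

(** * Expansion over signed vertex types into products of linear factors *)

Section SignedTypes.
Variable k : nat.
Local Open Scope ring_scope.
Local Notation Ty := (option ('I_k.+1 * bool)).

(* A type assigned to a vertex stands for a bound on the colours of its child
   edges: None for colours above k1 + 1, Some (a, b) for colours above
   k1 + 1 - a, with that colour itself allowed on decreasing edges if b. *)
Definition type_sign (t : Ty) : rat := if t is Some (_, false) then -1 else 1.
Definition type_base (t : Ty) : nat := if t is Some (a, _) then a else 0.
Definition type_bonus (t : Ty) : nat := if t is Some (_, b) then b else 0.

Lemma sum_types (V : nmodType) (G : Ty -> V) :
  \sum_(t : Ty) G t
  = G None + \sum_(a < k.+1) G (Some (a, true)) + \sum_(a < k.+1) G (Some (a, false)).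
Proof.
rewrite (bigD1 None) //= -addrA; congr (_ + _).
rewrite (reindex_omap Some id) /=; last by case.
under eq_bigl => i do rewrite eqxx.
transitivity (\sum_(a < k.+1) \sum_(b : bool) G (Some (a, b))).
  by rewrite pair_bigA; apply: eq_bigr => -[].
by rewrite -big_split; apply: eq_bigr => a _; rewrite big_bool.
Qed.

Lemma forest_polyS N :
  forest_poly k N.+1 = ('X : {poly rat})%:P * \sum_(t : Ty)
    (type_sign t)%:P%:P * 'X^(type_base t) * shift2 (type_bonus t)%:R (forest_poly k N).
Proof.
rewrite [forest_poly k N.+1]/= -/(forest_poly k N); congr (_ * _).
set f := forest_poly k N; rewrite sum_types /= shift2_ascent_op.
have s0 : shift2 0 f = f by apply/polyP => i; rewrite coef_map /= shift_poly0.
rewrite !s0 !polyC1 !mul1r /ascent_op shift2NK -!mulr_suml.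
rewrite !polyCN !polyC1 -!mulr_sumr -[\sum_(i < _) 'X^i]/(geom k).
ring.
Qed.

(** Vertices are added in increasing order: the bonus of the new type shifts the factors of all
    smaller vertices, while the new factor [Y] has not yet received any bonus. *)
Lemma forest_poly_types N :
  forest_poly k N = \sum_(tau : {ffun 'I_N -> Ty})
    (\prod_v type_sign (tau v))%:P%:P * 'X^(\sum_v type_base (tau v))
    * (\prod_(w < N) ('X + (\sum_(v < N | (w < v)%N) type_bonus (tau v))%:R%:P))%:P.
Proof.
elim: N => [|N IHN].
  rewrite (big_pred1 (finfun (of_void Ty \o (fun i : 'I_0 => False_rect _ (notF (valP i)))))); last first.
    by move=> f; apply/esym/eqP/ffunP => -[].
  by rewrite !big_ord0 expr0 !mul1r.
rewrite forest_polyS IHN big_ffun_ord_recr mulr_sumr; apply: eq_bigr => t _.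
rewrite rmorph_sum !mulr_sumr; apply: eq_bigr => f _.
pose g : {ffun 'I_N.+1 -> Ty} := [ffun i => if unlift ord_max i is Some j then f j else t].
rewrite -/g.
have gmax : g ord_max = t by rewrite ffunE unlift_none.
have gw (i : 'I_N) : g (widen_ord (leqnSn N) i) = f i.
  rewrite ffunE; have -> : widen_ord (leqnSn N) i = lift ord_max i.
    by apply: val_inj; rewrite [RHS]lift_max.
  by rewrite liftK.
have -> : \prod_v type_sign (g v) = (\prod_v type_sign (f v)) * type_sign t.
  by rewrite big_ord_recr gmax; congr (_ * _); apply: eq_bigr => v _; rewrite gw.
have -> : (\sum_v type_base (g v) = \sum_v type_base (f v) + type_base t)%N.
  by rewrite big_ord_recr gmax; congr (_ + _)%N; apply: eq_bigr => v _; rewrite gw.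
rewrite [X in _ = _ * X%:P]big_ord_recr /=.
rewrite [X in 'X + X%:R%:P]big1 ?addr0; last first.
  by move=> v; rewrite ltnNge -ltnS ltn_ord.
have -> : \prod_(w < N) ('X + (\sum_(v < N.+1 | (w < v)%N) type_bonus (g v))%:R%:P)
  = shift_poly (type_bonus t)%:R
      (\prod_(w < N) ('X + (\sum_(v < N | (w < v)%N) type_bonus (f v))%:R%:P)).
  rewrite rmorph_prod; apply: eq_bigr => w _.
  rewrite rmorphD /= shift_polyX shift_polyC -addrA -polyCD -natrD addnC.
  rewrite big_mkcond big_ord_recr /= ltn_ord gmax [in RHS]big_mkcond.
  by congr ('X + (_ + _)%N%:R%:P); apply: eq_bigr => v _; rewrite gw.
rewrite !polyCM 2!rmorphM /= rmorphXn /= !shift2C shift2X shift_polyC exprD; ring.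
Qed.

Lemma poly_pair_euler_types N :
  poly_pair (euler_poly N) (fun j => shift_poly (k * j)%:R (rising_poly N))
  = \sum_(tau : {ffun 'I_N -> Ty}) (\prod_v type_sign (tau v))%:P
    * \prod_(w < N) ('X + ((\sum_v type_base (tau v))
                           + \sum_(v < N | (w < v)%N) type_bonus (tau v))%:R%:P).
Proof.
rewrite -umbral_forest_poly forest_poly_types umbral_sum; apply: eq_bigr => tau _.
rewrite -mulrA umbralCM umbralXnM umbralC; congr (_ * _).
rewrite rmorph_prod; apply: eq_bigr => w _.
by rewrite rmorphD /= shift_polyX shift_polyC -addrA -polyCD -natrD.
Qed.

Lemma poly_pair_euler_types_horner N (y : rat) :
  poly_pair (euler_poly N) (fun j => ((rising_poly N).[y + (k * j)%:R] : rat^o))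
  = \sum_(tau : {ffun 'I_N -> Ty}) (\prod_v type_sign (tau v))
    * \prod_(w < N) (y + ((\sum_v type_base (tau v))
                           + \sum_(v < N | (w < v)%N) type_bonus (tau v))%:R).
Proof.
have := congr1 (horner^~ y) (poly_pair_euler_types N).
rewrite /poly_pair !horner_sum => e.
rewrite (eq_bigr (fun j : 'I_(size (euler_poly N)) =>
  ((euler_poly N)`_j *: shift_poly (k * j)%:R (rising_poly N)).[y])).
  rewrite e; apply: eq_bigr => tau _; rewrite hornerCM horner_prod; congr (_ * _).
  by apply: eq_bigr => w _; rewrite hornerD hornerX hornerC.
by move=> j _; rewrite hornerZ horner_comp hornerD hornerX hornerC.
Qed.

End SignedTypes.

(** * Sums over rooted trees *)

Section ParentFunctions.
Variable V : finType.
Implicit Types (F g : {ffun V -> option V}) (v w : V).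

(** Rooted forests are encoded by parent functions, with [None] at the roots; paths of [step] run
    from a vertex towards its root. *)
Definition step F : rel V := fun w v => F w == Some v.
Definition acyclic F :=
  [forall w, forall v, step F w v ==> ~~ connect (step F) v w].
Definition roots F := [set w | F w == None]%SET.
Definition extends F g := [forall w, (F w != None) ==> (g w == F w)].
Definition is_tree g := acyclic g && (#|roots g| == 1).
Definition graft F w v : {ffun V -> option V} := [ffun x => if x == w then Some v else F x].

Lemma acyclicP F :
  reflect (forall w v, F w = Some v -> ~~ connect (step F) v w) (acyclic F).
Proof.
apply: (iffP forallP) => [h w v e|h w].
  by have /forallP/(_ v)/implyP := h w; apply; rewrite /step e.
by apply/forallP => v; apply/implyP => /eqP; apply: h.
Qed.

Lemma connect_step F w x :
  connect (step F) w x -> x = w \/ exists2 v, F w = Some v & connect (step F) v x.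
Proof.
case/connectP => -[|v p] /=; first by move=> _ ->; left.
case/andP => /eqP e hp ->; right; exists v => //.
by apply/connectP; exists p.
Qed.

Lemma root_exists F w : acyclic F -> exists2 x, x \in roots F & connect (step F) w x.
Proof.
move=> /acyclicP aF; move: {2}(#|connect (step F) w|) (leqnn #|connect (step F) w|) => m.
elim: m w => [|m IHm] w hm.
  by move: hm; rewrite leqn0 => /eqP/card0_eq/(_ w); rewrite inE connect0.
case e: (F w) => [v|]; last by exists w; rewrite ?inE ?e // connect0.
have cwv : connect (step F) w v by apply: connect1; rewrite /step e.
have [|x hx cx] := IHm v; last by exists x => //; apply: connect_trans cx.
rewrite -ltnS; apply: leq_trans hm; apply: proper_card; apply/properP; split.
  by apply/fintype.subsetP => x; rewrite !inE; apply: connect_trans.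
by exists w; rewrite inE ?connect0 // aF.
Qed.

Lemma root_unique F w x y : x \in roots F -> y \in roots F ->
  connect (step F) w x -> connect (step F) w y -> x = y.
Proof.
rewrite !inE => /eqP ex /eqP ey /connectP[p]; elim: p w => [|v p IHp] w /=.
  by move=> _ xw /connect_step[->//|[v]]; rewrite -xw ex.
case/andP => /eqP ew hp el /connect_step[e|[v']]; first by rewrite -e ey in ew.
by rewrite ew => -[<-]; apply: IHp.
Qed.

(** Hanging a root below v closes a cycle only for the root of the tree containing v. *)
Lemma card_grafts F v : acyclic F ->
  #|[set w in roots F | ~~ connect (step F) v w]%SET| = #|roots F|.-1.
Proof.
move=> aF; have [x hx cx] := root_exists v aF.
rewrite [RHS](_ : _ = #|roots F :\ x|%SET); last by rewrite (cardsD1 x (roots F)) hx.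
apply: eq_card => w; rewrite !inE andbC; case e: (F w == None); rewrite ?andbF //= !andbT.
apply/idP/idP => [|wx]; first by apply: contraNneq => ->.
apply: contraNN wx => cw; apply/eqP; apply: (root_unique _ _ cw cx) => //.
by rewrite inE e.
Qed.

Lemma connect_graft F w v a b : F w = None -> connect (step (graft F w v)) a b ->
  connect (step F) a b \/ (connect (step F) a w /\ connect (step F) v b).
Proof.
move=> ew /connectP[p]; elim: p a => [|a' p IHp] a /=.
  by move=> _ ->; left; apply: connect0.
case/andP; rewrite {1}/step ffunE; case: (a =P w) => [-> /eqP[<-]|_ ea] hp el.
  by right; split; rewrite ?connect0 //; case: (IHp _ hp el) => [|[]].
have ca : connect (step F) a a' by apply: connect1.
case: (IHp _ hp el) => [h|[h1 h2]]; [left|right; split=> //]; exact: connect_trans ca _.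
Qed.

Lemma connect_sub_graft F w v a b : F w = None ->
  connect (step F) a b -> connect (step (graft F w v)) a b.
Proof.
move=> ew; apply: connect_sub => x y; rewrite /step => /eqP e; apply: connect1.
by rewrite /step ffunE; case: (x =P w) e => [->|_ ->] //; rewrite ew.
Qed.

Lemma acyclic_graft F w v : acyclic F -> F w = None ->
  acyclic (graft F w v) = ~~ connect (step F) v w.
Proof.
move=> /acyclicP aF ew; apply/acyclicP/idP => [h|ncvw].
  by apply: contraNN (h w v _) => [|]; [exact: connect_sub_graft|rewrite ffunE eqxx].
move=> x y; rewrite ffunE; case: (x =P w) => [-> [<-]|_ exy]; apply/negP => c.
  by case: (connect_graft ew c) => [|[]]; rewrite ?(negPf ncvw) //.
case: (connect_graft ew c) => [|[c1 c2]]; first by rewrite (negPf (aF _ _ exy)).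
case/negP: ncvw; apply: connect_trans c2 _; apply: connect_trans c1.
by apply: connect1; rewrite /step exy.
Qed.

Lemma extends_acyclic F g : extends F g -> acyclic g -> acyclic F.
Proof.
move=> /forallP eFg /acyclicP ag; apply/acyclicP => w v e.
have sub a b : F a = Some b -> g a = Some b.
  by move=> ea; have := eFg a; rewrite ea /= => /eqP.
apply: contraNN (ag w v (sub _ _ e)); apply: connect_sub => a b /eqP ea.
by apply: connect1; rewrite /step (sub _ _ ea).
Qed.

Lemma extends_graft F g w v : F w = None ->
  extends (graft F w v) g = extends F g && (g w == Some v).
Proof.
move=> ew; apply/forallP/andP => [h|[/forallP h /eqP gw] x].
  split; last by have := h w; rewrite ffunE eqxx.
  by apply/forallP => x; have := h x; rewrite ffunE; case: (x =P w) => [->|//]; rewrite ew.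
by rewrite ffunE; case: (x =P w) => [->|_]; [rewrite gw eqxx|exact: h].
Qed.

Section Weights.
Local Open Scope ring_scope.
Variable alpha : V -> rat.

Definition tree_weight F g : rat :=
  \prod_(w | F w == None) (if g w is Some v then alpha v else 1).

Definition tree_sum F : rat := \sum_(g | is_tree g && extends F g) tree_weight F g.

Lemma tree_weight_graft F g w v : F w = None -> g w = Some v ->
  tree_weight F g = alpha v * tree_weight (graft F w v) g.
Proof.
move=> ew gw; rewrite /tree_weight (bigD1 w) ?ew //= gw; congr (_ * _).
by apply: eq_bigl => x; rewrite ffunE; case: (x =P w) => [->|_]; rewrite ?andbT ?andbF.
Qed.

Lemma roots_extends F g : extends F g -> roots g \subset roots F.
Proof.
move=> /forallP h; apply/fintype.subsetP => w; rewrite !inE => /eqP e.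
by have := h w; rewrite e; case: (F w).
Qed.

(* Pitman's double counting: mark one of the edges added to F. *)
Lemma tree_sumE F r : acyclic F -> #|roots F| = r.+1 ->
  tree_sum F = (\sum_v alpha v) ^+ r.
Proof.
elim: r F => [|r IHr] F aF cF.
  have only g : is_tree g && extends F g = (g == F).
    apply/andP/eqP => [[/andP[ag /eqP cg] eFg]|->]; last first.
      by rewrite /is_tree aF cF eqxx; split=> //; apply/forallP => w; apply/implyP.
    have /setP er : roots g = roots F.
      by apply/eqP; rewrite eqEcard roots_extends //= cF cg.
    apply/ffunP => w; have := er w; rewrite !inE.
    case e: (F w) => [v|] h; last exact/eqP.
    by have /forallP/(_ w) := eFg; rewrite e => /eqP.
  rewrite /tree_sum (eq_bigl _ _ only) big_pred1_eq expr0 /tree_weight big1 // => w /eqP -> //.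
have nz : r.+1%:R != 0 :> rat by rewrite pnatr_eq0.
apply: (mulfI nz).
(* A tree g extending F is counted once for each root of F that is not a root of g; F has r + 2
   roots and g has one, so r + 1 times. *)
transitivity (\sum_(w | F w == None) \sum_v alpha v * tree_sum (graft F w v)).
  under [RHS]eq_bigr => w /eqP ew.
    under eq_bigr => v _.
      rewrite /tree_sum mulr_sumr.
      rewrite (eq_bigl (fun g => (is_tree g && extends F g) && (g w == Some v))); last first.
        by move=> g; rewrite extends_graft // andbA.
      rewrite (eq_bigr (fun g => tree_weight F g)); last first.
        by move=> g /andP[_ /eqP gw]; rewrite (tree_weight_graft ew gw).
      rewrite big_mkcondr /=.
      over.
    rewrite exchange_big /=.
    over.
  rewrite exchange_big mulr_sumr; apply: eq_bigr => g /andP[/andP[_ /eqP cg] eFg].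
  transitivity (\sum_(w | F w == None) (if g w != None then tree_weight F g else 0)).
    rewrite -big_mkcondr /= sumr_const mulr_natl; congr (_ *+ _).
    have := cardsD (roots F) (roots g); rewrite (finset.setIidPr (roots_extends eFg)) cF cg subSS subn0.
    move=> <-; apply: eq_card => w; rewrite !inE unfold_in /= andbC; by [].
  apply: eq_bigr => w _; case e: (g w) => [v|] /=; last by rewrite big1.
  rewrite (bigD1 v) //= eqxx big1 ?addr0 // => v' nv; case: eqP => // -[ev].
  by rewrite ev eqxx in nv.
(* A graft closing a cycle extends to no tree; any other graft has one root less, and the induction
   hypothesis applies. *)
have tsg w v : F w == None ->
  tree_sum (graft F w v) = if connect (step F) v w then 0 else (\sum_v alpha v) ^+ r.
  move=> /eqP ew; have := acyclic_graft v aF ew; case: ifP => c ag; last first.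
    apply: IHr => //; apply/eqP; rewrite -eqSS -cF (cardsD1 w (roots F)) inE ew eqxx.
    rewrite eqSS; apply/eqP/eq_card => x; by rewrite !inE ffunE; case: (x =P w).
  rewrite /tree_sum big_pred0 // => g; apply/negP => /andP[/andP[acg _] /extends_acyclic h].
  by rewrite h in ag.
rewrite exchange_big exprS mulr_suml mulr_sumr; apply: eq_bigr => v _.
transitivity (\sum_(w | (F w == None) && ~~ connect (step F) v w)
                alpha v * (\sum_v alpha v) ^+ r).
  rewrite big_mkcondr; apply: eq_bigr => w ew; rewrite tsg //.
  by case: ifP; rewrite ?mulr0.
rewrite sumr_const mulr_natl; congr (_ *+ _).
rewrite -[r.+1]/(r.+2.-1) -cF -(card_grafts v aF).
by apply: eq_card => w; rewrite !inE.
Qed.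

End Weights.
End ParentFunctions.

(** * Tree sums with an extra weight on edges to a larger parent *)

Section OrderedWeights.
Variable N : nat.
Local Open Scope ring_scope.
Local Notation V := 'I_N.+1.

Lemma decreasing_acyclic (F : {ffun V -> option V}) :
  (forall w v, F w = Some v -> (w < v)%N) -> acyclic F.
Proof.
move=> dF; apply/acyclicP => w v e; apply/negP => /connectP[p hp el].
have : (v <= last v p)%N.
  elim: p v {e el} hp => [|u p IHp] v //= /andP[/eqP/dF h /IHp]; apply: leq_trans; exact: ltnW.
by rewrite -el leqNgt dF.
Qed.

(** Expanding each factor records in F the edges taken with their [eps] summand. They lead from
    smaller to larger vertices, so F is a forest with the largest vertex among its roots, and
    [tree_sumE] turns the sum over the trees extending F into one factor [\sum_v alpha v] for every
    other root. The sum over F then factors again, vertex by vertex. *)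
Lemma tree_sum_ordered (alpha eps : V -> rat) :
  \sum_(g : {ffun V -> option V} | is_tree g)
    \prod_w (if g w is Some v then alpha v + (if (w < v)%N then eps v else 0) else 1)
  = \prod_(w < N.+1 | w != ord_max)
      (\sum_v alpha v + \sum_(v < N.+1 | (w < v)%N) eps v).
Proof.
(* The argument [o] is the choice made in the factor of w: [Some v] takes the [eps] summand, [None]
   the remaining one. *)
pose h (w : V) (o gw : option V) : rat :=
  if o is Some v then (if (gw == Some v) && (w < v)%N then eps v else 0)
  else if gw is Some v then alpha v else 1.
pose s := \sum_v alpha v.
pose c (w : V) (o : option V) : rat :=
  if o is Some v then (if (w < v)%N then eps v else 0)
  else if w == ord_max then 1 else s.
have sum_opt (G : option V -> rat) : \sum_o G o = G None + \sum_v G (Some v).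
  rewrite (bigD1 None) //=; congr (_ + _).
  rewrite (reindex_omap Some id) /=; last by case.
  by apply: eq_bigl => v; rewrite eqxx.
transitivity (\sum_(g : {ffun V -> option V} | is_tree g)
    \sum_(F : {ffun V -> option V}) \prod_w h w (F w) (g w)).
  apply: eq_bigr => g _; rewrite -(bigA_distr_bigA (fun w o => h w o (g w))) /=; apply: eq_bigr => w _.
  rewrite sum_opt /h; case: (g w) => [v|]; last by rewrite big1 ?addr0.
  rewrite (bigD1 v) //= eqxx /= big1 ?addr0 // => u nuv.
  by case: eqP => //= -[e]; rewrite e eqxx in nuv.
rewrite exchange_big /=.
transitivity (\sum_(F : {ffun V -> option V}) \prod_w c w (F w)); last first.
  rewrite -(bigA_distr_bigA c) [RHS]big_mkcond; apply: eq_bigr => w _.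
  rewrite sum_opt /c -big_mkcond /=; case: eqP => [->|//].
  rewrite big_pred0 ?addr0 // => v; apply/negbTE; rewrite -leqNgt /=.
  by rewrite -ltnS ltn_ord.
apply: eq_bigr => F _.
have [dF|] := boolP [forall w, if F w is Some v then (w < v)%N else true]; last first.
  case/forallPn => w hw; rewrite [RHS](bigD1 w) //= /c.
  case e: (F w) hw => [v|] // /negbTE hw; rewrite hw mul0r big1 // => g _.
  by rewrite (bigD1 w) //= e /h hw andbF mul0r.
have dF' w v : F w = Some v -> (w < v)%N by move=> e; have /forallP/(_ w) := dF; rewrite e.
have aF := decreasing_acyclic dF'.
have rmax : ord_max \in roots F.
  rewrite inE; case e: (F ord_max) => [v|//]; have := dF' _ _ e; have := ltn_ord v; rewrite /=; lia.
have cF : #|roots F| = (#|roots F :\ ord_max|%SET).+1 by rewrite (cardsD1 ord_max (roots F)) rmax.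
have -> : \prod_w c w (F w) = (\prod_(w | F w != None) (if F w is Some v then eps v else 1))
    * s ^+ #|roots F :\ ord_max|%SET.
  rewrite (bigID (fun w => F w != None)) /=; congr (_ * _).
    apply: eq_bigr => w; case e: (F w) => [v|] // _; by rewrite /c (dF' _ _ e).
  rewrite -prodr_const (bigD1 ord_max) /=; last by move: rmax; rewrite inE negbK.
  move: (rmax); rewrite inE => /eqP ->; rewrite /c eqxx mul1r; apply: eq_big => w.
    by rewrite !inE negbK andbC.
  by case/andP; rewrite negbK => /eqP -> /negbTE ->.
rewrite -(tree_sumE alpha aF cF) /tree_sum mulr_sumr [RHS]big_mkcondr /=.
apply: eq_bigr => g _; case: ifP => [/forallP eFg|/negbT/forallPn[w]].
  rewrite (bigID (fun w => F w != None)) /=; congr (_ * _).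
    apply: eq_bigr => w nw; have := eFg w; rewrite nw /= => /eqP ->.
    by case e: (F w) nw => [v|] // _; rewrite /h eqxx (dF' _ _ e).
  rewrite /tree_weight; apply: eq_big => w; first by rewrite negbK.
  by rewrite negbK => /eqP ->.
case e: (F w) => [v|] //= /negbTE nw; rewrite (bigD1 w) //= e /h nw.
by rewrite mul0r.
Qed.

End OrderedWeights.

(** * Weighted enumeration of decreasing colored trees *)

Section ColoredTrees.
Variables N k1 k2 : nat.
Local Notation V := 'I_N.+1.
Local Notation K := (k1 + 1 + k2)%N.
Local Notation Col := 'I_K.
Local Notation TE := (V * V * Col)%type.
Local Notation Ty := (option ('I_k1.+1 * bool)).
Implicit Types (c : {ffun V -> option (V * Col)}) (T : {set TE}).

(** A child determines its parent and the color of its edge, so a tree is encoded as a partial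
    function of the child; uniqueness of the parent is then built in. *)
Definition edge_set c : {set TE} := [set t | c t.1.2 == Some (t.1.1, t.2)]%SET.
Definition parent_color T : {ffun V -> option (V * Col)} :=
  [ffun w => [pick vc : V * Col | (vc.1, w, vc.2) \in T]].
Definition parent c : {ffun V -> option V} := [ffun w => omap fst (c w)].

Lemma in_edge_set c v w col : ((v, w, col) \in edge_set c) = (c w == Some (v, col)).
Proof. by rewrite inE. Qed.

Lemma parent_colorK T : colored_rooted_tree T -> edge_set (parent_color T) = T.
Proof.
case/and4P => _ _ /forallP uT _; apply/setP => -[[v w] col]; rewrite in_edge_set ffunE.
case: pickP => [[v' col'] h|h].
  apply/eqP/idP => [[<- <-] //|h']; congr Some.
  have /implyP/(_ h)/forallP/(_ (v, w, col))/implyP/(_ h')/implyP := uT (v', w, col').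
  by rewrite eqxx => /(_ isT)/eqP[-> ->].
by apply/esym; exact: (h (v, col)).
Qed.

Lemma edge_setK c : parent_color (edge_set c) = c.
Proof.
apply/ffunP => w; rewrite ffunE; case: pickP => [[v col]|h].
  by rewrite in_edge_set => /eqP.
case e: (c w) => [[v col]|] //.
by have := h (v, col); rewrite in_edge_set e eqxx.
Qed.

Lemma card_edge_set c : (#|edge_set c| + #|roots (parent c)| = N.+1)%N.
Proof.
have -> : #|edge_set c| = #|~: roots (parent c)|%SET.
  rewrite -(card_in_imset (f := fun t : TE => t.1.2) (D := mem (edge_set c))); last first.
    move=> [[v w] col] [[v' w'] col']; rewrite /= !in_edge_set => /eqP e /eqP e' ew.
    by move: e'; rewrite -ew e => -[-> ->].
  apply: eq_card => w; rewrite !inE ffunE; apply/imsetP/idP => [[[[v w'] col]]|].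
    by rewrite in_edge_set => /eqP e -> /=; rewrite e.
  case e: (c w) => [[v col]|] // _.
  by exists (v, w, col); rewrite // in_edge_set e.
by rewrite addnC cardsC card_ord.
Qed.

Lemma colored_rooted_tree_edge_set c :
  colored_rooted_tree (edge_set c) = is_tree (parent c).
Proof.
have pE u w : parent_rel (edge_set c) u w = step (parent c) w u.
  rewrite /step ffunE; apply/existsP/eqP => [[col]|].
    by rewrite in_edge_set => /eqP ->.
  case e: (c w) => [[v col]|] //= [vu]; exists col.
  by rewrite in_edge_set e vu.
have cE u w : connect (parent_rel (edge_set c)) u w = connect (step (parent c)) w u.
  have -> : connect (parent_rel (edge_set c)) u w
      = connect (fun x y => step (parent c) y x) u w by apply: eq_connect.
  by rewrite -[RHS]connect_rev.
have cT := card_edge_set c.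
have -> : is_tree (parent c) = (#|edge_set c| == N) && acyclic (parent c).
  by rewrite /is_tree andbC; congr (_ && _); lia.
apply/and4P/andP => [[-> _ _ /forallP h]|[cN /acyclicP aF]].
  split=> //; apply/forallP => w; apply/forallP => u.
  by have /forallP/(_ w) := h u; rewrite pE cE.
split=> //.
- apply/forallP => -[[v w] col]; apply/implyP; rewrite in_edge_set /= => /eqP e.
  have /aF : parent c w = Some v by rewrite ffunE e.
  by apply: contraNneq => ->; apply: connect0.
- apply/forallP => -[[v w] col]; apply/implyP; rewrite in_edge_set /= => /eqP e.
  apply/forallP => -[[v' w'] col']; apply/implyP; rewrite in_edge_set /= => /eqP e'.
  by apply/implyP => /eqP ew; move: e'; rewrite -ew e => -[-> ->].
apply/forallP => u; apply/forallP => w; apply/implyP; rewrite pE cE => /eqP.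
exact: aF.
Qed.

Lemma big_colored_rooted_tree (P : pred {set TE}) (G : {set TE} -> rat) :
  (\sum_(T : {set TE} | colored_rooted_tree T && P T) G T
   = \sum_(c | is_tree (parent c) && P (edge_set c)) G (edge_set c))%R.
Proof.
rewrite (reindex_onto edge_set parent_color) /=; last first.
  by move=> T /andP[hT _]; apply: parent_colorK.
by apply: eq_bigl => c; rewrite colored_rooted_tree_edge_set edge_setK eqxx andbT.
Qed.

Definition locally_decreasing c (v : V) : bool :=
  [forall w, forall col, [&& c w == Some (v, col), (col < k1 + 1)%N &
     [forall w', forall col', (c w' == Some (v, col')) ==> (col <= col')%N]]
     ==> (w < v)%N].

(** The condition at the largest vertex always holds, as all its children are smaller. Hence that
    vertex gets no type, and its edges are free to carry the weight x. *)
Lemma decreasing_edge_set c : is_tree (parent c) ->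
  decreasing (k1 + 1) (edge_set c)
  = [forall j : 'I_N, locally_decreasing c (lift ord_max j)].
Proof.
move=> /andP[/acyclicP aF _].
have minE v (col : Col) : [forall t' in edge_set c, (t'.1.1 == v) ==> (col <= t'.2)%N]
  = [forall w', forall col', (c w' == Some (v, col')) ==> (col <= col')%N].
  apply/forallP/forallP => [h w'|h [[v' w'] col']].
    apply/forallP => col'; apply/implyP => e; have := h (v, w', col').
    by rewrite in_edge_set e /= eqxx.
  rewrite in_edge_set /=; apply/implyP => e; apply/implyP => /eqP ev; rewrite ev in e.
  by have /forallP/(_ col')/implyP := h w'; apply.
apply/forallP/forallP => [h j|h [[v w] col]].
  apply/forallP => w; apply/forallP => col; apply/implyP => /and3P[e hc hm].
  have := h (lift ord_max j, w, col); rewrite in_edge_set e /=.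
  by rewrite minE hm hc /=.
apply/implyP; rewrite in_edge_set /= => e; apply/implyP; rewrite minE => /andP[hc hm].
case: (unliftP ord_max v) => [j|] ev.
  have /forallP/(_ w)/forallP/(_ col)/implyP := h j; rewrite -ev; apply.
  by rewrite e hc.
have /aF : parent c w = Some v by rewrite ffunE (eqP e).
move=> nc; rewrite ltn_neqAle {2}ev -ltnS ltn_ord andbT.
by apply: contraNneq nc => /val_inj ->; apply: connect0.
Qed.

(** Colors start at 0, so those subject to the decreasing condition are the ones up to [k1], and
    [k1 - a] runs through them. *)
Definition allowed (t : Ty) (v w : V) (col : Col) : bool :=
  if t is Some (a, b) then (k1 - a < col) || [&& b, (col : nat) == k1 - a & w < v]
  else k1 < col.

Local Open Scope ring_scope.

(* Summed over the possible minimal colours, the conditions "all child edges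
   have colour at least m, and those of colour m are decreasing" minus "all
   child edges have colour above m" leave only the true minimal colour. *)
Lemma locally_decreasing_types c v :
  (locally_decreasing c v)%:R
  = \sum_(t : Ty) type_sign t *
      \prod_w (if c w is Some (v', col) then
                 (if v' == v then (allowed t v w col)%:R else 1) else 1) :> rat.
Proof.
pose al t := [forall w, if c w is Some (v', col) then (v' == v) ==> allowed t v w col else true].
have prodE t : \prod_w (if c w is Some (v', col) then
    (if v' == v then (allowed t v w col)%:R else 1) else 1) = (al t)%:R :> rat.
  case: (boolP (al t)) => [/forallP h|/forallPn[w]].
    rewrite big1 // => w _; have := h w; case: (c w) => [[v' col]|] //.
    by case: eqP => //= _ ->.
  rewrite (bigD1 w) //=; case: (c w) => [[v' col]|] //.
  by case: eqP => //= _ /negbTE ->; rewrite mul0r.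
under eq_bigr do rewrite prodE.
rewrite sum_types /= mul1r -addrA -big_split /=.
pose ch w (col : Col) := c w == Some (v, col).
have alP t : reflect (forall w col, ch w col -> allowed t v w col) (al t).
  apply: (iffP forallP) => [h w col /eqP e|h w].
    by have := h w; rewrite e eqxx.
  case e: (c w) => [[v' col]|] //; apply/implyP => /eqP ev; apply: h.
  by rewrite /ch e ev.
have [all_hi|] := boolP (al None).
  have hi w col : ch w col -> (k1 < col)%N by move/alP: all_hi; apply.
  have -> : locally_decreasing c v.
    apply/forallP => w; apply/forallP => col; apply/implyP => /and3P[/hi]; lia.
  rewrite big1 ?addr0 // => a _.
  have -> : al (Some (a, true)) by apply/alP => w col /hi h; rewrite /allowed; lia.
  have -> : al (Some (a, false)) by apply/alP => w col /hi h; rewrite /allowed; lia.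
  by ring.
move=> nal; have [w0 [col0 [h0 lt0 min0]]] : exists w0 col0,
    [/\ ch w0 col0, (col0 <= k1)%N & forall w col, ch w col -> (col0 <= col)%N].
  have [w1 [col1 [h1 lt1]]] : exists w1 (col1 : Col), ch w1 col1 /\ (col1 <= k1)%N.
    apply: contrapT => hn; case/negP: nal; apply/alP => w col h /=.
    by rewrite ltnNge; apply/negP => h'; apply: hn; exists w, col.
  pose P (q : V * Col) := ch q.1 q.2.
  have P1 : P (w1, col1) by [].
  case: (arg_minnP (fun q : V * Col => q.2 : nat) P1) => -[w0 col0] hP hmin.
  exists w0, col0; split=> //; first by apply: leq_trans (hmin _ P1) lt1.
  by move=> w col h; apply: (hmin (w, col)).
have a0P : (k1 - col0 < k1.+1)%N by rewrite ltnS leq_subr.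
pose a0 : 'I_k1.+1 := Ordinal a0P.
(* The pair of types with [k1 - a = col0] gives the condition itself. For smaller [k1 - a] both
   members hold and cancel; for larger ones both fail. *)
rewrite add0r (bigD1 a0) //= big1 ?addr0 => [|a na].
  have -> : al (Some (a0, false)) = false.
    by apply/negP => /alP/(_ _ _ h0); rewrite /allowed /= subKn // ltnn.
  rewrite mulr0 addr0 mul1r; congr (_%:R); congr nat_of_bool.
  apply/forallP/alP => [h w col hw|h w].
    rewrite /allowed /= subKn //; have := min0 _ _ hw.
    rewrite leq_eqVlt => /orP[/eqP/val_inj e|->//]; rewrite -e ltnn eqxx /=.
    have lt1 : (col0 < k1 + 1)%N by lia.
    have /forallP/(_ col)/implyP := h w; apply; rewrite -/(ch w col) hw -e lt1 /=.
    by apply/forallP => w'; apply/forallP => col'; apply/implyP => /min0.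
  apply/forallP => col; apply/implyP => /and3P[hw hc hm].
  have le1 : (col <= col0)%N by have /forallP/(_ w0)/forallP/(_ col0)/implyP := hm; apply.
  have := h _ _ hw; rewrite /allowed /= subKn //; lia.
case: (ltnP (k1 - a) col0) => hlt.
  have -> : al (Some (a, true)) by apply/alP => w col /min0 h; rewrite /allowed; lia.
  have -> : al (Some (a, false)) by apply/alP => w col /min0 h; rewrite /allowed; lia.
  by ring.
have ne : (k1 - a != col0)%N.
  apply: contraNneq na => e; apply/eqP/val_inj => /=; have := ltn_ord a; lia.
have -> : al (Some (a, true)) = false.
  by apply/negP => /alP/(_ _ _ h0); rewrite /allowed; lia.
have -> : al (Some (a, false)) = false.
  by apply/negP => /alP/(_ _ _ h0); rewrite /allowed; lia.
by ring.
Qed.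

Definition top_color_weight (x : rat) (o : option (V * Col)) : rat :=
  if o is Some (v, col) then (if ((v : nat) == N) && ((col : nat) == 0%N) then x else 1)
  else 1.

Lemma exp_n_edges_col1 x c :
  x ^+ n_edges_col1 (edge_set c) = \prod_w top_color_weight x (c w).
Proof.
pose P w := if c w is Some (v, col) then ((v : nat) == N) && ((col : nat) == 0%N) else false.
have -> : n_edges_col1 (edge_set c) = #|[set w | P w]%SET|.
  rewrite /n_edges_col1 /= -(card_in_imset (f := fun t : TE => t.1.2)); last first.
    move=> [[v w] col] [[v' w'] col']; rewrite inE [in X in _ -> X]inE /= !in_edge_set.
    move=> /andP[/eqP e _] /andP[/eqP e' _] ew.
    by move: e'; rewrite -ew e => -[-> ->].
  apply: eq_card => w; rewrite !inE /P; apply/imsetP/idP => [[[[v w'] col]]|].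
    by rewrite inE in_edge_set /= => /andP[/eqP e h] ->; rewrite e.
  case e: (c w) => [[v col]|] // h.
  by exists (v, w, col); rewrite // inE in_edge_set e eqxx.
rewrite -prodr_const big_mkcond; apply: eq_bigr => w _.
rewrite inE /P /top_color_weight; by case: (c w) => [[v col]|].
Qed.

Definition typed_weight (x : rat) (tau : {ffun 'I_N -> Ty}) (w : V) (o : option (V * Col)) : rat :=
  if o is Some (v, col) then
    (if unlift ord_max v is Some j then (allowed (tau j) v w col)%:R
     else if (col : nat) == 0%N then x else 1)
  else 1.

Lemma sum_decreasing_trees_types x :
  \sum_(T : {set TE} | colored_rooted_tree T && decreasing (k1 + 1) T) x ^+ n_edges_col1 T
  = \sum_(tau : {ffun 'I_N -> Ty}) (\prod_j type_sign (tau j)) *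
      \sum_(c | is_tree (parent c)) \prod_w typed_weight x tau w (c w).
Proof.
rewrite big_colored_rooted_tree big_mkcondr /=.
under [RHS]eq_bigr do rewrite mulr_sumr.
rewrite exchange_big; apply: eq_bigr => c tc.
rewrite decreasing_edge_set // exp_n_edges_col1.
transitivity ((\prod_j (locally_decreasing c (lift ord_max j))%:R)
              * \prod_w top_color_weight x (c w)).
  case: forallP => [h|/forallP/forallPn[j nj]].
    by rewrite [X in _ = X * _]big1 ?mul1r // => j _; rewrite h.
  by rewrite (bigD1 j) //= (negbTE nj) !mul0r.
under eq_bigr do rewrite locally_decreasing_types.
rewrite bigA_distr_bigA mulr_suml; apply: eq_bigr => tau _.
rewrite big_split -mulrA; congr (_ * _).
rewrite exchange_big -big_split; apply: eq_bigr => w _ /=.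
rewrite /top_color_weight /typed_weight; case: (c w) => [[v col]|]; last by rewrite big1 ?mulr1.
case: unliftP => [j ev|->].
  rewrite (bigD1 j) //= -ev eqxx big1 ?mulr1 => [|i ij].
    rewrite [(v : nat) == N]ltn_eqF ?mulr1 // ev lift_max; exact: ltn_ord.
  by rewrite ev (inj_eq (@lift_inj _ ord_max)) eq_sym (negbTE ij).
rewrite eqxx /= big1 ?mul1r // => j _.
by rewrite (negbTE (neq_lift _ _)).
Qed.

Lemma sum_ord_gt (m M : nat) : \sum_(i < M) (m < i)%N%:R = (M - m.+1)%:R :> rat.
Proof.
elim: M => [|M IHM]; first by rewrite big_ord0.
rewrite big_ord_recr IHM /= -natrD; congr (_%:R); lia.
Qed.

(** Exactly [k2 + a] colors lie above [k1 - a], and the bonus color is open only when w < v. At the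
    largest vertex the first color weighs x and the other [k1 + k2] weigh 1. *)
Lemma sum_typed_weight x tau w (o : option V) :
  \sum_(o' : option (V * Col) | omap fst o' == o) typed_weight x tau w o'
  = if o is Some v then
      (if unlift ord_max v is Some j then (k2 + type_base (tau j))%:R
       else x + (k1 + k2)%:R)
      + (if (w < v)%N then
           (if unlift ord_max v is Some j then (type_bonus (tau j))%:R else 0) else 0)
    else 1.
Proof.
case: o => [v|]; last first.
  by rewrite (big_pred1 None) // => -[].
have -> : \sum_(o' : option (V * Col) | omap fst o' == Some v) typed_weight x tau w o'
  = \sum_(col : Col) typed_weight x tau w (Some (v, col)).
  rewrite (reindex_omap (fun col => Some (v, col)) (omap snd)) /=; last first.
    by move=> [[v' col]|] //= /eqP[->].
  by apply: eq_bigl => col; rewrite !eqxx.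
rewrite /typed_weight; case: (unliftP ord_max v) => [j ev|ev].
  case: (tau j) => [[a b]|] /=; last first.
    rewrite sum_ord_gt; case: ifP => _; rewrite addr0; congr (_%:R); lia.
  transitivity (\sum_(col < K) ((k1 - a < col)%N%:R
                 + (if (col : nat) == (k1 - a)%N then (b && (w < v)%N)%:R else 0)) : rat).
    apply: eq_bigr => col _; case: eqP => [->|_]; rewrite ?ltnn ?add0r ?andbF ?orbF ?addr0 //.
  rewrite big_split /= sum_ord_gt -big_mkcond /=; congr (_ + _).
    by congr (_%:R); have := ltn_ord a; lia.
  have hK : (k1 - a < K)%N by lia.
  rewrite (big_pred1 (Ordinal hK)) //.
  by case: ifP; rewrite ?andbT ?andbF.
have hK : (0 < K)%N by lia.
rewrite (bigD1 (Ordinal hK)) //= (eq_bigr (fun=> 1)) => [|col nc]; last first.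
  by rewrite -[_ == 0%N]/(col == Ordinal hK) (negbTE nc).
rewrite if_same addr0 sumr_const; congr (_ + _%:R).
by rewrite cardC1 card_ord; lia.
Qed.

Lemma unlift_widen (i : 'I_N) : unlift ord_max (widen_ord (leqnSn N) i) = Some i.
Proof.
have -> : widen_ord (leqnSn N) i = lift ord_max i.
  by apply: val_inj; rewrite [RHS]lift_max.
by rewrite liftK.
Qed.

(** For a fixed parent function the colors are summed edge by edge, and [tree_sum_ordered] produces
    the linear factors of [poly_pair_euler_types_horner]. The constant consists of [k1 + k2] from
    the largest vertex and [k2] from each of the N others. *)
Lemma sum_decreasing_trees x :
  \sum_(T : {set TE} | colored_rooted_tree T && decreasing (k1 + 1) T) x ^+ n_edges_col1 T
  = poly_pair (euler_poly N) (fun j =>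
      ((rising_poly N).[x + (k1 + N.+1 * k2)%:R + (k1 * j)%:R] : rat^o)).
Proof.
rewrite poly_pair_euler_types_horner sum_decreasing_trees_types.
apply: eq_bigr => tau _; congr (_ * _).
rewrite (partition_big parent (@is_tree _)) //=.
pose alpha (v : V) : rat := if unlift ord_max v is Some j then (k2 + type_base (tau j))%:R
       else x + (k1 + k2)%:R.
pose eps (v : V) : rat := if unlift ord_max v is Some j then (type_bonus (tau j))%:R else 0.
transitivity (\sum_(g : {ffun V -> option V} | is_tree g)
    \prod_w (if g w is Some v then alpha v + (if (w < v)%N then eps v else 0) else 1)).
  apply: eq_bigr => g tg.
  transitivity (\prod_w \sum_(o | omap fst o == g w) typed_weight x tau w o); last first.
    by apply: eq_bigr => w _; rewrite sum_typed_weight.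
  rewrite (bigA_distr_big_dep (fun w o => omap fst o == g w) (typed_weight x tau)); apply: eq_bigl => c.
  apply/andP/familyP => [[_ /eqP <-] w|h]; first by rewrite unfold_in ffunE.
  have e : parent c = g by apply/ffunP => w; rewrite ffunE; apply/eqP; apply: h.
  by rewrite e tg.
rewrite tree_sum_ordered big_mkcond big_ord_recr eqxx /= mulr1; apply: eq_bigr => w _ /=.
rewrite ifT; last by rewrite -val_eqE /= ltn_eqF.
have -> : \sum_v alpha v = x + (k1 + N.+1 * k2)%:R + (\sum_v type_base (tau v))%:R.
  rewrite big_ord_recr /alpha /= unlift_none.
  under eq_bigr do rewrite unlift_widen natrD.
  rewrite big_split /= sumr_const card_ord -natr_sum; ring.
have -> : \sum_(v < N.+1 | (w < v)%N) eps v
    = (\sum_(v < N | (w < v)%N) type_bonus (tau v))%:R.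
  rewrite big_mkcond big_ord_recr /= ltn_ord /eps unlift_none addr0.
  under eq_bigr do rewrite unlift_widen.
  by rewrite -big_mkcond -natr_sum.
ring.
Qed.

End ColoredTrees.

(** * Placements of labels on a line *)

Section Placements.
Variables (n k1 k2 M Q : nat).
Hypothesis leQM : (Q <= M)%N.
Local Notation V := 'I_n.
Local Notation pos := 'I_M.+1.
Implicit Types (S : {set V}) (a b : V) (x : {ffun V -> pos}) (p : nat).

(** Least distance from label a to a later label b in a proper coloring; ascents pay the extra [k1].
    The two values come from [noncongruent_gap]. *)
Definition gap a b : nat := k2.+1 + (if (a < b)%N then k1 else 0).

Definition separated S x := [forall i in S, forall j in S,
  ((i != j) && (x i <= x j)%N) ==> (x i + gap i j <= x j)%N].

(** The label a stands at p, to the left of all labels of S. Labels outside S are parked at 0, so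
    that a function on all labels represents each placement of S once. *)
Definition placed S a p x := [&& [forall i in S, (p + gap a i <= x i <= Q)%N],
  separated S x & [forall i, (i \notin S) ==> (x i == ord0)]].

Definition placements S a p := [set x | placed S a p x]%SET.

Lemma placedP S a p x : reflect
  [/\ forall i, i \in S -> (p + gap a i <= x i <= Q)%N,
      forall i j, i \in S -> j \in S -> i != j -> (x i <= x j)%N ->
        (x i + gap i j <= x j)%N
    & forall i, i \notin S -> x i = ord0] (placed S a p x).
Proof.
apply: (iffP and3P) => [[/forallP h1 /forallP h2 /forallP h3]|[h1 h2 h3]]; split.
- by move=> i iS; have /implyP := h1 i; apply.
- move=> i j iS jS ij le; have /implyP/(_ iS)/forallP/(_ j)/implyP/(_ jS)/implyP := h2 i.
  by apply; rewrite ij.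
- by move=> i iS; apply/eqP; have /implyP := h3 i; apply.
- by apply/forallP => i; apply/implyP; apply: h1.
- apply/forallP => i; apply/implyP => iS; apply/forallP => j; apply/implyP => jS.
  by apply/implyP => /andP[]; apply: h2.
by apply/forallP => i; apply/implyP => /h3 ->.
Qed.

Definition leftmost S x b := (b \in S) && [forall i in S, (i != b) ==> (x b < x i)%N].

Lemma leftmostP S x b : reflect
  (b \in S /\ forall i, i \in S -> i != b -> (x b < x i)%N) (leftmost S x b).
Proof.
apply: (iffP andP) => -[bS h]; split=> //.
  by move=> i iS ib; have /forallP/(_ i)/implyP/(_ iS)/implyP := h; apply.
by apply/forallP => i; apply/implyP => iS; apply/implyP; apply: h.
Qed.

Definition move_to b (y : pos) x : {ffun V -> pos} := [ffun i => if i == b then y else x i].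

(** If a < i, then a < b or b < i, so the extra [k1] is also paid along the detour. This is why only
    consecutive labels interact. *)
Lemma gap_triangle a b (i : V) : (gap a i <= gap a b + gap b i)%N.
Proof.
by rewrite /gap; case: (ltnP a i) => ?; case: (ltnP a b) => ?; case: (ltnP b i) => ?; lia.
Qed.

(** With b leftmost and at y, the other labels form a placement to the right of b; by [gap_triangle]
    their constraints with a follow from those with b. *)
Lemma card_placements_leftmost S a p b (y : pos) : b \in S ->
  #|[set x in placements S a p | leftmost S x b && (x b == y)]%SET|
  = if (p + gap a b <= y <= Q)%N then #|placements (S :\ b) b y| else 0.
Proof.
move=> bS; case: ifP => [hy|/negP hy]; last first.
  apply: eq_card0 => x; rewrite !inE; apply/negP => /andP[/placedP[h _ _] /andP[_ /eqP e]].
  by apply: hy; rewrite -e; apply: h.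
rewrite -(card_in_imset (f := move_to b ord0)); last first.
  move=> x x'; rewrite !inE => /andP[_ /andP[_ /eqP e]] /andP[_ /andP[_ /eqP e']] /ffunP h.
  apply/ffunP => i; have := h i; rewrite !ffunE; case: (i =P b) => [->|//].
  by rewrite e e'.
apply: eq_card => x; apply/imsetP/idP => [[z]|].
  rewrite !inE => /andP[/placedP[h1 h2 h3] /andP[/leftmostP[_ lb] /eqP e]] ->.
  apply/placedP; split=> [i|i j|i]; rewrite !inE ?ffunE.
  - case/andP => ib iS; rewrite (negbTE ib); have /andP[_ ->] := h1 i iS.
    by rewrite andbT -e; apply: h2; rewrite // ?(eq_sym b) // ltnW // lb.
  - by case/andP => /negbTE -> iS /andP[/negbTE -> jS]; apply: h2.
  by rewrite negb_and negbK; case: eqP => //= _; apply: h3.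
rewrite inE => /placedP[h1 h2 h3]; exists (move_to b y x); last first.
  apply/ffunP => i; rewrite !ffunE; case: eqP => // ->; apply: h3.
  by rewrite !inE eqxx.
have xi i : i \in S -> i != b -> (y + gap b i <= x i <= Q)%N.
  by move=> iS ib; apply: h1; rewrite !inE ib.
rewrite !inE !ffunE !eqxx andbT; apply/andP; split.
  apply/placedP; split=> [i iS|i j iS jS|i iS]; rewrite !ffunE.
  - case: (i =P b) => [->//|/eqP ib]; have /andP[l1 ->] := xi i iS ib; rewrite andbT.
    apply: leq_trans l1; have /andP[l2 _] := hy.
    apply: leq_trans (leq_add l2 (leqnn (gap b i))).
    by rewrite -addnA leq_add2l gap_triangle.
  - case: (i =P b) => [->|/eqP ib]; case: (j =P b) => [->|/eqP jb] ij; rewrite ?eqxx // in ij *.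
    + by move=> _; have /andP[] := xi j jS jb.
    + have /andP[l1 _] := xi i iS ib => l2.
      by move: (leq_trans l1 l2); rewrite -{2}[y : nat]addn0 leq_add2l.
    by apply: h2 => //; rewrite !inE ?ib ?jb.
  case: (i =P b) => [ib|/eqP ib]; first by rewrite ib bS in iS.
  by apply: h3; rewrite !inE negb_and iS orbT.
apply/leftmostP; split=> // i iS ib; rewrite !ffunE eqxx (negbTE ib).
have /andP[l1 _] := xi i iS ib; apply: leq_trans l1.
by rewrite -addn1 leq_add2l.
Qed.

Lemma card_placementsE S a p : S != finset.set0 ->
  #|placements S a p| = (\sum_(b in S) \sum_(y : pos | p + gap a b <= y <= Q)
                          #|placements (S :\ b) b y|)%N.
Proof.
move=> S0; rewrite -sum1_card.
transitivity (\sum_(x in placements S a p) \sum_(b in S) \sum_(y : pos)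
                (leftmost S x b && (x b == y)))%N.
  apply: eq_bigr => x; rewrite inE => /placedP[h1 h2 h3].
  have [c cS] : exists c, c \in S by apply/set0Pn.
  case: (arg_minnP (fun i => x i : nat) cS) => b bS bmin.
  have lb : leftmost S x b.
    apply/leftmostP; split=> // i iS ib; rewrite ltn_neqAle bmin // andbT.
    apply: contraNneq ib => e; apply/eqP; apply: contraPP (h2 _ _ bS iS) => /eqP ib.
    rewrite eq_sym ib -e leqnn => /(_ isT isT); rewrite /gap; lia.
  rewrite (bigD1 b) //= (bigD1 (x b)) //= lb eqxx /= big1 => [|y /negbTE ny]; last first.
    by rewrite eq_sym ny.
  rewrite big1 ?addn0 // => i /andP[iS ib]; apply: big1 => y _.
  case: leftmostP => //= -[_ li]; have := li b bS; rewrite eq_sym => /(_ ib).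
  by rewrite ltnNge bmin.
rewrite exchange_big; apply: eq_bigr => b bS.
rewrite exchange_big [RHS]big_mkcond; apply: eq_bigr => y _.
rewrite -card_placements_leftmost // -sum1_card big_mkcond [RHS]big_mkcond.
by apply: eq_bigr => x _; rewrite !inE; case: (placed _ _ _ _).
Qed.

(** Subtraction is truncated, so for m = 0 the summands with Q - y < c would still count 1; the
    hypothesis rules this out. *)
Lemma hockey_stick (c s m : nat) : (0 < m)%N || (c == 0) ->
  (\sum_(y : pos | s <= y <= Q) 'C(Q - y - c, m) = 'C(Q.+1 - s - c, m.+1))%N.
Proof.
move=> hm.
rewrite (eq_bigl (fun y : pos => (s <= y)%N && (y < Q.+1)%N)); last by [].
rewrite -(big_ord_widen_cond M.+1 (fun y => s <= y) (fun y => 'C(Q - y - c, m))) //.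
have [|hs] := leqP Q.+1 s.
  move=> hs; rewrite big_pred0 => [|y]; first by have -> : (Q.+1 - s = 0)%N by lia.
  by apply/negbTE; rewrite -ltnNge (leq_trans (ltn_ord y)).
have -> : (\sum_(i < Q.+1 | s <= i) 'C(Q - i - c, m) = \sum_(i < Q.+1 - s) 'C(i - c, m))%N.
  rewrite (big_ord_widen _ (fun u : nat => 'C(u - c, m)) (leq_subr s Q.+1)).
  rewrite (reindex_inj rev_ord_inj) /=; apply: eq_big => i; first by have := ltn_ord i; lia.
  by move=> _; congr 'C(_ - _, _); have := ltn_ord i; lia.
elim: (Q.+1 - s)%N => [|u IHu]; first by rewrite big_ord0 sub0n.
rewrite big_ord_recr IHu /=; have [|huc] := leqP c u.
  by move=> huc; rewrite subSn // binS.
have -> : (u - c = 0)%N by lia.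
have -> : (u.+1 - c = 0)%N by lia.
rewrite bin0n; case/orP: hm => [|/eqP c0]; [by case: (m) | lia].
Qed.

Definition rank S b := #|[set i in S | (i < b)%N]%SET|.

Lemma big_rank (W : nmodType) (G : nat -> W) S :
  (\sum_(b in S) G (rank S b) = \sum_(i < #|S|) G i)%R.
Proof.
have [S0|] := posnP #|S|.
  by rewrite S0 big_ord0 big_pred0 // => b; rewrite (cards0_eq S0) inE.
case E: #|S| => [//|m] _.
have rlt b : b \in S -> (rank S b < m.+1)%N.
  move=> bS; rewrite -E; apply: proper_card; apply/properP; split.
    by apply/fintype.subsetP => i; rewrite inE => /andP[].
  by exists b; rewrite // inE ltnn andbF.
have rinj : {in S &, injective (fun b => inord (rank S b) : 'I_m.+1)}.
  move=> b b' bS b'S /(congr1 val); rewrite /= !inordK ?rlt // => e.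
  have lt_rank (c c' : V) : c \in S -> (c < c')%N -> (rank S c < rank S c')%N.
    move=> cS cc'; apply: proper_card; apply/properP; split.
      by apply/fintype.subsetP => i; rewrite !inE => /andP[-> /ltn_trans]; apply.
    by exists c; rewrite !inE ?ltnn ?andbF // cS.
  apply: val_inj; case: (ltngtP b b') => // [/(lt_rank _ _ bS)|/(lt_rank _ _ b'S)];
    rewrite /= e ltnn //.
have im : [set (inord (rank S b) : 'I_m.+1) | b in S]%SET = [set: 'I_m.+1]%SET.
  by apply/eqP; rewrite eqEcard finset.subsetT cardsT card_ord card_in_imset // E leqnn.
transitivity (\sum_(i in [set: 'I_m.+1]%SET) G i)%R; last by apply: eq_bigl => i; rewrite inE.
by rewrite -im big_imset //=; apply: eq_bigr => b bS; rewrite inordK ?rlt.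
Qed.

Lemma ltn_rank S a b : a \notin S -> b \in S -> (rank S b < rank S a)%N = (b < a)%N.
Proof.
move=> aS bS; case: (ltngtP b a) => [ba|ab|/val_inj e]; last by rewrite -e bS in aS.
  apply: proper_card; apply/properP; split.
    by apply/fintype.subsetP => i; rewrite !inE => /andP[-> /ltn_trans]; apply.
  by exists b; rewrite !inE ?ltnn ?andbF // bS.
apply/negbTE; rewrite -leqNgt; apply: subset_leq_card.
by apply/fintype.subsetP => i; rewrite !inE => /andP[-> /ltn_trans]; apply.
Qed.

Local Open Scope ring_scope.

(** Read from left to right, the labels form a word beginning with a. With j ascents its gaps take
    up [#|S| * k2.+1 + k1 * j] positions, and distributing the slack gives the binomial coefficient;
    [reuler_poly] counts the words by j. *)
Lemma card_placements S a p : a \notin S -> (p <= Q)%N ->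
  #|placements S a p|%:R = poly_pair (reuler_poly (rank S a) (#|S| - rank S a))
    (fun j => ('C(Q - p - #|S| * k2 - k1 * j, #|S|)%:R : rat^o)).
Proof.
move E: #|S| => m; elim: m S a p E => [|m IHm] S a p E aS hp.
  have S0 := cards0_eq E.
  have -> : rank S a = 0%N by apply: eq_card0 => i; rewrite !inE S0 inE.
  rewrite S0 poly_pair1 bin0; apply/eqP; rewrite eqr_nat; apply/eqP.
  rewrite (_ : placements _ _ _ = [set [ffun=> ord0]]%SET) ?cards1 //.
  apply/setP => x; rewrite !inE; apply/placedP/eqP => [[_ _ h]|->].
    by apply/ffunP => i; rewrite ffunE h // inE.
  by split=> [i|i j|i]; rewrite ?inE // ffunE.
have S0 : S != finset.set0 by rewrite -card_gt0 E.
rewrite card_placementsE // natr_sum.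
have cS b : b \in S -> #|S :\ b|%SET = m.
  by move=> bS; have := cardsD1 b S; rewrite bS E => -[].
have rk b : b \in S -> rank (S :\ b)%SET b = rank S b.
  move=> bS; apply: eq_card => i; rewrite !inE; case: (i =P b) => [->|//].
  by rewrite ltnn !andbF.
pose phi j : rat^o := 'C(Q - p - m.+1 * k2 - k1 * j, m.+1)%:R.
transitivity (\sum_(b in S)
    poly_pair ((if (rank S b < rank S a)%N then 1 else 'X)
               * reuler_poly (rank S b) (m - rank S b)) phi).
  apply: eq_bigr => b bS; rewrite natr_sum.
  rewrite (eq_bigr (fun y : pos => poly_pair (reuler_poly (rank S b) (m - rank S b))
      (fun j => ('C(Q - y - (m * k2 + k1 * j), m)%:R : rat^o)))); last first.
    move=> y /andP[_ yQ]; rewrite (IHm _ _ _ (cS _ bS)) ?rk // ?inE ?eqxx //.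
    by apply: eq_poly_pair => j; rewrite subnDA.
  have gapE : gap a b = (k2.+1 + (if (rank S b < rank S a)%N then 0 else k1))%N.
    rewrite /gap ltn_rank //; case: (ltngtP a b) => // /val_inj e.
    by rewrite -e (negbTE aS) in bS.
  (* The extra [k1] of an ascent from a to b turns [phi j] into [phi j.+1]. *)
  transitivity (poly_pair (reuler_poly (rank S b) (m - rank S b)) (fun j =>
      if (rank S b < rank S a)%N then phi j else phi j.+1)); last first.
    by case: ifP => _; rewrite ?mul1r // poly_pairMX.
  rewrite /poly_pair exchange_big; apply: eq_bigr => i _; rewrite -scaler_sumr -natr_sum.
  move: (nat_of_ord i) => {i}j.
  have [m0|mj] := boolP ((0 < m)%N || (m * k2 + k1 * j == 0)%N).
    rewrite hockey_stick // gapE /phi; case: ifP => _; congr (_ *: _%:R); congr binomial.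
      by rewrite -!subnDA; lia.
    by rewrite -!subnDA mulnS; lia.
  have [m0 j0] : m = 0%N /\ (0 < j)%N.
    by move: mj; case: (m) => // ; case: (j) => //; rewrite mul0n muln0.
  rewrite nth_default ?scale0r // m0 sub0n.
  have -> : rank S b = 0%N.
    by apply/eqP; rewrite -leqn0 -(rk _ bS) -m0 -(cS _ bS); apply: subset_leq_card; apply/fintype.subsetP => i; rewrite inE => /andP[].
  by rewrite size_poly1.
rewrite -poly_pair_sum; congr poly_pair.
rewrite (big_rank (fun i : nat => (if (i < rank S a)%N then 1 else 'X) * reuler_poly i (m - i))) E.
have rle : (rank S a <= m.+1)%N.
  by rewrite -E; apply: subset_leq_card; apply/fintype.subsetP => i; rewrite inE => /andP[].
by rewrite reuler_poly_next ?subnKC.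
Qed.

End Placements.

(** * Connectivity and circles in gain graphs *)

Section Connectivity.
Variables n N : nat.
Local Notation V := 'I_n.
Local Notation E := (gedge n N).
Implicit Types (S B C : {set E}) (e f : E) (u v : V).

Lemma esrc_lt_edst e : (esrc e < edst e)%N.
Proof. exact: (valP e). Qed.

Lemma esrc_neq_edst e : esrc e != edst e.
Proof. by rewrite -val_eqE /= ltn_eqF ?esrc_lt_edst. Qed.

Lemma joins_sym e u v : joins e u v = joins e v u.
Proof. by rewrite /joins orbC. Qed.

Lemma joins_ends e : joins e (esrc e) (edst e).
Proof. by rewrite /joins !eqxx. Qed.

Definition other e u : V := if esrc e == u then edst e else esrc e.

Lemma joins_other e u v : joins e u v -> v = other e u.
Proof.
rewrite /joins /other => /orP[/andP[/eqP -> /eqP ->]|/andP[/eqP -> /eqP <-]].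
  by rewrite eqxx.
by case: eqP => // e'; have := esrc_neq_edst e; rewrite e' eqxx.
Qed.

Definition conn S : rel V := connect (adj S).

Lemma adjP S u v : reflect (exists2 e, e \in S & joins e u v) (adj S u v).
Proof. exact: exists_inP. Qed.

Lemma adj_sym S u v : adj S u v = adj S v u.
Proof. by apply/adjP/adjP => -[e eS je]; exists e; rewrite // joins_sym. Qed.

Lemma conn_sym S u v : conn S u v = conn S v u.
Proof. exact: (sym_connect_sym (adj_sym S)). Qed.

Lemma conn0 S u : conn S u u. Proof. exact: connect0. Qed.

Lemma conn_trans S v u w : conn S u v -> conn S v w -> conn S u w.
Proof. exact: connect_trans. Qed.

Lemma conn_edge S e : e \in S -> conn S (esrc e) (edst e).
Proof. by move=> eS; apply: connect1; apply/adjP; exists e; rewrite // joins_ends. Qed.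

Lemma conn_sub S S' : (forall e, e \in S -> conn S' (esrc e) (edst e)) ->
  forall u v, conn S u v -> conn S' u v.
Proof.
move=> h; apply: connect_sub => u v /adjP[e /h c].
case/orP => /andP[/eqP <- /eqP <-] //; by rewrite -/(conn S' _ _) conn_sym.
Qed.

Lemma conn_mono S S' u v : S \subset S' -> conn S u v -> conn S' u v.
Proof.
by move=> /fintype.subsetP sSS'; apply: conn_sub => e /sSS'; apply: conn_edge.
Qed.

Lemma conn_add S e u v : conn (e |: S)%SET u v ->
  [\/ conn S u v, conn S u (esrc e) /\ conn S (edst e) v
    | conn S u (edst e) /\ conn S (esrc e) v].
Proof.
case/connectP => p; elim: p u => [|w p IHp] u /=.
  by move=> _ ->; apply: Or31; apply: conn0.
case/andP => /adjP[f]; rewrite !inE => /orP[/eqP ->|fS] jf hp el.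
  have := IHp _ hp el; move: jf => /orP[] /andP[/eqP e1 /eqP e2]; rewrite -e1 -e2.
    by move=> [h|[_ h]|[_ h]]; [apply: Or32|apply: Or32|apply: Or31] => //; split; rewrite ?conn0.
  by move=> [h|[_ h]|[_ h]]; [apply: Or33|apply: Or31|apply: Or33] => //; split; rewrite ?conn0.
have uw : conn S u w by apply: connect1; apply/adjP; exists f.
have [h|[h1 h2]|[h1 h2]] := IHp _ hp el.
- by apply: Or31; apply: conn_trans h.
- by apply: Or32; split=> //; apply: conn_trans h1.
by apply: Or33; split=> //; apply: conn_trans h1.
Qed.

Lemma circle_walk_size s (es : seq E) : circle_walk s es -> size es = size s.
Proof.
case/and4P => _ _ _; rewrite all2E => /andP[/eqP -> _].
by rewrite size_zip size_rot minnn.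
Qed.

(** The steps of the walk start at the vertices of s and end at a rotation of the same list. *)
Lemma circle_telescope (W : zmodType) (x : V -> W) s (es : seq E) : circle_walk s es ->
  (\sum_(p <- zip es s) (x (other p.1 p.2) - x p.2) = 0)%R.
Proof.
case/and4P => _ _ _ h.
have gen r : size s = size r -> all2 (fun e p => joins e p.1 p.2) es (zip s r) ->
  (\sum_(p <- zip es s) (x (other p.1 p.2) - x p.2) = \sum_(v <- r) x v - \sum_(v <- s) x v)%R.
  elim: s es r {h} => [|u s IHs] [|e es] [|v r] //= => [_ _|[sr] /andP[j h]].
    by rewrite !big_nil subrr.
  rewrite !big_cons (IHs es r) // -(joins_other j) /=.
  by rewrite opprD addrACA.
rewrite (gen (rot 1 s)) ?size_rot //.
by rewrite (perm_big s) ?subrr //; rewrite perm_rot.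
Qed.

(** Controls one edge of a circle by all the others without rotating the walk: f occurs only once in
    it, so its term is the whole sum. *)
Lemma circle_single (W : zmodType) (D : E -> V -> W) s (es : seq E) f : circle_walk s es ->
  (\sum_(p <- zip es s) D p.1 p.2 = 0)%R -> f \in es ->
  (forall e u, e \in es -> e != f -> joins e u (other e u) -> D e u = 0%R) ->
  exists2 u, joins f u (other f u) & D f u = 0%R.
Proof.
move=> cw; have ss := circle_walk_size cw; case/and4P: cw => _ _ ues h s0 fes D0.
have jz p : p \in zip es s -> joins p.1 p.2 (other p.1 p.2).
  have : size s = size (rot 1 s) by rewrite size_rot.
  move: (rot 1 s) h => r; clear -ss.
  elim: s es r ss => [|u s IHs] [|e es] [|v r] //= [ss] /andP[j h] [sr].
  rewrite inE => /orP[/eqP -> /=|]; first by rewrite -(joins_other j).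
  exact: (IHs es r).
have [u fu] : exists u, (f, u) \in zip es s.
  have : f \in unzip1 (zip es s) by rewrite unzip1_zip ?ss.
  by case/mapP => -[e u] h' /= ->; exists u.
exists u; first exact: (jz (f, u)).
move: s0; rewrite (bigD1_seq (f, u)) //=; last by apply: zip_uniql.
rewrite big_seq_cond big1 ?addr0 // => -[e w] /andP[ez nez]; apply: D0.
- by have := map_f fst ez; rewrite -/unzip1 unzip1_zip ?ss.
- apply: contraNneq nez => /= ee; rewrite ee in ez *.
  have nu : uniq (unzip1 (zip es s)) by rewrite unzip1_zip ?ss.
  clear -nu fu ez; elim: (zip es s) nu fu ez => [|[e' w'] z IHz] //= /andP[nz uz].
  rewrite !inE => /orP[/eqP[e1 e2]|h1] /orP[/eqP[e3 e4]|h2].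
  + by rewrite e2 e4 e1.
  + by case/negP: nz; rewrite -e1; apply: (map_f fst h2).
  + by case/negP: nz; rewrite -e3; apply: (map_f fst h1).
  exact: IHz.
exact: (jz (e, w)).
Qed.

(** The indicator function of the component of [esrc f] in the circle without f is constant along
    all other edges, hence along f by [circle_single]. *)
Lemma is_circle_conn C f : is_circle C -> f \in C -> conn (C :\ f)%SET (esrc f) (edst f).
Proof.
move=> [s [es [cw ->]]]; rewrite inE => fes.
set S := (_ :\ f)%SET.
pose x v : int := if conn S (esrc f) v then 1%R else 0%R.
have [|u ju] := @circle_single _ (fun e u => x (other e u) - x u)%R s es f cw (circle_telescope x cw) fes.
  move=> e u ees nef j; apply/eqP; rewrite subr_eq0 /x.
  have uo : conn S u (other e u).
    by apply: connect1; apply/adjP; exists e; rewrite // !inE nef.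
  suff -> : conn S (esrc f) (other e u) = conn S (esrc f) u by [].
  apply/idP/idP => h; apply: conn_trans h _ => //; by rewrite conn_sym.
move: ju; rewrite /x /joins /other; case: eqP => [<- _|_]; first by rewrite conn0; case: ifP.
by rewrite /= eqxx /= => /eqP <-; rewrite conn0; case: ifP.
Qed.

(** The last clause serves the induction: the edge leaving u is new because u does not lie on the
    remaining path. *)
Lemma path_edges S u p : path (adj S) u p -> uniq (u :: p) ->
  exists es : seq E, [/\ all2 (fun e q => joins e q.1 q.2) es (zip (belast u p) p),
    {subset es <= S}, uniq es
    & forall e, e \in es -> (esrc e \in u :: p) && (edst e \in u :: p)].
Proof.
elim: p u => [|v p IHp] u /=; first by exists [::].
case/andP => /adjP[e eS je] hp /andP[uvp uq].
have [es [h1 h2 h3 h4]] := IHp v hp uq.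
exists (e :: es); split=> /=.
- by rewrite je.
- by move=> f; rewrite inE => /orP[/eqP ->|/h2].
- rewrite h3 andbT; apply/negP => /h4 /andP[s1 s2].
  case/negP: uvp; by case/orP: je => [/andP[/eqP <- _]|/andP[_ /eqP <-]].
move=> f; rewrite inE => /orP[/eqP ->|/h4/andP[f1 f2]]; last first.
  by rewrite [in X in X && _]in_cons f1 orbT in_cons f2 orbT.
by move/orP: je => [] /andP[/eqP -> /eqP ->]; rewrite !inE !eqxx ?orbT.
Qed.

Lemma conn_circle S f : f \notin S -> conn S (esrc f) (edst f) ->
  exists2 C, is_circle C & f \in C /\ (C :\ f \subset S)%SET.
Proof.
move=> fS /connectP[p0 hp0]; case: (shortenP hp0) => p hp uq _ el.
have [es [h1 h2 h3 h4]] := path_edges hp uq.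
have p0' : p != [::] by apply: contraNneq (esrc_neq_edst f) => pn; rewrite el pn.
exists [set e in rcons es f]%SET; last first.
  split; first by rewrite inE mem_rcons mem_head.
  apply/fintype.subsetP => e; rewrite !inE mem_rcons inE => /andP[/negbTE ->] /=.
  exact: h2.
exists (esrc f :: p), (rcons es f); split=> //; apply/and4P; split=> //.
- by case: (p) p0'.
- by rewrite rcons_uniq h3 andbT; apply: contraNN fS; apply: h2.
rewrite rot1_cons {1}lastI zip_rcons ?size_belast // all2E !size_rcons eqSS.
move: h1; rewrite all2E => /andP[/eqP sz h1]; rewrite sz eqxx zip_rcons //= all_rcons h1 andbT.
by rewrite /= -el joins_sym joins_ends.
Qed.

Lemma forestP S :
  forest S <-> forall e, e \in S -> ~~ conn (S :\ e)%SET (esrc e) (edst e).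
Proof.
split=> [fS e eS|h [C [sCS circ]]].
  apply/negP => /(conn_circle (negbT (setD11 _ _)))[C cC [eC sC]]; apply: fS; exists C; split=> //.
  apply/fintype.subsetP => f fC; have [->//|nfe] := eqVneq f e.
  have : f \in (C :\ e)%SET by rewrite !inE nfe.
  by move/(fintype.subsetP sC); rewrite !inE => /andP[].
have [f fC] : exists f, f \in C.
  case: circ => s [es [cw ->]]; have ss := circle_walk_size cw.
  by case/and4P: cw => + _ _ _; rewrite -ss; case: es ss => // f es _ _; exists f; rewrite inE mem_head.
have := h f (fintype.subsetP sCS _ fC); rewrite (conn_mono _ (is_circle_conn circ fC)) //.
exact: finset.setSD.
Qed.

Lemma forest0 : forest (finset.set0 : {set E}).
Proof. by apply/forestP => e; rewrite inE. Qed.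

Lemma forest_sub S S' : S \subset S' -> forest S' -> forest S.
Proof. by move=> sS fS' [C [sC cC]]; apply: fS'; exists C; split=> //; apply: fintype.subset_trans sS. Qed.

Lemma forest_add S e : e \notin S ->
  forest (e |: S)%SET <-> forest S /\ ~~ conn S (esrc e) (edst e).
Proof.
move=> eS; split=> [fe|[/forestP fS ne]].
  split; first by apply: forest_sub fe; apply: finset.subsetUr.
  move/forestP: fe => /(_ e); rewrite setU11 => /(_ isT).
  by rewrite setU1K.
apply/forestP => f; rewrite !inE => /orP[/eqP ->|fS']; first by rewrite setU1K.
have ef : e != f by apply: contraNneq eS => ->.
have -> : ((e |: S) :\ f = e |: (S :\ f))%SET.
  by apply/setP => g; rewrite !inE; case: (g =P e) => [->|]; rewrite ?ef.
have mono u v : conn (S :\ f)%SET u v -> conn S u v by apply: conn_mono; apply: finset.subD1set.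
have cf : conn S (esrc f) (edst f) by apply: conn_edge.
apply/negP => /conn_add[|[/mono c1 /mono c2]|[/mono c1 /mono c2]].
- by rewrite (negbTE (fS f fS')).
- case/negP: ne; rewrite conn_sym in c1; apply: conn_trans c1 _; apply: conn_trans cf _.
  by rewrite conn_sym.
case/negP: ne; apply: conn_trans c2 _; rewrite conn_sym in cf; apply: conn_trans cf _.
exact: c1.
Qed.

Lemma spanning_tree_bridge B e : spanning_tree B -> e \in B ->
  ~~ conn (B :\ e)%SET (esrc e) (edst e).
Proof. by move=> [/forestP h _]; apply: h. Qed.

(** Removing e leaves two components, and f joins them again. *)
Lemma spanning_tree_exchange B e f : spanning_tree B -> e \in B ->
  ~~ conn (B :\ e)%SET (esrc f) (edst f) -> spanning_tree (f |: (B :\ e))%SET.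
Proof.
move=> sB eB nf; have [fB cB] := sB.
have fBe : f \notin (B :\ e)%SET by apply: contraNN nf; apply: conn_edge.
split; first by apply/(forest_add fBe); split=> //; apply: forest_sub fB; apply: finset.subD1set.
set B' := (f |: _)%SET.
have mono u v : conn (B :\ e)%SET u v -> conn B' u v by apply: conn_mono; apply: finset.subsetUr.
have side u : conn (B :\ e)%SET u (esrc e) || conn (B :\ e)%SET u (edst e).
  have := cB u (esrc e); rewrite -{1}(finset.setD1K eB) => /conn_add[->//|[-> //]|[->]].
  by rewrite orbT.
have cf : conn B' (esrc f) (edst f) by apply: conn_edge; rewrite setU11.
have ce : conn B' (esrc e) (edst e).
  case/orP: (side (esrc f)) => h1; case/orP: (side (edst f)) => h2.
  - by case/negP: nf; apply: conn_trans h1 _; rewrite conn_sym.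
  - move: (mono _ _ h1) (mono _ _ h2); rewrite conn_sym => c1 c2.
    by apply: conn_trans c1 _; apply: conn_trans cf _.
  - move: (mono _ _ h1) (mono _ _ h2) => c1; rewrite conn_sym => c2.
    by apply: conn_trans c2 _; rewrite conn_sym in cf; apply: conn_trans cf _.
  by case/negP: nf; apply: conn_trans h1 _; rewrite conn_sym.
move=> u v; apply: (conn_sub _ (cB u v)) => g gB.
have [->//|nge] := eqVneq g e; apply: mono; apply: conn_edge.
by rewrite !inE nge.
Qed.

End Connectivity.

(** * Potentials satisfying edges of a gain graph *)

Section Potentials.
Variables (n N : nat) (a : int).
Local Notation V := 'I_n.
Local Notation E := (gedge n N).
Local Open Scope ring_scope.
Implicit Types (S B C X : {set E}) (e f : E) (u v : V).

Section Ring.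
Variable R : nzRingType.
Implicit Types x : V -> R.

(** Generic in the ring: integers modulo q serve the colorings, real numbers the points of the
    arrangement. *)
Definition sat x e := x (edst e) - x (esrc e) == (egain a e)%:~R.
Definition sats x : {set E} := [set e | sat x e]%SET.

Lemma sat_ogain x e u : joins e u (other e u) ->
  (x (other e u) - x u - (ogain a e u)%:~R == 0) = sat x e.
Proof.
rewrite /joins /other /ogain /sat; case: eqP => [<- _|_ /=]; first by rewrite subr_eq0.
rewrite eqxx /= => /eqP <-; rewrite intrN opprK addrC -[x (esrc e) - _]opprB subr_eq0.
by rewrite eq_sym.
Qed.

Lemma circle_gain x s es : circle_walk s es -> {subset es <= sats x} ->
  (\sum_(p <- zip es s) ogain a p.1 p.2)%:~R = 0 :> R.
Proof.
move=> cw ses; rewrite rmorph_sum /=.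
transitivity (\sum_(p <- zip es s) (x (other p.1 p.2) - x p.2)); last exact: circle_telescope.
rewrite big_seq [RHS]big_seq; apply: eq_bigr => -[e u] /= euz.
apply/esym/eqP; rewrite -subr_eq0.
have ss := circle_walk_size cw; case/and4P: cw => _ _ _ h.
have jz : joins e u (other e u).
  have : size s = size (rot 1 s) by rewrite size_rot.
  move: (rot 1 s) h euz => r; clear -ss.
  elim: s es r ss => [|w s IHs] [|f es] [|v r] //= [ss] /andP[j h] + [sr].
  rewrite inE => /orP[/eqP[-> ->] /=|]; first by rewrite -(joins_other j).
  by move=> euz; apply: (IHs es r).
rewrite sat_ogain //; have : e \in sats x.
  by apply: ses; have := map_f fst euz; rewrite -/unzip1 unzip1_zip ?ss.
by rewrite inE.
Qed.

(** The defects along the circle add up to minus its gain, which is zero; if all but one vanish, so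
    does the last. *)
Lemma balanced_circle_sats x C f : balanced_circle a C -> f \in C ->
  (C :\ f)%SET \subset sats x -> f \in sats x.
Proof.
move=> [s [es [cw -> s0]]]; rewrite inE => fes /fintype.subsetP sub.
have [||u ju] := @circle_single _ _ _ (fun e u => x (other e u) - x u - (ogain a e u)%:~R) s es f cw _ fes.
- by rewrite sumrB (circle_telescope x cw) -rmorph_sum s0 subrr.
- move=> e u ees nef j; apply/eqP; rewrite sat_ogain //.
  have : e \in sats x by apply: sub; rewrite !inE nef.
  by rewrite inE.
by move/eqP; rewrite sat_ogain // inE.
Qed.

(** Translating one component of S by d preserves the satisfied edges of S and changes the
    difference along an edge entering that component by d; potentials are corrected in this way one
    edge at a time. *)
Definition shift_on (K : pred V) (d : R) x : V -> R := fun v => if K v then x v + d else x v.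

Lemma shift_on_sat S e d x (K := conn S (edst e)) :
  S \subset sats x -> S \subset sats (shift_on K d x).
Proof.
move=> /fintype.subsetP h; apply/fintype.subsetP => f fS.
have := h f fS; rewrite !inE /sat /shift_on.
have -> : K (edst f) = K (esrc f).
  have cf := conn_edge fS.
  apply/idP/idP => c; apply: conn_trans c _ => //; by rewrite conn_sym.
by case: ifP => // _; rewrite opprD addrACA subrr addr0.
Qed.

Lemma shift_on_defect S e d x (K := conn S (edst e)) : ~~ conn S (esrc e) (edst e) ->
  shift_on K d x (edst e) - shift_on K d x (esrc e) = x (edst e) - x (esrc e) + d.
Proof. by move=> nc; rewrite /shift_on /K conn0 conn_sym (negbTE nc) addrAC. Qed.

Lemma forest_sat S : forest S -> exists x, S \subset sats x.
Proof.
move: {2}#|S| (erefl #|S|) => m; elim: m S => [|m IHm] S cS fS.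
  by exists (fun=> 0); rewrite (cards0_eq cS) finset.sub0set.
have [e eS] : exists e, e \in S by apply/set0Pn; rewrite -card_gt0 cS.
have eS' : e \notin (S :\ e)%SET by rewrite !inE eqxx.
move: fS; rewrite -{1}(finset.setD1K eS) => /(forest_add eS')[fS' nc].
have [|x hx] := IHm _ _ fS'; first by have := cardsD1 e S; rewrite eS cS => -[].
pose d := (egain a e)%:~R - (x (edst e) - x (esrc e)).
exists (shift_on (conn (S :\ e)%SET (edst e)) d x).
rewrite -{1}(finset.setD1K eS) finset.subUset finset.sub1set shift_on_sat // andbT inE /sat.
by rewrite shift_on_defect // addrC subrK.
Qed.

End Ring.

Section FiniteRing.
Variable R : finNzRingType.

Definition solutions S := [set x : {ffun V -> R} | S \subset sats x]%SET.

(** The edges of a forest are independent conditions: without e, the solutions split by their defect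
    at e into [#|R|] classes, which [shift_on] maps onto each other. *)
Lemma card_solutions S : forest S -> (#|solutions S| * #|R| ^ #|S| = #|R| ^ n)%N.
Proof.
move: {2}#|S| (erefl #|S|) => m; elim: m S => [|m IHm] S cS fS.
  rewrite cS expn0 muln1 (cards0_eq cS) (_ : solutions _ = [set: {ffun V -> R}]%SET).
    by rewrite cardsT card_ffun card_ord.
  by apply/setP => x; rewrite !inE finset.sub0set.
have [e eS] : exists e, e \in S by apply/set0Pn; rewrite -card_gt0 cS.
have eS' : e \notin (S :\ e)%SET by rewrite !inE eqxx.
move: fS; rewrite -{1}(finset.setD1K eS) => /(forest_add eS')[fS' nc].
have cS' : #|S :\ e|%SET = m by have := cardsD1 e S; rewrite eS cS => -[].
rewrite -(IHm _ cS' fS') cS' cS expnS mulnA; congr (_ * _)%N.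
pose S' := (S :\ e)%SET; pose K := conn S' (edst e).
pose def (x : {ffun V -> R}) : R := x (edst e) - x (esrc e) - (egain a e)%:~R.
have fib d : #|[set x in solutions S' | def x == d]%SET| = #|solutions S|.
  pose sh (d : R) (x : {ffun V -> R}) : {ffun V -> R} := finfun (shift_on K d x).
  have shE d' (x : {ffun V -> R}) : sh d' x =1 shift_on K d' x by move=> v; rewrite ffunE.
  have sS d' (x : {ffun V -> R}) : x \in solutions S' -> sh d' x \in solutions S'.
    rewrite !inE => h; apply: fintype.subset_trans (shift_on_sat e d' h) _.
    by apply/fintype.subsetP => f; rewrite !inE /sat !shE.
  have dS d' (x : {ffun V -> R}) : def (sh d' x) = def x + d'.
    by rewrite /def !shE shift_on_defect // addrAC.
  have shK d' : cancel (sh d') (sh (- d')).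
    move=> x; apply/ffunP => v; rewrite shE /shift_on shE /shift_on.
    by case: (K v); rewrite // addrK.
  rewrite -(card_imset _ (can_inj (shK (- d)))); apply: eq_card => x.
  have inS (z : {ffun V -> R}) : (z \in solutions S) = (z \in solutions S') && (def z == 0).
    rewrite !inE -{1}(finset.setD1K eS) finset.subUset finset.sub1set andbC inE /sat.
    by rewrite /def subr_eq0.
  apply/imsetP/idP => [[z]|].
    rewrite inE => /andP[zS /eqP dz] ->; by rewrite inS sS //= dS dz subrr.
  rewrite inS => /andP[xS /eqP dx]; exists (sh d x); last by rewrite shK.
  by rewrite inE sS //= dS dx add0r.
rewrite mulnC -[RHS]sum1_card (partition_big def predT) //=.
rewrite (eq_bigr (fun=> #|solutions S|)) ?sum_nat_const // => d _.
by rewrite -(fib d) -sum1_card; apply: eq_bigl => x; rewrite !inE.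
Qed.

(** Along a spanning tree a potential is determined by its value at one vertex. *)
Lemma card_solutions_tree B : (0 < n)%N -> spanning_tree B -> #|solutions B| = #|R|.
Proof.
move=> n0 [fB cB].
have [x0 hx0] : exists x0, x0 \in solutions B.
  have [x hx] := forest_sat R fB; exists (finfun x); rewrite inE.
  by apply: fintype.subset_trans hx _; apply/fintype.subsetP => f; rewrite !inE /sat !ffunE.
pose sh (d : R) : {ffun V -> R} := [ffun v => d + x0 v].
rewrite -cardsT -(card_imset [set: R]%SET (f := sh)); last first.
  by move=> d d' /ffunP/(_ (Ordinal n0)); rewrite !ffunE => /addIr.
apply: eq_card => x; apply/idP/imsetP => [xs|[d _ ->]]; last first.
  move: hx0; rewrite !inE => /fintype.subsetP h; apply/fintype.subsetP => f /h.
  by rewrite !inE /sat !ffunE opprD addrACA subrr add0r.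
exists (x (Ordinal n0) - x0 (Ordinal n0)); rewrite ?inE //; apply/ffunP => v.
rewrite ffunE; apply/eqP; rewrite -subr_eq; apply/eqP.
have /connectP[p hp ->] := cB (Ordinal n0) v.
elim: p (Ordinal n0) hp => [|w p IHp] u //= /andP[/adjP[e eB je] hp].
rewrite IHp //; move: xs hx0; rewrite !inE => /fintype.subsetP/(_ e eB) + /fintype.subsetP/(_ e eB).
rewrite !inE /sat => /eqP <- /eqP h.
have {}h : x (edst e) - x0 (edst e) = x (esrc e) - x0 (esrc e).
  have -> : x (edst e) = x0 (edst e) - x0 (esrc e) + x (esrc e) by rewrite h subrK.
  by rewrite addrC !addrA addNr add0r addrC.
by case/orP: je => /andP[/eqP <- /eqP <-].
Qed.

End FiniteRing.

(** The two counts of solutions over a ring with two elements are compared, and the exponents of 2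
    are read off. *)
Lemma card_spanning_tree B : (0 < n)%N -> spanning_tree B -> #|B| = n.-1.
Proof.
move=> n0 sB; have := card_solutions 'Z_2 (proj1 sB).
rewrite card_solutions_tree // card_ord -expnS => /eqP.
by rewrite eqn_exp2l // => /eqP/(congr1 predn).
Qed.

End Potentials.

(** * Broken circuits *)

Section BrokenCircuits.
Variables (n N : nat) (a : int).
Local Notation V := 'I_n.
Local Notation E := (gedge n N).
Variable ord : E -> nat.
Hypothesis ord_inj : injective ord.
Local Open Scope ring_scope.
Implicit Types (S B C X : {set E}) (e f : E) (u v : V).
Local Notation NBC := (NBC_set a ord).

Lemma NBC_sub S S' : S \subset S' -> NBC S' -> NBC S.
Proof.
move=> sS [fS nb]; split; first exact: forest_sub fS.
move=> [C [e [h1 h2 h3 h4]]]; apply: nb; exists C, e; split=> //.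
exact: fintype.subset_trans sS.
Qed.

Lemma NBC_set0 : NBC finset.set0.
Proof.
split; first exact: forest0.
move=> [C [e [[s [es [cw -> _]]] _ _]]]; have ss := circle_walk_size cw.
case/and4P: cw => + _ u _; rewrite -ss => s2 /fintype.subsetP sub.
have : es \subset [set e]%SET.
  apply/fintype.subsetP => f fes; rewrite inE; apply: contraT => nf.
  by have := sub f; rewrite !inE nf fes => /(_ isT).
by move/subset_leq_card; rewrite cards1 (card_uniqP u) leqNgt s2.
Qed.

Lemma balanced_is_circle C : balanced_circle a C -> is_circle C.
Proof. by move=> [s [es [h1 h2 _]]]; exists s, es. Qed.

(** The properties of a set of satisfied edges on which toggling relies. They are stated abstractly
    because they are used for potentials modulo q as well as for closures over the reals. *)
Definition gain_flat X :=
  (forall s es, circle_walk s es -> {subset es <= X} -> \sum_(p <- zip es s) ogain a p.1 p.2 = 0)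
  /\ (forall C f, balanced_circle a C -> f \in C -> (C :\ f)%SET \subset X -> f \in X).

Lemma NBC_add_min X S e : gain_flat X -> e \in X ->
  (forall f, f \in X -> (ord e <= ord f)%N) -> S \subset X -> e \notin S ->
  NBC S -> NBC (e |: S)%SET.
Proof.
move=> [bal cl] eX emin SX eS [fS nb].
have eSX : (e |: S)%SET \subset X by rewrite finset.subUset finset.sub1set eX.
split.
  apply/(forest_add eS); split=> //; apply/negP => /(conn_circle eS)[C cC [eC sC]].
  have CX : C \subset X.
    rewrite -(finset.setD1K eC) finset.subUset finset.sub1set eX.
    exact: fintype.subset_trans sC SX.
  apply: nb; exists C, e; split=> //.
    case: cC CX => s [es [cw ->]] /fintype.subsetP h; exists s, es; split=> //.
    by apply: bal => // f fes; apply: h; rewrite inE.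
  by move=> f /(fintype.subsetP CX); apply: emin.
move=> [C [f [bC fC fmin sC]]].
have fX : f \in X by apply: cl fC _ => //; apply: fintype.subset_trans sC eSX.
have [ef|nef] := eqVneq e f.
  apply: nb; exists C, f; split=> //; apply/fintype.subsetP => g gC.
  have := fintype.subsetP sC g gC; rewrite !inE => /orP[/eqP ge|//].
  by move: gC; rewrite ge ef !inE eqxx.
have [eC|neC] := boolP (e \in C).
  case/eqP: nef; apply: ord_inj; apply/eqP; rewrite eqn_leq emin //=.
  exact: fmin.
apply: nb; exists C, f; split=> //; apply/fintype.subsetP => g gC.
have := fintype.subsetP sC g gC; rewrite !inE => /orP[/eqP ge|//].
by move: gC; rewrite ge !inE (negbTE neC) andbF.
Qed.

Lemma sum_NBC_flat X : gain_flat X ->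
  \sum_(S : {set E} | `[< NBC S >] && (S \subset X)) (-1) ^+ #|S| = (X == finset.set0)%:R :> rat.
Proof.
move=> fX; have [->|X0] := eqVneq X finset.set0.
  rewrite (big_pred1 finset.set0) ?cards0 // => S; rewrite finset.subset0 andbC.
  case: (S =P finset.set0) => [->|/eqP/negbTE ne] /=; last by rewrite ne.
  by rewrite eqxx; apply/asboolP; apply: NBC_set0.
have [e0 e0X] : exists e, e \in X by apply/set0Pn.
case: (arg_minnP ord e0X) => e eX' emin; have {eX'} eX : e \in X := eX'.
rewrite (bigID (fun S : {set E} => e \in S)) /=.
rewrite (reindex_onto (fun S => e |: S)%SET (fun S => S :\ e)%SET) /=; last first.
  by move=> S /andP[_ eS]; rewrite finset.setD1K.
rewrite -[X in X + _]opprK -sumrN; apply/eqP; rewrite addrC subr_eq0; apply/eqP.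
apply: eq_big => S; last first.
  move=> /andP[_ eS]; rewrite cardsU1 eS add1n exprS mulN1r opprK //.
have [eS|neS] := boolP (e \in S).
  rewrite andbF; apply/esym/negbTE; rewrite negb_and.
  by apply/orP; right; apply: contraTneq eS => <-; rewrite !inE eqxx.
rewrite setU1K // eqxx setU11 !andbT finset.subUset finset.sub1set eX /=.
case SX: (S \subset X); rewrite ?andbF // !andbT.
apply/asboolP/asboolP => [|h]; first exact: NBC_add_min fX eX emin SX neS.
by apply: NBC_sub h; apply: finset.subsetUr.
Qed.

Hypotheses (n_gt0 : (0 < n)%N) (N_gt0 : (0 < N)%N).

Lemma edge_exists u v : u != v -> exists e : E, joins e u v.
Proof.
wlog uv : u v / (u < v)%N => [h nuv|_].
  case: (ltngtP u v) => [uv|vu|/val_inj e]; first exact: h.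
    by have [|e je] := h _ _ vu; rewrite 1?eq_sym //; exists e; rewrite joins_sym.
  by rewrite e eqxx in nuv.
pose t : V * V * 'I_N := (u, v, Ordinal N_gt0).
have tP : (t.1.1 < t.1.2)%N by [].
by exists (exist _ t tP); rewrite /joins /esrc /edst /= !eqxx.
Qed.

Lemma forest_extend S : forest S -> exists2 B, spanning_tree B & S \subset B.
Proof.
move=> fS; pose P B := `[< forest B >] && (S \subset B).
have PS : P S by apply/andP; split=> //; apply/asboolP.
case: (arg_maxnP (fun B : {set E} => #|B|) PS) => B /andP[/asboolP fB sB] bmax.
exists B => //; split=> // u v; apply: contraT => nc.
have [uv|uv] := eqVneq u v; first by rewrite uv connect0 in nc.
have [e je] := edge_exists uv.
have nce : ~~ conn B (esrc e) (edst e).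
  apply: contraNN nc => c; move: (je) => /orP[] /andP[/eqP <- /eqP <-] //.
  by rewrite -/(conn B _ _) conn_sym.
have eB : e \notin B by apply: contraNN nce; apply: conn_edge.
have := bmax (e |: B)%SET; rewrite cardsU1 eB add1n /= ltnn; apply.
rewrite /P; apply/andP; split; last by apply: fintype.subset_trans sB (finset.subsetUr _ _).
by apply/asboolP/(forest_add eB).
Qed.

Definition active_set B := [set e in B | `[< active ord B e >]]%SET.

Definition NBC_completion S B :=
  [&& `[< NBC_basis a ord B >], S \subset B & (B :\: S)%SET \subset active_set B].

(** A spanning tree containing S of least total order works: no exchange of an edge outside S lowers
    the total, so such an edge is active. A broken circuit not inside S would contain such an edge,
    exchangeable for the smaller edge missing from the circuit. *)
Lemma NBC_completion_exists S : NBC S -> exists B, NBC_completion S B.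
Proof.
move=> nS; have [B0 tB0 sB0] := forest_extend (proj1 nS).
pose P B := `[< spanning_tree B >] && (S \subset B).
have P0 : P B0 by apply/andP; split=> //; apply/asboolP.
case: (arg_minnP (fun B : {set E} => \sum_(e in B) ord e)%N P0) => B /andP[/asboolP tB sB] bmin.
have act e : e \in B -> e \notin S -> active ord B e.
  move=> eB eS; split=> // f tf.
  have feB : f \notin (B :\ e)%SET.
    apply: contraNN (spanning_tree_bridge tB eB) => fB.
    have := proj2 tf (esrc e) (edst e); rewrite (_ : f |: _ = B :\ e)%SET //.
    by apply/finset.setUidPr; rewrite finset.sub1set.
  have := bmin (f |: (B :\ e))%SET; rewrite big_setU1 //= (big_setD1 e eB) /= leq_add2r.
  apply; apply/andP; split; first exact/asboolP.
  apply/fintype.subsetP => g gS; rewrite !inE (fintype.subsetP sB) // andbT.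
  by apply/orP; right; apply: contraNneq eS => <-.
exists B; apply/and3P; split=> //; last first.
  apply/fintype.subsetP => e; rewrite !inE => /andP[eS eB]; rewrite eB /=.
  by apply/asboolP; apply: act.
apply/asboolP; split=> //; split; first exact: (proj1 tB).
move=> [C [f [bC fC fmin sC]]].
have cC := balanced_is_circle bC.
have [CS|/fintype.subsetPn[e eC eS]] := boolP ((C :\ f)%SET \subset S).
  by case: nS => _; apply; exists C, f.
have eB := fintype.subsetP sC _ eC.
have [_] := act e eB eS => /(_ f) h.
have [nef eC'] : e != f /\ e \in C by move: eC; rewrite !inE => /andP[].
have /h le : spanning_tree (f |: (B :\ e))%SET.
  apply: spanning_tree_exchange => //; apply: contraNN (spanning_tree_bridge tB eB) => cf.
  apply: (conn_sub _ (is_circle_conn cC eC')) => g; rewrite !inE => /andP[nge gC].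
  have [->//|ngf] := eqVneq g f; apply: conn_edge; rewrite !inE nge /=.
  by apply: (fintype.subsetP sC); rewrite !inE ngf.
case/eqP: nef; apply: ord_inj; apply/eqP; rewrite eqn_leq le /=.
exact: fmin.
Qed.

(* The largest element of the symmetric difference of two completions
   would violate activity. *)
Lemma NBC_completion_unique S B B' : NBC_completion S B -> NBC_completion S B' -> B = B'.
Proof.
have key A A' e : NBC_completion S A -> NBC_completion S A' -> e \in A -> e \notin A' ->
    exists2 f, (f \in A') && (f \notin A) & (ord e < ord f)%N.
  move=> /and3P[/asboolP[_ tA] sA /fintype.subsetP actA] /and3P[/asboolP[_ tA'] sA' _] eA eA'.
  have eS : e \notin S by apply: contraNN eA'; apply: fintype.subsetP.
  have : e \in active_set A by apply: actA; rewrite !inE eS.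
  rewrite inE => /andP[_ /asboolP[_ act]].
  (* Since A' is connected, one of its edges joins the two sides of A without e; by activity of e it
     is larger than e. *)
  have [f fA' nf] : exists2 f, f \in A' & ~~ conn (A :\ e)%SET (esrc f) (edst f).
    apply: contrapT => hn; case/negP: (spanning_tree_bridge tA eA).
    apply: (conn_sub _ (proj2 tA' _ _)) => f fA'; apply: contrapT => /negP nf.
    by apply: hn; exists f.
  have le := act f (spanning_tree_exchange tA eA nf).
  have nfe : f != e by apply: contraNneq eA' => <-.
  have nfA : f \notin A by apply: contraNN nf => fA; apply: conn_edge; rewrite !inE nfe.
  exists f; first by rewrite fA'.
  by rewrite ltn_neqAle le andbT; apply: contraNneq nfe => /ord_inj ->.
move=> cB cB'; apply/eqP; apply: contraT => nBB'.
pose D e := (e \in B) (+) (e \in B').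
have [e0 De0] : exists e, D e.
  apply: contrapT => hn; case/eqP: nBB'; apply/setP => e.
  by apply: contrapT => h; apply: hn; exists e; rewrite /D; move: h; case: (e \in B); case: (e \in B').
case: (arg_maxnP ord De0) => e De emax.
have [f Df lt] : exists2 f, D f & (ord e < ord f)%N.
  move: De; rewrite /D; case eB: (e \in B); case eB': (e \in B') => //= _.
    have [f /andP[h1 /negbTE h2] lt] := key _ _ _ cB cB' eB (negbT eB').
    by exists f => //; rewrite /D h1 h2.
  have [f /andP[h1 /negbTE h2] lt] := key _ _ _ cB' cB eB' (negbT eB).
  by exists f => //; rewrite /D h1 h2.
by have := emax f Df; rewrite /= leqNgt lt.
Qed.

Lemma sum_subset_exp (y : rat) (D : {set E}) :
  \sum_(A : {set E} | A \subset D) y ^+ #|A| = (1 + y) ^+ #|D|.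
Proof.
transitivity (\prod_(e : E) ((if e \in D then y else 0) + 1)).
  rewrite bigA_distr [RHS]big_mkcond [LHS]big_mkcond /=; apply: eq_bigr => A _.
  case: ifP => [/fintype.subsetP AD|/negbT/fintype.subsetPn[e eA /negbTE eD]].
    rewrite -prodr_const [LHS]big_mkcond; apply: eq_bigr => e _.
    by case: ifP => // /AD ->.
  by rewrite (bigD1 e) //= eA eD mul0r.
rewrite -prodr_const [RHS]big_mkcond; apply: eq_bigr => e _.
by case: ifP; rewrite ?add0r // addrC.
Qed.

Lemma sum_NBC_sets (y : rat) :
  \sum_(S : {set E} | `[< NBC S >]) y ^+ (n.-1 - #|S|)
  = \sum_(B : {set E} | `[< NBC_basis a ord B >]) (1 + y) ^+ activity ord B.
Proof.
transitivity (\sum_(S : {set E} | `[< NBC S >]) \sum_(B | NBC_completion S B) y ^+ #|(B :\: S)%SET|).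
  apply: eq_bigr => S /asboolP nS; have [B cB] := NBC_completion_exists nS.
  rewrite (big_pred1 B) => [|B']; last first.
    by apply/idP/eqP => [/NBC_completion_unique/(_ cB)|->].
  case/and3P: cB => /asboolP[_ tB] sB _.
  by rewrite cardsD (finset.setIidPr sB) (card_spanning_tree a n_gt0 tB).
rewrite (exchange_big_dep (fun B => `[< NBC_basis a ord B >])) /=; last first.
  by move=> S B _ /and3P[].
apply: eq_bigr => B /asboolP bB.
rewrite -[activity ord B]/(#|active_set B|) -sum_subset_exp.
have aB : active_set B \subset B by apply/fintype.subsetP => e; rewrite inE => /andP[].
rewrite [RHS](reindex_onto (fun S => B :\: S)%SET (fun A => B :\: A)%SET) /=; last first.
  move=> A AD; rewrite finset.setDDr finset.setDv finset.set0U; apply/finset.setIidPr.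
  exact: fintype.subset_trans AD aB.
apply: eq_bigl => S; rewrite /NBC_completion.
have [sB|nsB] := boolP (S \subset B); last first.
  rewrite !andbF; apply/esym/negbTE; rewrite negb_and; apply/orP; right.
  apply: contraNneq nsB => <-; exact: finset.subsetDl.
have -> : (B :\: (B :\: S) == S)%SET.
  by rewrite finset.setDDr finset.setDv finset.set0U; apply/eqP/finset.setIidPr.
have -> : `[< NBC_basis a ord B >] by apply/asboolP.
rewrite andbT /=; case: (_ \subset active_set B); rewrite ?andbF // andbT.
by apply/asboolP; apply: NBC_sub sB (proj1 bB).
Qed.

End BrokenCircuits.

(** * Proper colorings modulo q *)

Lemma eqn_mod_lt_double (q A B : nat) : (A < q + q)%N -> (B < q + q)%N ->
  (A = B %[mod q]) <-> [\/ A = B, A = (B + q)%N | B = (A + q)%N].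
Proof.
have small C : (C < q + q)%N -> C %% q = if (C < q)%N then C else (C - q)%N.
  move=> hC; case: ltnP => h; first exact: modn_small.
  by rewrite -{1}(subnK h) modnDr modn_small //; lia.
move=> hA hB; split=> [|[->|->|->]]; rewrite ?modnDr //.
rewrite !small //; case: ltnP => ?; case: ltnP => ? h.
- exact: Or31.
- by apply: Or33; lia.
- by apply: Or32; lia.
by apply: Or31; lia.
Qed.

Lemma Zp_intr_eq0 (q0 : nat) (z : int) : (`|z| < q0.+2)%N ->
  (z%:~R == 0 :> 'Z_q0.+2)%R -> z = 0%R.
Proof.
have h (m : nat) : (m < q0.+2)%N -> (m%:R == 0 :> 'Z_q0.+2)%R -> m = 0%N.
  by move=> hm /eqP/(congr1 val); rewrite /= val_Zp_nat // modn_small.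
case: z => m /=; first by move=> hm /(h _ hm) ->.
by move=> hm; rewrite NegzE intrN oppr_eq0 => /(h _ hm).
Qed.

Section Colorings.
Variables (m k1 k2 : nat).
Local Notation n := m.+1.
Local Notation NN := (k1 + k2.*2).+1.
Local Notation E := (gedge n NN).
Local Notation a := (- (k2%:Z))%R.
Local Open Scope ring_scope.

Lemma egain_bound (e : E) : (`|egain a e| <= NN)%N.
Proof. by rewrite /egain; have := ltn_ord (val e).2; lia. Qed.

Lemma circle_gain_bound s (es : seq E) : circle_walk s es ->
  (`|(\sum_(p <- zip es s) ogain a p.1 p.2)%R| <= n * NN)%N.
Proof.
move=> cw; have ss := circle_walk_size cw; case/and4P: cw => _ us _ _.
have sn : (size s <= n)%N.
  by rewrite -(card_uniqP us) -[X in (_ <= X)%N]card_ord; apply: max_card.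
have ob (e : E) u : (`|ogain a e u| <= NN)%N.
  by rewrite /ogain; case: ifP => _; have := egain_bound e; lia.
apply: (@leq_trans (size (zip es s) * NN)).
  elim: (zip es s) => [|[e u] z IHz]; first by rewrite big_nil.
  rewrite big_cons /= mulSn; move: IHz (ob e u).
  move: (ogain a e u) (\sum_(p <- z) _) (size z * NN)%N => g X Z; lia.
by rewrite leq_mul2r size_zip ss minnn sn orbT.
Qed.

(** The gain of a circle of satisfied edges is zero modulo q and smaller than q in absolute
    value. *)
Lemma gain_flat_sats_Zp q0 (x : 'I_n -> 'Z_q0.+2) : (n * NN < q0.+2)%N ->
  gain_flat a (sats NN a x : {set E}).
Proof.
move=> hq; split=> [s es cw ses|C f]; last exact: balanced_circle_sats.
apply: (@Zp_intr_eq0 q0); first exact: leq_ltn_trans (circle_gain_bound cw) hq.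
by rewrite (circle_gain cw ses).
Qed.

Lemma sum_NBC_colorings (ord : E -> nat) q0 : injective ord -> (n * NN < q0.+2)%N ->
  \sum_(S : {set E} | `[< NBC_set a ord S >]) (-1) ^+ #|S| * q0.+2%:R ^+ (n - #|S|)
  = #|[set x : {ffun 'I_n -> 'Z_q0.+2} | sats NN a x == finset.set0 :> {set E}]%SET|%:R :> rat.
Proof.
move=> oi hq; set R := 'Z_q0.+2.
transitivity (\sum_(x : {ffun 'I_n -> R}) (sats NN a x == finset.set0 :> {set E})%:R : rat); last first.
  rewrite -sum1_card natr_sum [RHS]big_mkcond; apply: eq_bigr => x _.
  by rewrite inE; case: eqP.
under [RHS]eq_bigr => x _ do rewrite -(sum_NBC_flat oi (gain_flat_sats_Zp x hq)).
rewrite (exchange_big_dep (fun S : {set E} => `[< NBC_set a ord S >])) /=; last by move=> x S _ /andP[].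
apply: eq_bigr => S nS.
rewrite (eq_bigl (fun x : {ffun 'I_n -> R} => x \in solutions a R S)); last first.
  by move=> x; rewrite inE nS.
rewrite sumr_const -[RHS]mulr_natr; congr (_ * _).
move/asboolP: nS => [fS _].
have [B tB sB] := @forest_extend n NN (ltn0Sn _) S fS.
have cS : (#|S| <= n)%N.
  by apply: leq_trans (subset_leq_card sB) _; rewrite (card_spanning_tree a _ tB).
have e : (q0.+2 ^ n = q0.+2 ^ (n - #|S|) * q0.+2 ^ #|S|)%N by rewrite -expnD subnK.
have := card_solutions a R fS; have -> : #|R| = q0.+2 by rewrite card_ord.
rewrite e; move/eqP; rewrite eqn_pmul2r ?expn_gt0 // => /eqP ->.
by rewrite -natrX.
Qed.

Lemma sat_Zp q0 (u v : 'Z_q0.+2) (c : 'I_NN) :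
  (v - u == (a + (c : nat)%:Z)%:~R) = (v + k2 == u + c %[mod q0.+2])%N.
Proof.
rewrite intrD intrN -!pmulrn subr_eq -(inj_eq (addIr (k2%:R : 'Z_q0.+2))).
have -> : - k2%:R + c%:R + u + k2%:R = u + c%:R :> 'Z_q0.+2 by ring.
rewrite -[v in LHS]natr_Zp -[u in LHS]natr_Zp -!natrD.
by rewrite -val_eqE /= !val_Zp_nat.
Qed.

(** For labels i < j at u and v, the forbidden residues of v - u are those of -k2, ..., k1 + k2.
    Around the cycle the distance from i to j must exceed k1 + k2 and the distance from j to i must
    exceed k2; the two branches tell which label comes first once the cycle is cut at 0. *)
Lemma noncongruent_gap (q u v : nat) : (NN <= q)%N -> (u < q)%N -> (v < q)%N ->
  (forall c : 'I_NN, (v + k2 != u + c %[mod q])%N) <->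
  ((u <= v -> u + (k2.+1 + k1) <= v /\ v + k2.+1 <= u + q) /\
   (v <= u -> v + k2.+1 <= u /\ u + (k2.+1 + k1) <= v + q))%N.
Proof.
move=> hq hu hv; split=> [h|[h1 h2] c].
  have wit c : (c < NN)%N ->
      ~ [\/ (v + k2 = u + c)%N, (v + k2 = u + c + q)%N | (u + c = v + k2 + q)%N].
    move=> hc /eqn_mod_lt_double e; have := h (Ordinal hc).
    by rewrite /= e ?eqxx //; lia.
  split=> le; split; rewrite leqNgt; apply/negP => lt.
  - by apply: (wit (v - u + k2)%N); [lia|apply: Or31; lia].
  - by apply: (wit (v + k2 - u - q)%N); [lia|apply: Or32; lia].
  - by apply: (wit (v + k2 - u)%N); [lia|apply: Or31; lia].
  - by apply: (wit (v + k2 + q - u)%N); [lia|apply: Or33; lia].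
have hc := ltn_ord c.
apply/eqP => /eqn_mod_lt_double [||e|e|e]; [lia|lia| | | ]; case: (leqP u v) => [/[dup] le /h1|/ltnW/[dup] le /h2]; lia.
Qed.

(** A translation moves the largest label to 0, whence the factor q. The first step away from it is
    a descent of length at least k2 + 1; the return to it, at position q, is an ascent of length at
    least k1 + k2 + 1, which gives the last admissible position Q. *)
Lemma card_proper_colorings q0 (Q := (q0.+2 - k1 - k2 - 1)%N) : (n * NN < q0.+2)%N ->
  #|[set x : {ffun 'I_n -> 'Z_q0.+2} | sats NN a x == finset.set0 :> {set E}]%SET|
  = (q0.+2 * #|placements k1 k2 q0.+1 Q (~: [set ord_max])%SET (ord_max : 'I_n) 0|)%N.
Proof.
move=> hq; have hNN : (NN <= q0.+2)%N by lia.
set R := 'Z_q0.+2.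
have satsE (x : {ffun 'I_n -> R}) : (sats NN a x == finset.set0 :> {set E})
   = [forall i : 'I_n, forall j : 'I_n, (i < j)%N ==>
       [forall c : 'I_NN, (x j + k2 != x i + c %[mod q0.+2])%N]].
  apply/eqP/forallP => [/setP h i|h].
    apply/forallP => j; apply/implyP => ij; apply/forallP => c.
    pose t : 'I_n * 'I_n * 'I_NN := (i, j, c).
    have tP : (t.1.1 < t.1.2)%N by [].
    have := h (exist _ t tP); rewrite !inE /sat /egain /esrc /edst /= sat_Zp.
    by move=> ->.
  apply/setP => e; rewrite !inE /sat /egain sat_Zp; apply/negbTE.
  have /forallP/(_ (edst e))/implyP/(_ (esrc_lt_edst e))/forallP := h (esrc e).
  exact.
pose P0 := [set x : {ffun 'I_n -> R} | (sats NN a x == finset.set0 :> {set E}) && (x ord_max == 0)]%SET.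
transitivity (q0.+2 * #|P0|)%N.
  rewrite -[LHS]sum1_card (partition_big (fun x : {ffun 'I_n -> R} => x ord_max) predT) //=.
  rewrite (eq_bigr (fun=> #|P0|)) ?sum_nat_const ?card_ord // => t _.
  pose sh (d : R) (x : {ffun 'I_n -> R}) : {ffun 'I_n -> R} := [ffun i => x i + d].
  have shS d x : sats NN a (sh d x) = sats NN a x :> {set E}.
    by apply/setP => e; rewrite !inE /sat !ffunE opprD addrACA subrr addr0.
  have shK d : cancel (sh d) (sh (- d)) by move=> x; apply/ffunP => i; rewrite !ffunE addrK.
  rewrite -(card_imset P0 (can_inj (shK t))) -sum1_card; apply: eq_bigl => x.
  rewrite !inE; apply/andP/imsetP => [[s0 /eqP xt]|[z]].
    exists (sh (- t) x); first by rewrite inE shS s0 ffunE xt subrr eqxx.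
    by rewrite -{1}[t]opprK shK.
  by rewrite inE => /andP[s0 /eqP z0] ->; rewrite shS s0 ffunE z0 add0r.
congr (_ * _)%N; apply: eq_card => x; rewrite !inE satsE.
have xq i : (x i < q0.+2)%N by apply: ltn_ord.
have pP (i j : 'I_n) := @noncongruent_gap q0.+2 (x i) (x j) hNN (xq i) (xq j).
have gapmax (i : 'I_n) : gap k1 k2 ord_max i = k2.+1.
  by rewrite /gap ltnNge -ltnS ltn_ord addn0.
have lt_max (i : 'I_n) : i != ord_max -> (i < (ord_max : 'I_n))%N.
  by move=> ni; rewrite ltn_neqAle -ltnS ltn_ord andbT.
apply/andP/placedP => [[/forallP h /eqP x0]|[h1 h2 h3]].
  have hp (i j : 'I_n) : (i < j)%N -> _ := fun ij => proj1 (pP i j)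
    (fun c => forallP (implyP (forallP (h i) j) ij) c).
  have bd i : i != ord_max -> (k2.+1 <= x i)%N /\ (x i + (k2.+1 + k1) <= q0.+2)%N.
    move=> ni; have [_ g2] := hp _ _ (lt_max _ ni); rewrite x0 in g2.
    by have [g3 g4] := g2 (leq0n _); split; [exact: g3|exact: g4].
  split=> [i|i j|i]; rewrite !inE.
  - move=> /bd[b1 b2]; rewrite gapmax add0n b1 /Q /=.
    by move: b2; move: (nat_of_ord (x i)) => t; lia.
  - move=> _ _ ij le; rewrite /gap; case: (ltngtP i j) => [/hp[/(_ le)[]]|/hp[_ /(_ le)[]]|/val_inj e].
    + by [].
    + by rewrite addn0.
    by rewrite e eqxx in ij.
  by rewrite negbK => /eqP ->.
have x0 : x ord_max = ord0 by apply: h3; rewrite !inE eqxx.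
have bd i : i != ord_max -> (k2.+1 <= x i)%N /\ (x i + (k2.+1 + k1) <= q0.+2)%N.
  move=> ni; have := h1 i; rewrite !inE => /(_ ni); rewrite gapmax add0n /Q.
  have hk : (k1 + k2 + 1 <= q0.+2)%N by lia.
  by move: (nat_of_ord (x i)) => t; lia.
split; last by rewrite x0.
apply/forallP => i; apply/forallP => j; apply/implyP => ij; apply/forallP; apply/pP.
have ni : i != ord_max by apply: contraTneq ij => ->; rewrite -leqNgt -ltnS ltn_ord.
have [b1 b2] := bd i ni.
have [ej|nj] := eqVneq j ord_max.
  rewrite ej x0 -[nat_of_ord ord0]/0%N.
  by move: b1 b2; move: (nat_of_ord (x i)) => t; split; lia.
have [b3 b4] := bd j nj.
have nij : i != j by rewrite -val_eqE /= ltn_eqF.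
have c1 : (x i <= x j)%N -> (x i + (k2.+1 + k1) <= x j)%N.
  by move=> le; have := h2 i j; rewrite !inE ni nj nij /gap ij => /(_ isT isT isT le).
have c2 : (x j <= x i)%N -> (x j + k2.+1 <= x i)%N.
  move=> le; have := h2 j i.
  by rewrite !inE ni nj eq_sym nij /gap ltnNge (ltnW ij) addn0 => /(_ isT isT isT le).
move: b1 b2 b3 b4 c1 c2; move: (nat_of_ord (x i)) (nat_of_ord (x j)) => t t'; lia.
Qed.

Lemma rising_poly_neg (z : nat) : (m <= z)%N ->
  (rising_poly m).[- z%:R] = (-1) ^+ m * 'C(z, m)%:R.
Proof.
move=> hz; rewrite /rising_poly hornerZ horner_prod.
rewrite (eq_bigr (fun i : 'I_m => -1 * (z - i)%:R)) => [|i _]; last first.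
  rewrite hornerD hornerX hornerC natrB; first by ring.
  exact: leq_trans (ltnW (ltn_ord i)) hz.
rewrite big_split /= prodr_const card_ord -natr_prod -ffact_prod -bin_ffact natrM.
rewrite mulrC mulrA mulfK // pnatr_eq0 -lt0n; exact: fact_gt0.
Qed.

(** The bound on q makes circles balanced modulo q balanced over the integers, and keeps the
    truncated subtractions in the binomial coefficients exact. *)
Lemma sum_activity_horner (ord : E -> nat) q0 : injective ord ->
  (n * NN + m + n * (k1 + k2) < q0.+2)%N ->
  \sum_(B : {set E} | `[< NBC_basis a ord B >]) (1 - q0.+2%:R) ^+ activity ord B
  = \sum_(T : {set 'I_n * 'I_n * 'I_(k1 + 1 + k2)} |
        colored_rooted_tree T && decreasing (k1 + 1) T) (1 - q0.+2%:R) ^+ n_edges_col1 T :> rat.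
Proof.
move=> oi hq; have hq1 : (n * NN < q0.+2)%N by lia.
have nz : q0.+2%:R != 0 :> rat by rewrite pnatr_eq0.
have sg : (-1) ^+ m != 0 :> rat by rewrite signr_eq0.
rewrite -(@sum_NBC_sets n NN a ord oi (ltn0Sn _) (ltn0Sn _)).
rewrite sum_decreasing_trees; apply: (mulfI sg); apply: (mulfI nz).
(* The factors (-1)^m and q convert the powers of y = -q into the weights of [sum_NBC_colorings]. *)
transitivity (\sum_(S : {set E} | `[< NBC_set a ord S >]) (-1) ^+ #|S| * q0.+2%:R ^+ (n - #|S|) : rat).
  rewrite !mulr_sumr; apply: eq_bigr => S /asboolP[fS _].
  have [B tB sB] := @forest_extend n NN (ltn0Sn _) S fS.
  have cS : (#|S| <= m)%N.
    by apply: leq_trans (subset_leq_card sB) _; rewrite (card_spanning_tree a _ tB).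
  rewrite /= subSn // exprS [X in _ * (_ * X)]exprNn; set d := (m - #|S|)%N.
  have -> : (-1) ^+ m = (-1) ^+ #|S| * (-1) ^+ d :> rat by rewrite -exprD subnKC.
  have s2 : (-1) ^+ d * (-1) ^+ d = 1 :> rat by rewrite -expr2 sqrr_sign.
  set t := (-1) ^+ d in s2 *; set s := (-1) ^+ #|S|; set qd := q0.+2%:R ^+ d.
  by transitivity (t * t * (s * (q0.+2%:R * qd))); [ring|rewrite s2 mul1r].
rewrite sum_NBC_colorings // card_proper_colorings // natrM; congr (_ * _).
set Q := (q0.+2 - k1 - k2 - 1)%N; set S := (~: [set ord_max])%SET.
rewrite card_placements ?inE ?eqxx //; last by rewrite /Q; lia.
have cS : #|S| = m by rewrite /S cardsC1 card_ord.
(* The largest label exceeds the m others, so [reuler_poly] specializes to the Eulerian polynomial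
   of m letters. *)
have -> : rank S ord_max = m.
  rewrite -[RHS]cS; apply: eq_card => i; rewrite !inE; case: (i =P ord_max) => //= ni.
  rewrite ltn_neqAle -ltnS ltn_ord andbT; apply/eqP => im; apply: ni; exact: val_inj.
rewrite cS subnn /= /poly_pair mulr_sumr; apply: eq_bigr => j _.
have jm : (j <= m)%N by rewrite -ltnS; apply: leq_trans (ltn_ord j) (size_euler_poly m).
have kj : (k1 * j <= k1 * m)%N by rewrite leq_mul2l jm orbT.
have hz : (1 + k1 + n * k2 + k1 * j + m <= q0.+2)%N.
  by move: hq; rewrite mulnDr [(n * k1)%N]mulSn [(m * k1)%N]mulnC; lia.
have -> : 1 - q0.+2%:R + (k1 + n * k2)%:R + (k1 * j)%:R
    = - (Q - 0 - m * k2 - k1 * j)%:R :> rat.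
  have -> : (Q - 0 - m * k2 - k1 * j = q0.+2 - (1 + k1 + n * k2 + k1 * j))%N.
    by rewrite /Q mulSn; lia.
  by rewrite natrB; [ring|lia].
rewrite rising_poly_neg; last by rewrite /Q; move: hz; rewrite mulSn; lia.
have s2 : (-1) ^+ m * (-1) ^+ m = 1 :> rat by rewrite -expr2 sqrr_sign.
rewrite -[_ *: (_ : rat^o)]/(_ * _) -[(_ *: (_ * _) : rat^o)]/(_ * (_ * _)).
by rewrite mulrCA [X in _ = _ * X]mulrA s2 mul1r.
Qed.

End Colorings.

Lemma poly_eq_of_large_values (p1 p2 : {poly rat}) (q1 : nat) :
  (forall q0, (q1 <= q0)%N -> p1.[1 - q0.+2%:R] = p2.[1 - q0.+2%:R])%R -> p1 = p2.
Proof.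
move=> h; apply/eqP; rewrite -subr_eq0; apply: contraT => nz.
pose rs := [seq (1 - (q1 + i).+2%:R : rat)%R | i <- iota 0 (size (p1 - p2)%R)].
have := max_poly_roots nz (rs := rs); rewrite size_map size_iota ltnn; apply.
  apply/allP => _ /mapP[i _ ->]; rewrite /root hornerD hornerN h ?leq_addr //.
  by rewrite subrr.
rewrite map_inj_uniq ?iota_uniq // => i j /addrI/oppr_inj/eqP.
by rewrite eqr_nat => /eqP; lia.
Qed.

Lemma card_NBC_bases_trees (m k1 k2 : nat) (ord : gedge m.+1 (k1 + k2.*2).+1 -> nat) alpha :
  injective ord ->
  #|[set B : {set gedge m.+1 (k1 + k2.*2).+1} |
      `[< NBC_basis (- (k2%:Z))%R ord B >] && (activity ord B == alpha)]%SET|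
  = #|[set T : {set 'I_m.+1 * 'I_m.+1 * 'I_(k1 + 1 + k2)} |
        [&& colored_rooted_tree T, decreasing (k1 + 1) T & n_edges_col1 T == alpha]]%SET|.
Proof.
move=> oi.
pose pB := (\sum_(B : {set gedge m.+1 (k1 + k2.*2).+1} | `[< NBC_basis (- (k2%:Z))%R ord B >])
  'X^(activity ord B) : {poly rat})%R.
pose pT := (\sum_(T : {set 'I_m.+1 * 'I_m.+1 * 'I_(k1 + 1 + k2)} |
  colored_rooted_tree T && decreasing (k1 + 1) T) 'X^(n_edges_col1 T) : {poly rat})%R.
have e : pB = pT.
  apply: (@poly_eq_of_large_values _ _ (m.+1 * (k1 + k2.*2).+1 + m + m.+1 * (k1 + k2))) => q0 hq.
  rewrite /pB /pT !horner_sum.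
  under eq_bigr do rewrite hornerXn.
  under [RHS]eq_bigr do rewrite hornerXn.
  by apply: sum_activity_horner => //; apply: leq_ltn_trans hq _.
have := congr1 (fun p : {poly rat} => p`_alpha)%R e; rewrite /pB /pT !coef_sum.
under eq_bigr do rewrite coefXn.
under [X in _ = X -> _]eq_bigr do rewrite coefXn.
rewrite -!natr_sum => /eqP; rewrite eqr_nat => /eqP h.
rewrite -sum1_card -[RHS]sum1_card.
transitivity (\sum_(B : {set gedge m.+1 (k1 + k2.*2).+1} | `[< NBC_basis (- (k2%:Z))%R ord B >])
   (alpha == activity ord B))%N.
  rewrite [RHS]big_mkcond [LHS]big_mkcond; apply: eq_bigr => B _; rewrite !inE eq_sym.
  by case: `[< _ >] => //=; case: eqP.
rewrite h [RHS]big_mkcond [LHS]big_mkcond; apply: eq_bigr => T _; rewrite !inE eq_sym.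
by case: (colored_rooted_tree T) => //=; case: (decreasing _ T) => //=; case: eqP.
Qed.

(** * Relatively bounded cells of affine arrangements *)

Section AffineCells.
Variables (R : realFieldType) (d : nat).
Local Open Scope ring_scope.
Local Notation form := ('rV[R]_d * R)%type.
Local Notation pt := 'cV[R]_d.
Implicit Types (C L : seq form) (f : form) (x y z : pt) (sg : seq bool).

Definition dot (c : 'rV[R]_d) (y : pt) : R := (c *m y) ord0 ord0.
Definition ev f x : R := dot f.1 x - f.2.

Lemma dotD c x y : dot c (x + y) = dot c x + dot c y.
Proof. by rewrite /dot mulmxDr mxE. Qed.
Lemma dotZ c t y : dot c (t *: y) = t * dot c y.
Proof. by rewrite /dot -scalemxAr mxE. Qed.
Lemma evD f x y : ev f (x + y) = ev f x + dot f.1 y.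
Proof. by rewrite /ev dotD addrAC. Qed.

Definition lin L y := all (fun f => dot f.1 y == 0) L.
Definition onflat C x := all (fun f => ev f x == 0) C.

Fixpoint incell L sg x : bool :=
  match L, sg with
  | f :: L', s :: sg' => (if s then 0 < ev f x else ev f x < 0) && incell L' sg' x
  | [::], [::] => true
  | _, _ => false
  end.

(** Recession cone: the inequalities of the cell made homogeneous and weak. *)
Fixpoint inrec L sg y : bool :=
  match L, sg with
  | f :: L', s :: sg' => (if s then 0 <= dot f.1 y else dot f.1 y <= 0) && inrec L' sg' y
  | [::], [::] => true
  | _, _ => false
  end.

(* A cell is relatively bounded when its recession cone is its lineality space. *)
Definition relbounded C L sg := forall y, lin C y -> inrec L sg y -> lin L y.
Definition good C L sg := (exists x, onflat C x && incell L sg x) /\ relbounded C L sg.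

Fixpoint sign_vectors m : seq (seq bool) :=
  if m is m'.+1 then
    [seq true :: s | s <- sign_vectors m'] ++ [seq false :: s | s <- sign_vectors m']
  else [:: [::]].

Definition bounded_cells C L := count (fun sg => `[< good C L sg >]) (sign_vectors (size L)).

(** Sum of (-1)^|A| over the subfamilies A of L whose equations are consistent with those of C, in
    the recursive form matching deletion and restriction. *)
Fixpoint euler_flats C L : int :=
  if L is f :: L' then euler_flats C L' - euler_flats (f :: C) L'
  else if `[< exists x, onflat C x >] then 1 else 0.

Definition fspan L : {vspace 'rV[R]_d} := <<map fst L>>%VS.

Lemma fspan_cons f L : fspan (f :: L) = (<[f.1]> + fspan L)%VS.
Proof. exact: span_cons. Qed.

Lemma lin_fspan L y c : lin L y -> c \in fspan L -> dot c y = 0.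
Proof.
elim: L c => [|f L IHL] c /=; first by rewrite /fspan span_nil memv0 => _ /eqP ->; rewrite /dot mul0mx mxE.
case/andP => /eqP fy ly; rewrite fspan_cons => /memv_addP[u /vlineP[t ->] [v vL ->]].
have -> : dot (t *: f.1 + v) y = t * dot f.1 y + dot v y.
  by rewrite /dot mulmxDl -scalemxAl !mxE.
by rewrite fy mulr0 add0r IHL.
Qed.

(** Some column of the cokernel of the matrix of L is not annihilated by c; rescaled, it is the
    required direction. *)
Lemma notin_fspan L c : c \notin fspan L -> exists2 y, lin L y & dot c y = 1.
Proof.
move=> nc; pose A := \matrix_(i < size L) (nth (0, 0) L i).1.
have nA : ~~ (c <= A)%MS.
  apply: contraNN nc => /submxP[D ->]; rewrite mulmx_sum_row; apply: memv_suml => i _.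
  apply: memvZ; apply: memv_span; rewrite rowK; apply: map_f; exact: mem_nth.
have [j nj] : exists j, (c *m cokermx A) ord0 j != 0.
  apply: contrapT => hn; case/negP: nA; rewrite submxE; apply/eqP/rowP => j.
  by rewrite [RHS]mxE; apply: contrapT => h; apply: hn; exists j; apply/eqP.
pose y := col j (cokermx A).
have dE (c' : 'rV_d) : dot c' y = (c' *m cokermx A) ord0 j by rewrite /dot /y [LHS]mxE [RHS]mxE; apply: eq_bigr => i _; rewrite [col _ _ _ _]mxE.
exists (((c *m cokermx A) ord0 j)^-1 *: y); last by rewrite dotZ dE mulVf.
apply/allP => f fL; rewrite dotZ dE.
have hi : (index f L < size L)%N by rewrite index_mem.
have -> : f.1 = row (Ordinal hi) A by rewrite rowK nth_index.
by rewrite -row_mul mulmx_coker !mxE mulr0.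
Qed.

Lemma dim_fspan_cons f L :
  \dim (fspan (f :: L)) = (\dim (fspan L) + (f.1 \notin fspan L))%N.
Proof.
rewrite fspan_cons; case: (boolP (f.1 \in fspan L)) => [h|h] /=.
  by rewrite addn0; congr (\dim _); apply/addv_idPr; rewrite -memvE.
rewrite dimv_disjoint_sum ?dim_vline; last first.
  apply/eqP; rewrite -subv0; apply/subvP => v; rewrite memv_cap => /andP[/vlineP[t ->] ht].
  rewrite memv0; apply: contraNT h => nt; have nzt : t != 0 by apply: contraNneq nt => ->; rewrite scale0r.
  by rewrite -[f.1]scale1r -(mulVf nzt) -scalerA memvZ.
have -> : f.1 != 0 by apply: contraNneq h => ->; apply: mem0v.
by rewrite addnC.
Qed.

Lemma dim_fspan_mid C f L : \dim (fspan (C ++ f :: L)) = \dim (fspan (f :: C ++ L)).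
Proof.
congr (\dim _); apply: eq_span => v; rewrite /= !map_cat /= !(inE, mem_cat).
exact: orbCA.
Qed.

Lemma fspan_catl C L c : c \in fspan C -> c \in fspan (C ++ L).
Proof. by rewrite /fspan map_cat span_cat; apply: subvP (addvSl _ _) _. Qed.

Lemma lin_cat C L y : lin (C ++ L) y = lin C y && lin L y.
Proof. exact: all_cat. Qed.

Lemma linD L x y : lin L x -> lin L y -> lin L (x + y).
Proof. by move=> /allP h1 /allP h2; apply/allP => f fL; rewrite dotD (eqP (h1 _ fL)) (eqP (h2 _ fL)) addr0. Qed.

Lemma linZ L t y : lin L y -> lin L (t *: y).
Proof. by move=> /allP h; apply/allP => f fL; rewrite dotZ (eqP (h _ fL)) mulr0. Qed.

Lemma onflatD C x y : onflat C x -> lin C y -> onflat C (x + y).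
Proof. by move=> /allP h1 /allP h2; apply/allP => f fL; rewrite evD (eqP (h1 _ fL)) (eqP (h2 _ fL)) addr0. Qed.

Lemma onflatB C x x' : onflat C x -> onflat C x' -> lin C (x' - x).
Proof.
move=> /allP h1 /allP h2; apply/allP => f fL.
have := eqP (h2 _ fL); rewrite -{1}(subrK x x') addrC evD (eqP (h1 _ fL)) add0r.
by move/eqP.
Qed.

Lemma incell_lin L sg x y : lin L y -> incell L sg (x + y) = incell L sg x.
Proof.
elim: L sg => [|f L IHL] [|s sg] //= /andP[/eqP fy ly].
by rewrite evD fy addr0 IHL.
Qed.

Lemma inrec_lin L sg y y' : lin L y' -> inrec L sg (y + y') = inrec L sg y.
Proof.
elim: L sg => [|f L IHL] [|s sg] //= /andP[/eqP fy ly].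
by rewrite dotD fy addr0 IHL.
Qed.

Lemma lin_inrec L sg x y : incell L sg x -> lin L y -> inrec L sg y.
Proof.
elim: L sg => [|f L IHL] [|s sg] //= /andP[_ c] /andP[/eqP -> ly].
by rewrite lexx if_same IHL.
Qed.

Lemma incell_rec L sg x y t : incell L sg x -> inrec L sg y -> 0 <= t ->
  incell L sg (x + t *: y).
Proof.
move=> + + t0; elim: L sg => [|f L IHL] [|s sg] //= /andP[c cs] /andP[r rs].
rewrite IHL // andbT evD dotZ; case: s c r => c r.
  by rewrite ltr_wpDr // mulr_ge0.
by rewrite ltr_wnDr // mulr_ge0_le0.
Qed.

Lemma inrec_comb L sg y y' s t : inrec L sg y -> inrec L sg y' -> 0 <= s -> 0 <= t ->
  inrec L sg (s *: y + t *: y').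
Proof.
move=> + + s0 t0; elim: L sg => [|f L IHL] [|b sg] //= /andP[c cs] /andP[r rs].
rewrite IHL // andbT dotD !dotZ; case: b c r => c r.
  by rewrite addr_ge0 // mulr_ge0.
by rewrite -oppr_ge0 opprD addr_ge0 // oppr_ge0 mulr_ge0_le0.
Qed.

(** On a recession cone each form keeps one sign, so a positive combination vanishes only if both
    terms do. *)
Lemma lin_comb L sg y y' s t : inrec L sg y -> inrec L sg y' -> 0 < s -> 0 < t ->
  lin L (s *: y + t *: y') -> lin L y.
Proof.
move=> + + s0 t0; elim: L sg => [|f L IHL] [|b sg] //= /andP[c cs] /andP[r rs] /andP[z zs].
rewrite (IHL sg) // andbT; move: z; rewrite dotD !dotZ; case: b c r => c r.
  rewrite paddr_eq0 ?mulr_ge0 // ?(ltW s0) ?(ltW t0) // mulf_eq0 (gt_eqF s0) /=.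
  by case/andP.
rewrite naddr_eq0 ?mulr_ge0_le0 // ?(ltW s0) ?(ltW t0) // mulf_eq0 (gt_eqF s0) /=.
by case/andP.
Qed.

Lemma incell_convex L sg x x' t : incell L sg x -> incell L sg x' -> 0 <= t <= 1 ->
  incell L sg (x + t *: (x' - x)).
Proof.
move=> + + /andP[t0 t1]; elim: L sg => [|f L IHL] [|b sg] //= /andP[c cs] /andP[r rs].
rewrite IHL // andbT evD dotZ.
have -> : dot f.1 (x' - x) = ev f x' - ev f x.
  by rewrite /ev dotD -scaleN1r dotZ; ring.
have -> : ev f x + t * (ev f x' - ev f x) = (1 - t) * ev f x + t * ev f x' by ring.
have t1' : 0 <= 1 - t by rewrite subr_ge0.
case: b c r => c r.
  have [->|tn] := eqVneq t 0; first by rewrite subr0 mul1r mul0r addr0.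
  by rewrite ltr_wpDl ?mulr_ge0 ?(ltW c) // mulr_gt0 // lt_def tn.
have [->|tn] := eqVneq t 0; first by rewrite subr0 mul1r mul0r addr0.
by rewrite ltr_wnDl ?mulr_ge0_le0 ?(ltW c) // pmulr_rlt0 // lt_def tn.
Qed.

Lemma incell_open L sg x y : incell L sg x ->
  exists2 e : R, 0 < e & forall t, `|t| <= e -> incell L sg (x + t *: y).
Proof.
elim: L sg => [|f L IHL] [|b sg] //=; first by exists 1.
case/andP => c /IHL[e e0 he].
have v0 : 0 < `|ev f x| by rewrite normr_gt0; case: b c => c; [rewrite gt_eqF | rewrite lt_eqF].
pose e' := `|ev f x| / (1 + `|dot f.1 y|) / 2.
have p0 : 0 < 1 + `|dot f.1 y| by rewrite ltr_wpDr.
have e'0 : 0 < e' by rewrite !divr_gt0.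
exists (Num.min e e'); first by rewrite lt_min e0.
move=> t; rewrite le_min => /andP[te te']; rewrite he // andbT evD dotZ.
have small : `|t * dot f.1 y| < `|ev f x|.
  rewrite normrM; apply: (@le_lt_trans _ _ (e' * (1 + `|dot f.1 y|))).
    by apply: ler_pM => //; rewrite lerDr.
  rewrite /e' mulrAC divfK ?gt_eqF // ltr_pdivrMr // ltr_pMr //.
  by rewrite ltr1n.
case: b c => c; move: small.
  by rewrite (gtr0_norm c) ltr_norml => /andP[]; lra.
by rewrite (ltr0_norm c) ltr_norml => /andP[]; lra.
Qed.

Lemma asbool_nat (P Q : Prop) : (P <-> Q) -> (`[< P >] : nat) = `[< Q >].
Proof. by move=> h; congr nat_of_bool; apply/asboolP/asboolP => /h. Qed.

Lemma asboolF_nat (P : Prop) : ~ P -> (`[< P >] : nat) = 0%N.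
Proof. by move=> h; case: asboolP. Qed.

(* A hyperplane crossing a cell adds one cell; the recession cones decide
   which of the pieces are bounded. *)
Lemma good_split C L f sg : f.1 \notin fspan C -> f.1 \in fspan (C ++ L) ->
  (`[< good C (f :: L) (true :: sg) >] + `[< good C (f :: L) (false :: sg) >]
   = `[< good C L sg >] + `[< good (f :: C) L sg >])%N.
Proof.
move=> nC iCL.
have fl y : lin C y -> lin L y -> dot f.1 y = 0.
  by move=> h1 h2; apply: lin_fspan iCL; rewrite lin_cat h1.
have [[x0 /andP[fx0 cx0]]|ne] := pselect (exists x, onflat C x && incell L sg x); last first.
  rewrite !asboolF_nat //; move=> [[x /=]].
  - by move=> /andP[/andP[_ h1] h2] _; apply: ne; exists x; rewrite h1 h2.
  - by move=> h _; apply: ne; exists x.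
  - by move=> /andP[h1 /andP[_ h2]] _; apply: ne; exists x; rewrite h1 h2.
  by move=> /andP[h1 /andP[_ h2]] _; apply: ne; exists x; rewrite h1 h2.
have [[z /and3P[fz cz z0]]|nz] :=
    pselect (exists z, [&& onflat C z, incell L sg z & ev f z == 0]); last first.
  (* No point of the cell lies on the hyperplane, so by convexity the cell stays on one side and a
     single half is nonempty. *)
  have same x x' : onflat C x -> incell L sg x -> onflat C x' -> incell L sg x' ->
      0 < ev f x -> ev f x' < 0 -> False.
    move=> h1 h2 h3 h4 p q; apply: nz; pose t := ev f x / (ev f x - ev f x').
    have dn : 0 < ev f x - ev f x' by lra.
    have t01 : 0 <= t <= 1.
      by rewrite divr_ge0 ?(ltW p) ?(ltW dn) //= ler_pdivrMr // mul1r; lra.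
    exists (x + t *: (x' - x)); rewrite onflatD ?linZ ?onflatB // incell_convex //= evD dotZ.
    have -> : dot f.1 (x' - x) = ev f x' - ev f x by rewrite /ev dotD -scaleN1r dotZ; ring.
    have ht : t * (ev f x - ev f x') = ev f x by rewrite /t divfK ?gt_eqF.
    by apply/eqP; lra.
  have n0 : ~ good (f :: C) L sg.
    by move=> [[x /= /andP[/andP[h1 h2] h3]] _]; apply: nz; exists x; rewrite h2 h3.
  have ev0 : ev f x0 != 0.
    by apply/negP => h; apply: nz; exists x0; rewrite fx0 cx0 h.
  have side (s : bool) : (if s then 0 < ev f x0 else ev f x0 < 0) ->
      good C (f :: L) (s :: sg) <-> good C L sg.
    move=> hs; split=> -[_ rb]; split.
    - by exists x0; rewrite fx0.
    - move=> y ly ry; have /= h := rb y ly; suff /h/andP[] :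
        (if s then 0 <= dot f.1 y else dot f.1 y <= 0) && inrec L sg y by [].
      have cross t : 0 <= t -> ev f x0 + t * dot f.1 y = 0 -> False.
        move=> t0 e; apply: nz; exists (x0 + t *: y).
        by rewrite onflatD ?linZ // incell_rec //= evD dotZ e.
      rewrite ry andbT; case: s hs {h rb} => hs; rewrite leNgt; apply/negP => hd.
        apply: (cross (- ev f x0 / dot f.1 y)); last by rewrite divfK ?lt_eqF // subrr.
        by apply: mulr_le0; rewrite ?oppr_le0 ?invr_le0 ltW.
      apply: (cross (- ev f x0 / dot f.1 y)); last by rewrite divfK ?gt_eqF // subrr.
      by apply: mulr_ge0; rewrite ?oppr_ge0 ?invr_ge0 ltW.
    - by exists x0; rewrite fx0 /= hs.
    move=> y ly /= /andP[_ ry]; have h := rb y ly ry.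
    by rewrite h (fl _ ly h) eqxx.
  have [p|q|e] := ltgtP 0 (ev f x0); last by rewrite -e eqxx in ev0.
    rewrite (asbool_nat (side true p)) (asboolF_nat n0) [X in (_ + X)%N]asboolF_nat //.
    by move=> [[x /= /and3P[h1 h2 h3]] _]; apply: (same x0 x).
  rewrite (asbool_nat (side false q)) (asboolF_nat n0) [X in (X + _)%N]asboolF_nat ?addn0 //.
  by move=> [[x /= /and3P[h1 h2 h3]] _]; apply: (same x x0).
have [y0 ly0 d0] := notin_fspan nC.
have [e e0 he] := incell_open y0 cz.
have zt t : ev f (z + t *: y0) = t by rewrite evD dotZ d0 (eqP z0) add0r mulr1.
(* The cell meets the hyperplane at z, so all four pieces are nonempty and being [good] depends on
   recession cones only. *)
pose Pp := forall y, lin C y -> 0 <= dot f.1 y -> inrec L sg y -> lin (f :: L) y.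
pose Pm := forall y, lin C y -> dot f.1 y <= 0 -> inrec L sg y -> lin (f :: L) y.
pose P0 := forall y, lin C y -> dot f.1 y = 0 -> inrec L sg y -> lin L y.
have gp : good C (f :: L) (true :: sg) <-> Pp.
  split=> [[_ rb] y h1 h2 h3|h]; first by apply: rb; rewrite //= h2.
  split; last by move=> y h1 /= /andP[h2 h3]; apply: h.
  exists (z + e *: y0); rewrite onflatD ?linZ //= zt e0 he //.
  by rewrite gtr0_norm.
have gm : good C (f :: L) (false :: sg) <-> Pm.
  split=> [[_ rb] y h1 h2 h3|h]; first by apply: rb; rewrite //= h2.
  split; last by move=> y h1 /= /andP[h2 h3]; apply: h.
  exists (z + (- e) *: y0); rewrite onflatD ?linZ //= zt oppr_lt0 e0 he //.
  by rewrite normrN gtr0_norm.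
have g : good C L sg <-> relbounded C L sg.
  by split=> [[]|h] //; split=> //; exists z; rewrite fz.
have g0 : good (f :: C) L sg <-> P0.
  split=> [[_ rb] y h1 h2 h3|h]; first by apply: rb; rewrite //= h2 eqxx.
  split; last by move=> y /= /andP[/eqP h1 h2] h3; apply: h.
  by exists z; rewrite /= z0 fz.
rewrite (asbool_nat gp) (asbool_nat gm) (asbool_nat g) (asbool_nat g0).
have [rb|nrb] := pselect (relbounded C L sg).
  have full y : lin C y -> inrec L sg y -> lin (f :: L) y.
    by move=> h1 h2; have h := rb y h1 h2; rewrite /= h (fl _ h1 h) eqxx.
  do 4 (rewrite asboolT; last by move=> y h1 *; by [apply: full | apply: rb]); by [].
rewrite (asboolF_nat nrb) add0n.
have [p0|np0] := pselect P0; last first.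
  rewrite !asboolF_nat // => h; apply: np0 => y h1 h2 h3.
    by have /= /andP[] : lin (f :: L) y by apply: h; rewrite ?h2.
  by have /= /andP[] : lin (f :: L) y by apply: h; rewrite ?h2.
rewrite (asboolT p0).
have [y1 [l1 r1 n1]] : exists y1, [/\ lin C y1, inrec L sg y1 & ~~ lin L y1].
  apply: contrapT => hn; apply: nrb => y h1 h2; apply: contrapT => /negP h3.
  by apply: hn; exists y.
(* The cell is unbounded but its restriction is bounded. Recession directions on opposite sides of f
   would combine to one with f-value 0, lineal by [p0], and then y1 would be lineal. So the cone
   leans to one side, and exactly the other half is bounded. *)
have opp y : lin C y -> inrec L sg y -> dot f.1 y1 * dot f.1 y < 0 -> False.
  move=> ly ry hm; case/negP: n1.
  have pos : 0 < `|dot f.1 y| /\ 0 < `|dot f.1 y1|.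
    by rewrite !normr_gt0; split; apply: contraTneq hm => ->; rewrite ?mul0r ?mulr0 ltxx.
  apply: (@lin_comb L sg y1 y `|dot f.1 y| `|dot f.1 y1|) => //; try by case: pos.
  apply: p0; [by rewrite linD ?linZ | | by rewrite inrec_comb].
  rewrite dotD !dotZ; case: (ltgtP 0 (dot f.1 y1)) hm => [q|q|<-]; last by rewrite mul0r ltxx.
    by rewrite pmulr_rlt0 // => q'; rewrite (gtr0_norm q) (ltr0_norm q'); ring.
  by rewrite nmulr_rlt0 // => q'; rewrite (ltr0_norm q) (gtr0_norm q'); ring.
have ne1 : dot f.1 y1 != 0 by apply: contraNneq n1 => h; apply: p0.
have fin y : lin C y -> inrec L sg y -> dot f.1 y = 0 -> lin (f :: L) y.
  by move=> h1 h2 h3; rewrite /= h3 eqxx; apply: p0.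
have [q|q|e1] := ltgtP 0 (dot f.1 y1); last by rewrite -e1 eqxx in ne1.
  rewrite asboolF_nat ?asboolT // => [y h1 h2 h3|h].
    apply: fin => //; apply/eqP; rewrite eq_le h2 /= leNgt; apply/negP => h4.
    by apply: (opp y) => //; rewrite pmulr_rlt0.
  by have := h y1 l1 (ltW q) r1; rewrite /= (negbTE n1) andbF.
rewrite asboolT ?asboolF_nat // => [h|y h1 h2 h3].
  by have := h y1 l1 (ltW q) r1; rewrite /= (negbTE n1) andbF.
apply: fin => //; apply/eqP; rewrite eq_le h2 andbT leNgt; apply/negP => h4.
by apply: (opp y) => //; rewrite nmulr_rlt0.
Qed.

(** Some direction y0 changes f alone. Each half recedes along y0 or its opposite, and sliding along
    y0 identifies the cell with its restriction to the hyperplane of f. *)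
Lemma good_coloop C L f sg : f.1 \notin fspan (C ++ L) ->
  [/\ ~ good C (f :: L) (true :: sg), ~ good C (f :: L) (false :: sg)
    & good C L sg <-> good (f :: C) L sg].
Proof.
move=> ni; have [y0] := notin_fspan ni; rewrite lin_cat => /andP[lC lL] d0.
have bad s : ~ good C (f :: L) (s :: sg).
  move=> [[x /= /and3P[_ _ cx]] rb].
  have := rb (if s then y0 else (-1) *: y0); case: s {rb} => /= h.
    by have := h lC; rewrite d0 ler01 (lin_inrec cx lL) oner_eq0 => /(_ isT).
  have := h (linZ _ lC); rewrite dotZ d0 mulr1 lerN10 (lin_inrec cx (linZ _ lL)).
  by rewrite oppr_eq0 oner_eq0 => /(_ isT).
split=> //; split=> -[[x /= hx] rb]; split.
- case/andP: hx => fx cx; exists (x + (- ev f x) *: y0).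
  by rewrite /= evD dotZ d0 mulr1 subrr eqxx onflatD ?linZ // incell_lin ?linZ.
- by move=> y /= /andP[_ ly]; apply: rb.
- by case/andP: hx => /andP[_ fx] cx; exists x; rewrite fx.
move=> y ly ry; have := rb (y + (- dot f.1 y) *: y0).
rewrite /= dotD dotZ d0 mulr1 subrr eqxx linD ?linZ // inrec_lin ?linZ // => /(_ isT ry) h.
by rewrite -[y](addrK ((- dot f.1 y) *: y0)) -scaleNr linD ?linZ.
Qed.

Lemma eq_euler_flats C C' L : (forall x, onflat C x = onflat C' x) ->
  euler_flats C L = euler_flats C' L.
Proof.
elim: L C C' => [|f L IHL] C C' h /=.
  congr (if _ then _ else _); apply/asboolP/asboolP => -[x hx]; exists x; by rewrite ?h // -h.
by rewrite (IHL C C' h) (IHL (f :: C) (f :: C')) // => x /=; rewrite h.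
Qed.

Lemma euler_flats_empty C L : ~ (exists x, onflat C x) -> euler_flats C L = 0.
Proof.
elim: L C => [|f L IHL] C h /=; first by case: asboolP.
by rewrite !IHL ?subrr // => -[x /= hx]; apply: h; exists x; case/andP: hx.
Qed.

Lemma bounded_cells_cons C f L : bounded_cells C (f :: L)
  = (\sum_(sg <- sign_vectors (size L))
      (`[< good C (f :: L) (true :: sg) >] + `[< good C (f :: L) (false :: sg) >]))%N.
Proof.
rewrite /bounded_cells /= count_cat !count_map big_split /= -!sum1_count.
by congr (_ + _)%N; rewrite big_mkcond; apply: eq_bigr => sg _ /=; case: asboolP.
Qed.

Lemma bounded_cellsE C L : bounded_cells C L
  = (\sum_(sg <- sign_vectors (size L)) `[< good C L sg >])%N.
Proof. by rewrite /bounded_cells -sum1_count big_mkcond; apply: eq_bigr => sg _; case: asboolP. Qed.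

(** A form constant on the flat either vanishes there, making both sides zero, or has an empty
    restriction. A form varying on the flat and dependent on C and L falls under [good_split]; for
    an independent one the deletion and restriction terms cancel and no bounded cell remains. *)
Lemma euler_flatsE C L : euler_flats C L
  = (-1) ^+ (\dim (fspan (C ++ L)) + \dim (fspan C)) * (bounded_cells C L)%:R.
Proof.
elim: L C => [|f L IHL] C.
  rewrite cats0 addnn -mul2n exprM sqrrN expr1n mul1r /= bounded_cellsE /= big_seq1.
  case: asboolP => [h|h]; last by rewrite asboolF_nat // => -[[x]]; rewrite andbT => hx _; apply: h; exists x.
  by rewrite asboolT //; split; [case: h => x hx; exists x; rewrite hx | move=> y].
have [[x0 fx0]|ne] := pselect (exists x, onflat C x); last first.
  rewrite euler_flats_empty // bounded_cells_cons big1 ?mulr0 // => sg _.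
  by rewrite !asboolF_nat // => -[[x /andP[hx _]] _]; apply: ne; exists x.
have sgS m : (-1) ^+ m.+1 = - (-1) ^+ m :> int by rewrite exprS mulN1r.
rewrite /= dim_fspan_mid dim_fspan_cons; case: (boolP (f.1 \in fspan C)) => iC.
  have const x : onflat C x -> ev f x = ev f x0.
    move=> fx; have := lin_fspan (onflatB fx0 fx) iC.
    by rewrite /ev dotD -scaleN1r dotZ mulN1r => /eqP; rewrite subr_eq0 => /eqP ->.
  rewrite fspan_catl //= addn0.
  have [e0|ne0] := eqVneq (ev f x0) 0.
    rewrite (@eq_euler_flats (f :: C) C) ?subrr => [|x /=]; last first.
      by case: (boolP (onflat C x)) => [/const ->|]; rewrite ?andbF ?e0 ?eqxx.
    rewrite bounded_cells_cons big1 ?mulr0 // => sg _.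
    by rewrite !asboolF_nat // => -[[x /= /and3P[/const -> h _]] _]; rewrite e0 ltxx in h.
  rewrite (@euler_flats_empty (f :: C)) => [|[x /= /andP[h /const e]]]; last first.
    by rewrite -e h in ne0.
  rewrite subr0 IHL; congr (_ * _%:R); rewrite bounded_cells_cons bounded_cellsE.
  apply: eq_bigr => sg _.
  have side (s : bool) : (if s then 0 < ev f x0 else ev f x0 < 0) ->
      good C L sg <-> good C (f :: L) (s :: sg).
    move=> hs; split=> -[[x /= hx] rb]; split.
    - by case/andP: hx => fx cx; exists x; rewrite /= fx cx (const _ fx) hs.
    - by move=> y ly /= /andP[_ ry]; rewrite (lin_fspan ly iC) eqxx; apply: rb.
    - by case/and3P: hx => fx _ cx; exists x; rewrite fx.
    move=> y ly ry; have /= := rb y ly; rewrite (lin_fspan ly iC) lexx if_same ry.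
    by case/(_ isT)/andP.
  have [p|q|e] := ltgtP 0 (ev f x0); last by rewrite -e eqxx in ne0.
    rewrite -(asbool_nat (side true p)) [X in (_ + X)%N]asboolF_nat ?addn0 //.
    by move=> [[x /= /and3P[/const -> h _]] _]; rewrite ltNge (ltW p) in h.
  rewrite -(asbool_nat (side false q)) [X in (X + _)%N]asboolF_nat ?add0n //.
  by move=> [[x /= /and3P[/const -> h _]] _]; rewrite ltNge (ltW q) in h.
rewrite !IHL dim_fspan_cons iC /= -/(fspan (f :: C ++ L)) dim_fspan_cons bounded_cells_cons.
case: (boolP (f.1 \in fspan (C ++ L))) => iCL /=; rewrite ?addn0 ?addn1.
  rewrite addnS sgS mulNr opprK -mulrDr -natrD; congr (_ * _%:R).
  rewrite !bounded_cellsE -big_split; apply: eq_bigr => sg _.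
  by rewrite (good_split _ iC iCL).
rewrite addSn addnS !sgS opprK -mulrBr [X in _ = _ * X%:R]big1 ?mulr0 => [|sg _]; last first.
  by have [h1 h2 _] := good_coloop sg iCL; rewrite !asboolF_nat.
rewrite (_ : bounded_cells (f :: C) L = bounded_cells C L) ?subrr ?mulr0 //.
rewrite !bounded_cellsE; apply: eq_bigr => sg _.
by have [_ _ h] := good_coloop sg iCL; rewrite (asbool_nat h).
Qed.

End AffineCells.

(** * Regions of the gain graph arrangement *)

Lemma mem_sign_vectors m (sg : seq bool) : (sg \in sign_vectors m) = (size sg == m).
Proof.
elim: m sg => [|m IHm] [|s sg] //=.
  by apply/negP; rewrite mem_cat => /orP[] /mapP[].
rewrite eqSS -IHm mem_cat; apply/orP/idP => [[] /mapP[t ht [_ ->]]|h] //.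
by case: s; [left|right]; apply: map_f.
Qed.

Lemma uniq_sign_vectors m : uniq (sign_vectors m).
Proof.
elim: m => [|m IHm] //=; rewrite cat_uniq !map_inj_uniq ?IHm ?andbT //=; try by move=> s t [].
by apply/hasPn => _ /mapP[s _ ->]; apply/negP => /mapP[].
Qed.

Section CellSigns.
Variables (R : realFieldType) (d : nat).
Local Open Scope ring_scope.
Implicit Types (L : seq ('rV[R]_d * R)) (sg : seq bool) (x : 'cV[R]_d).

Lemma incell_inj L sg sg' x : incell L sg x -> incell L sg' x -> sg = sg'.
Proof.
elim: L sg sg' => [|f L IHL] [|s sg] [|s' sg'] //= /andP[h1 h2] /andP[h3 h4].
by rewrite (IHL _ _ h2 h4); case: s s' h1 h3 => -[] // h1 h3; rewrite ltNge (ltW h1) in h3.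
Qed.

Lemma incell_neq0 (T : eqType) (F : T -> 'rV[R]_d * R) (s : seq T) sg x :
  incell (map F s) sg x -> forall e, e \in s -> ev (F e) x != 0.
Proof.
elim: s sg => [|e s IHs] [|b sg] //= /andP[h1 h2] f; rewrite inE => /orP[/eqP ->|].
  by case: b h1 => h1; [rewrite gt_eqF | rewrite lt_eqF].
by move=> fs; apply: (IHs _ h2).
Qed.

Lemma incell_signs (T : eqType) (F : T -> 'rV[R]_d * R) (s : seq T) x :
  (forall e, e \in s -> ev (F e) x != 0) -> incell (map F s) [seq 0 < ev (F e) x | e <- s] x.
Proof.
elim: s => //= e s IHs h; rewrite IHs => [|f fs]; last by apply: h; rewrite inE fs orbT.
by rewrite andbT; have := h e (mem_head _ _); case: ltgtP.
Qed.

Lemma inrec_map (T : eqType) (F : T -> 'rV[R]_d * R) (p : T -> bool) (s : seq T) x :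
  (forall e, e \in s -> if p e then 0 <= dot (F e).1 x else dot (F e).1 x <= 0) ->
  inrec (map F s) (map p s) x.
Proof.
elim: s => //= e s IHs h; rewrite IHs ?andbT => [|f fs]; first exact: h (mem_head _ _).
by apply: h; rewrite inE fs orbT.
Qed.

End CellSigns.

Section Regions.
Variables (R : realType) (n N : nat) (a : int).
Hypotheses (n_gt0 : (0 < n)%N) (N_gt0 : (0 < N)%N).
Local Notation V := 'I_n.
Local Notation E := (gedge n N).
Local Open Scope ring_scope.
Implicit Types (e f : E) (X A S : {set E}).

Definition consistent X := `[< exists x : V -> R, X \subset sats N a x >].
Definition closure_flat X : {set E} :=
  [set e | `[< forall x : V -> R, X \subset sats N a x -> sat a x e >]]%SET.
Local Notation cl := closure_flat.

Lemma closure_flatP X e :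
  reflect (forall x : V -> R, X \subset sats N a x -> sat a x e) (e \in cl X).
Proof. by rewrite inE; apply: asboolP. Qed.

Lemma sub_closure_flat X : X \subset cl X.
Proof.
apply/fintype.subsetP => e eX; apply/closure_flatP => x /fintype.subsetP/(_ e eX).
by rewrite inE.
Qed.

Lemma closure_flat_sats X (x : V -> R) : X \subset sats N a x -> cl X \subset sats N a x.
Proof. by move=> h; apply/fintype.subsetP => e /closure_flatP/(_ x h); rewrite inE. Qed.

Lemma closure_flat_min X A : A \subset cl X -> cl A \subset cl X.
Proof.
move=> h; apply/fintype.subsetP => e /closure_flatP he; apply/closure_flatP => x hx.
by apply: he; apply: fintype.subset_trans h (closure_flat_sats hx).
Qed.

Lemma gain_flat_closure X : consistent X -> gain_flat a (cl X).
Proof.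
move=> /asboolP[x hx]; split=> [s es cw ses|C f bC fC sC].
  have ses' : {subset es <= sats N a x}.
    by move=> e /ses; apply/fintype.subsetP; apply: closure_flat_sats.
  by apply/eqP; rewrite -(intr_eq0 R) (circle_gain cw ses').
apply/closure_flatP => z hz.
have := balanced_circle_sats bC fC (fintype.subset_trans sC (closure_flat_sats hz)).
by rewrite inE.
Qed.

(** Both sums are grouped by closure. Below the closure Y of a consistent set every subset is
    consistent, so both families have total 1 or 0 according to whether Y is empty; induction on the
    size of Y, in the manner of Moebius inversion, makes the groups agree. *)
Lemma sum_consistent (ord : E -> nat) : injective ord ->
  \sum_(A : {set E} | consistent A) (-1) ^+ #|A|
  = \sum_(S : {set E} | `[< NBC_set a ord S >]) (-1) ^+ #|S| :> rat.
Proof.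
move=> oi.
have nbc_cons S : `[< NBC_set a ord S >] -> consistent S.
  by move=> /asboolP[fS _]; apply/asboolP; apply: forest_sat.
pose h (P : pred {set E}) (Y : {set E}) := \sum_(A | P A && (cl A == Y)) (-1) ^+ #|A| : rat.
have hsum (P : pred {set E}) : \sum_(A | P A) (-1) ^+ #|A| = \sum_Y h P Y.
  by rewrite (partition_big cl predT).
rewrite !hsum; apply: eq_bigr => Y _.
move: {2}#|Y|.+1 (ltnSn #|Y|) => m; elim: m Y => // m IHm Y hm.
have [[A0 cA0 eY]|nY] := pselect (exists2 A0, consistent A0 & cl A0 = Y); last first.
  rewrite /h !big_pred0 // => A; apply/negP => /andP[hA /eqP e]; apply: nY; exists A => //.
  exact: nbc_cons.
have consY A : A \subset Y -> consistent A.
  rewrite -eY => hA; move/asboolP: cA0 => [x hx]; apply/asboolP; exists x.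
  exact: fintype.subset_trans hA (closure_flat_sats hx).
have clY A : (cl A \subset Y) = (A \subset Y).
  apply/idP/idP => [|hA]; first exact: fintype.subset_trans (sub_closure_flat A).
  by rewrite -eY; apply: closure_flat_min; rewrite eY.
have below (P : pred {set E}) : \sum_(A | P A && (A \subset Y)) (-1) ^+ #|A|
    = \sum_(Z : {set E} | Z \subset Y) h P Z.
  rewrite (partition_big cl (fun Z : {set E} => Z \subset Y)) /=; last first.
    by move=> A /andP[_]; rewrite clY.
  apply: eq_bigr => Z ZY; apply: eq_bigl => A.
  by case: eqP => [e|_]; rewrite ?andbF // !andbT -clY e ZY andbT.
have tot : \sum_(Z : {set E} | Z \subset Y) h consistent Z
    = \sum_(Z : {set E} | Z \subset Y) h (fun S => `[< NBC_set a ord S >]) Z.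
  rewrite -!below.
  have -> : \sum_(A : {set E} | consistent A && (A \subset Y)) (-1) ^+ #|A|
      = \sum_(A : {set E} | A \subset Y) (-1) ^+ #|A| :> rat.
    by apply: eq_bigl => A; case AY: (A \subset Y); rewrite ?andbF // andbT consY.
  have gY : gain_flat a Y by rewrite -eY; apply: gain_flat_closure.
  by rewrite (sum_NBC_flat oi gY) (sum_subset_exp (-1) Y) subrr expr0n cards_eq0.
move: tot; rewrite (bigD1 Y) //= [RHS](bigD1 Y) //=.
rewrite [X in _ + X = _ -> _](eq_bigr (h (fun S => `[< NBC_set a ord S >]))); first exact: addIr.
move=> Z /andP[ZY nZY]; apply: IHm; rewrite ltnS in hm; apply: leq_trans hm.
by apply: proper_card; rewrite finset.properEneq nZY.
Qed.

(** The value y = -1 in [sum_NBC_sets], where only the bases of activity 0 survive. *)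
Lemma sum_NBC_sign (ord : E -> nat) : injective ord ->
  \sum_(S : {set E} | `[< NBC_set a ord S >]) (-1) ^+ #|S|
  = (-1) ^+ n.-1 * #|[set B : {set E} | `[< NBC_basis a ord B >] && (activity ord B == 0%N)]%SET|%:R :> rat.
Proof.
move=> oi; transitivity ((-1) ^+ n.-1 * \sum_(S : {set E} | `[< NBC_set a ord S >])
    (-1) ^+ (n.-1 - #|S|) : rat).
  rewrite mulr_sumr; apply: eq_bigr => S /asboolP[fS _].
  have [B tB sB] := forest_extend N_gt0 fS.
  have cS : (#|S| <= n.-1)%N by rewrite -(card_spanning_tree a n_gt0 tB) subset_leq_card.
  by rewrite -{1}(subnK cS) exprD mulrAC -expr2 sqrr_sign mul1r.
rewrite (sum_NBC_sets a oi n_gt0 N_gt0) -sum1_card natr_sum; congr (_ * _).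
rewrite [LHS]big_mkcond [RHS]big_mkcond; apply: eq_bigr => B _; rewrite inE subrr expr0n.
by case: `[< _ >] => //=; case: eqP.
Qed.

Definition sum_form : 'rV[R]_n * R := (const_mx 1, 0).
Definition edge_form e : 'rV[R]_n * R :=
  (delta_mx ord0 (edst e) - delta_mx ord0 (esrc e), (egain a e)%:~R).
Local Notation C0 := [:: sum_form].
Local Notation L0 := [seq edge_form e | e <- enum {: E}].

Lemma dot_sum_form (y : 'cV[R]_n) : dot sum_form.1 y = \sum_i y i ord0.
Proof. by rewrite /dot mxE; apply: eq_bigr => i _; rewrite mxE mul1r. Qed.

Lemma dot_edge_form e (y : 'cV[R]_n) :
  dot (edge_form e).1 y = y (edst e) ord0 - y (esrc e) ord0.
Proof.
rewrite /dot mulmxBl mxE [X in _ + X]mxE !mxE; congr (_ - _).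
  rewrite (bigD1 (edst e)) //= mxE !eqxx mul1r big1 ?addr0 // => i ni.
  by rewrite mxE (negbTE ni) andbF mul0r.
rewrite (bigD1 (esrc e)) //= mxE !eqxx mul1r big1 ?addr0 // => i ni.
by rewrite mxE (negbTE ni) andbF mul0r.
Qed.

Lemma ev_edge_form e y : (ev (edge_form e) y == 0) = sat a (fun v => y v ord0) e.
Proof. by rewrite /ev dot_edge_form subr_eq0. Qed.

(** Subtracting the mean of a potential changes no difference, so the restriction to coordinate sum
    zero does not affect consistency. *)
Lemma consistent_sum_form X :
  consistent X = `[< exists x, (dot sum_form.1 x == 0) && (X \subset sats N a (fun v => x v ord0)) >].
Proof.
apply/asboolP/asboolP => [[x hx]|[x /andP[_ hx]]]; last by exists (fun v => x v ord0).
pose c := (\sum_i x i) / n%:R; exists (\col_i (x i - c)).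
apply/andP; split.
  rewrite dot_sum_form; under eq_bigr do rewrite mxE.
  by rewrite sumrB sumr_const card_ord /c -[_ *+ n]mulr_natr divfK ?subrr // pnatr_eq0 -lt0n.
apply/fintype.subsetP => e /(fintype.subsetP hx).
by rewrite !inE /sat !mxE => /eqP <-; apply/eqP; ring.
Qed.

(** The set X collects the edges already moved into C; splitting the subsets A by membership of the
    next edge reproduces the recursion. *)
Lemma euler_flats_edges s C X : uniq s -> (forall e, e \in s -> e \notin X) ->
  (forall x, onflat C x = (dot sum_form.1 x == 0) && (X \subset sats N a (fun v => x v ord0))) ->
  (euler_flats C [seq edge_form e | e <- s])%:~R
  = \sum_(A : {set E} | A \subset [set e in s]%SET) (-1) ^+ #|A| * (consistent (X :|: A)%SET)%:R :> rat.
Proof.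
elim: s C X => [|e s IHs] C X /=.
  move=> _ _ hC; rewrite (big_pred1 finset.set0) => [|A]; last first.
    have -> : [set e in [::]]%SET = finset.set0 :> {set E} by apply/setP => f; rewrite !inE.
    by rewrite finset.subset0.
  rewrite cards0 mul1r finset.setU0 consistent_sum_form.
  have -> : (exists x, onflat C x) = (exists x, (dot sum_form.1 x == 0) &&
      (X \subset sats N a (fun v => x v ord0))).
    by rewrite propeqE; split=> -[x hx]; exists x; rewrite ?hC // -hC.
  by case: `[< _ >].
move=> /andP[es us] hX hC; rewrite intrB (IHs C X) //; last first.
  by move=> f fs; apply: hX; rewrite inE fs orbT.
rewrite (IHs (edge_form e :: C) (e |: X)%SET) //; last first.
- move=> x /=; rewrite hC ev_edge_form finset.subUset finset.sub1set inE.
  by rewrite andbCA.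
- move=> f fs; rewrite !inE negb_or hX ?inE ?fs ?orbT // andbT.
  by apply: contraNneq es => <-.
rewrite [RHS](bigID (fun A : {set E} => e \in A)) /= addrC; congr (_ + _).
  apply: eq_bigl => A; apply/idP/andP => [/fintype.subsetP h|[/fintype.subsetP h eA]].
    split; first by apply/fintype.subsetP => f /h; rewrite !inE => ->; rewrite orbT.
    by apply: contraNN es => /h; rewrite inE.
  apply/fintype.subsetP => f fA; have := h f fA; rewrite !inE => /orP[/eqP fe|//].
  by rewrite -fe fA in eA.
rewrite [RHS](reindex_onto (fun A => e |: A)%SET (fun A => A :\ e)%SET) /=; last first.
  by move=> A /andP[_ eA]; rewrite finset.setD1K.
rewrite -sumrN; apply: eq_big => A.
  rewrite setU11 andbT; apply/idP/andP => [/fintype.subsetP h|[/fintype.subsetP h /eqP eA]].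
    have eA : e \notin A by apply: contraNN es => /h; rewrite inE.
    rewrite setU1K //; split=> //; apply/fintype.subsetP => f; rewrite !inE.
    by case/orP => [->//|/h]; rewrite inE => ->; rewrite orbT.
  apply/fintype.subsetP => f fA; have := h f; rewrite !inE fA orbT => /(_ isT) /orP[/eqP fe|//].
  by move: fA; rewrite -eA fe !inE eqxx.
move=> /fintype.subsetP h; have eA : e \notin A by apply: contraNN es => /h; rewrite inE.
rewrite cardsU1 eA add1n exprS mulN1r mulNr; congr (- (_ * (consistent _)%:R)).
by rewrite -finset.setUA finset.setUCA.
Qed.

(** Two natural numbers that agree up to sign are equal; absolute values eliminate the dimensions in
    [euler_flatsE]. *)
Lemma bounded_cells_NBC (ord : E -> nat) : injective ord ->
  bounded_cells C0 L0
  = #|[set B : {set E} | `[< NBC_basis a ord B >] && (activity ord B == 0%N)]%SET|.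
Proof.
move=> oi.
have e1 : `|(euler_flats C0 L0)%:~R| = (bounded_cells C0 L0)%:R :> rat.
  rewrite -intr_norm euler_flatsE normrM normrX normrN1 expr1n mul1r normr_nat.
  by rewrite rmorph_nat.
have e2 : (euler_flats C0 L0)%:~R = (-1) ^+ n.-1
    * #|[set B : {set E} | `[< NBC_basis a ord B >] && (activity ord B == 0%N)]%SET|%:R :> rat.
  rewrite (@euler_flats_edges (enum {: E}) C0 finset.set0 (enum_uniq {: E})).
  - rewrite -sum_NBC_sign // -sum_consistent // [RHS]big_mkcond; apply: eq_big => A.
      by apply/fintype.subsetP => e _; rewrite inE mem_enum.
    by rewrite finset.set0U; case: (consistent A); rewrite ?mulr1 ?mulr0.
  - by move=> e _; rewrite inE.
  by move=> x; rewrite finset.sub0set andbT /onflat /all andbT /ev subr0.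
move: e1; rewrite e2 normrM normrX normrN1 expr1n mul1r normr_nat.
by move/eqP; rewrite eqr_nat => /eqP ->.
Qed.

Local Notation compl := (@arr_complement R n N a).
Definition cell (sg : seq bool) : set 'rV[R]_n :=
  [set x | onflat C0 x^T && incell L0 sg x^T]%classic.
Definition signs (x : 'rV[R]_n) : seq bool := [seq 0 < ev (edge_form e) x^T | e <- enum {: E}].

Lemma cellE sg x : cell sg x = (onflat C0 x^T && incell L0 sg x^T).
Proof. by []. Qed.

Lemma ev_edge_formT e (x : 'rV[R]_n) :
  ev (edge_form e) x^T = x ord0 (edst e) - x ord0 (esrc e) - (egain a e)%:~R.
Proof. by rewrite /ev dot_edge_form !mxE. Qed.

Lemma onflat_sumT (x : 'rV[R]_n) : onflat C0 x^T = (\sum_i x ord0 i == 0).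
Proof.
rewrite /= andbT /ev subr0 dot_sum_form; congr (_ == _).
by apply: eq_bigr => i _; rewrite mxE.
Qed.

Lemma cell_compl sg x : cell sg x -> compl x.
Proof.
move=> /andP[]; rewrite onflat_sumT => /eqP s0 c; split=> // -[e _ he].
have := incell_neq0 c (mem_enum {: E} e); rewrite ev_edge_formT.
by move: he; rewrite /hyperplane /= => ->; rewrite subrr eqxx.
Qed.

Lemma compl_cell x : compl x -> cell (signs x) x.
Proof.
move=> [s0 nh]; apply/andP; split; first by rewrite onflat_sumT; apply/eqP.
apply: incell_signs => e _; rewrite ev_edge_formT; apply/negP => /eqP h; apply: nh.
by exists e => //; rewrite /hyperplane /=; apply/eqP; rewrite -subr_eq0 h.
Qed.

Lemma cell_signs sg x : cell sg x -> sg = signs x.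
Proof.
move=> h; have /andP[_ h'] := compl_cell (cell_compl h).
by case/andP: h => _ h; apply: incell_inj h h'.
Qed.

(** A connected set avoiding the hyperplanes keeps every sign by the intermediate value property;
    conversely, segments inside a cell connect it. *)
Lemma component_cell x : compl x -> connected_component compl x = cell (signs x).
Proof.
move=> cx; apply/seteqP; split=> y.
  move=> [B [Bx BA cB] By]; have cy := compl_cell (BA y By).
  suff -> : signs x = signs y by [].
  apply: eq_map => e; pose g (z : 'rV[R]_n) := z ord0 (edst e) - z ord0 (esrc e).
  pose c : R := (egain a e)%:~R.
  have gE z : ev (edge_form e) z^T = g z - c by rewrite ev_edge_formT.
  have gc : continuous g.
    have c1 i : continuous (fun z : 'rV[R]_n => z ord0 i) by apply: coord_continuous.
    by move=> z; exact: (cvgB (c1 _ z) (c1 _ z)).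
  have /connected_intervalP gi : connected (g @` B)%classic.
    by apply: connected_continuous_connected => //; apply: continuous_subspaceT.
  have key u v : B u -> B v -> c < g u -> c < g v.
    move=> Bu Bv gu; rewrite ltNge; apply/negP => gv.
    have [w Bw gw] : (g @` B)%classic c.
      by apply: (gi (g v) (g u)); [exists v|exists u|rewrite gv ltW].
    have /andP[_ h] := compl_cell (BA w Bw).
    by have := incell_neq0 h (mem_enum {: E} e); rewrite gE gw subrr eqxx.
  by rewrite !gE !subr_gt0; apply/idP/idP; apply: key.
move=> cy; pose f (t : R) := x + t *: (y - x).
apply: (@connected_component_max _ _ (f @` `[0, 1])%classic).
- by exists 0; rewrite /f ?scale0r ?addr0 //= in_itv /= lexx ler01.
- move=> _ [t /= + <-]; rewrite in_itv /= => t01.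
  apply: (@cell_compl (signs x)); have /andP[f1 c1] := compl_cell cx; case/andP: cy => f2 c2.
  have e : (f t)^T = x^T + t *: (y^T - x^T) by apply/matrixP => i j; rewrite !mxE.
  by rewrite cellE e onflatD ?linZ ?onflatB // incell_convex.
- apply: connected_continuous_connected; first exact: segment_connected.
  apply: continuous_subspaceT => t; apply: cvgD; first exact: cvg_cst.
  by apply: cvgZ; [exact: cvg_id|exact: cvg_cst].
by exists 1; rewrite /f ?scale1r ?[x + _]addrC ?subrK //= in_itv /= lexx ler01.
Qed.

Lemma ler_entry_norm (z : 'rV[R]_n) i : `|z ord0 i| <= `|z|.
Proof.
rewrite [X in _ <= X]/Num.norm /= mx_normrE.
exact: (le_bigmax _ (fun ij : 'I_1 * 'I_n => `|z ij.1 ij.2|) (ord0, i)).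
Qed.

Lemma norm_ler_entries (z : 'rV[R]_n) D : 0 <= D -> (forall i, `|z ord0 i| <= D) -> `|z| <= D.
Proof.
move=> D0 h; rewrite [X in X <= _]/Num.norm /= mx_normrE; apply/bigmax_leP; split=> // -[i j] _ /=.
by rewrite (ord1 i).
Qed.

Lemma cell_bounded_relbounded x : compl x -> bounded_set (cell (signs x)) ->
  relbounded C0 L0 (signs x).
Proof.
move=> cx [M0 [_ hM]] y ly ry; apply: contrapT => /negP/allPn[_ /mapP[e _ ->] ne].
have [i yi] : exists i, y i ord0 != 0.
  apply: contrapT => hn; case/negP: ne; rewrite dot_edge_form.
  have y0 j : y j ord0 = 0 by apply: contrapT => /eqP h; apply: hn; exists j.
  by rewrite !y0 subrr.
pose M := `|M0| + 1; have MM : M0 < M by rewrite /M ltr_pwDr // ler_norm.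
have M_ge0 : 0 <= M by rewrite addr_ge0.
(* Far enough along the ray for coordinate i to exceed M even after losing the contribution of x. *)
pose t := (M + `|x ord0 i| + 1) / `|y i ord0|.
have yi0 : 0 < `|y i ord0| by rewrite normr_gt0.
have t0 : 0 <= t by rewrite divr_ge0 // !addr_ge0.
have cz : cell (signs x) (x^T + t *: y)^T.
  rewrite cellE trmxK; have /andP[f1 c1] := compl_cell cx.
  by rewrite onflatD ?linZ // incell_rec.
have := le_trans (ler_entry_norm _ i) (hM _ MM _ cz); rewrite !mxE.
have h1 : `|t * y i ord0| = M + `|x ord0 i| + 1.
  by rewrite normrM (ger0_norm t0) divfK // gt_eqF.
have h2 : `|t * y i ord0| <= `|x ord0 i + t * y i ord0| + `|x ord0 i|.
  have e1 : t * y i ord0 = (x ord0 i + t * y i ord0) - x ord0 i by rewrite addrC addKr.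
  by rewrite {1}e1; apply: ler_normB.
by move=> h3; lra.
Qed.

(** An arc from i to j means that the cell bounds x_j - x_i from above. If some vertex is
    unreachable from u, the centered indicator function of the unreachable vertices is a recession
    direction that is not lineal. Hence the digraph is strongly connected, and paths bound all
    differences of coordinates. *)
Lemma relbounded_cell_bounded x : compl x -> relbounded C0 L0 (signs x) ->
  bounded_set (cell (signs x)).
Proof.
move=> cx rb; pose s e := 0 < ev (edge_form e) x^T.
pose arc : rel V := fun i j => [exists e : E,
  [&& esrc e == i, edst e == j & ~~ s e] || [&& edst e == i, esrc e == j & s e]].
have conn_arc u w : connect arc u w.
  apply: contraT => nuw; pose U v := connect arc u v.
  pose c : R := (\sum_(v < n) (~~ U v)%:R) / n%:R.
  pose y : 'cV[R]_n := \col_v ((~~ U v)%:R - c).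
  have dy e : dot (edge_form e).1 y = (~~ U (edst e))%:R - (~~ U (esrc e))%:R.
    by rewrite dot_edge_form !mxE; ring.
  have ly : lin C0 y.
    rewrite /= andbT dot_sum_form; under eq_bigr do rewrite mxE.
    rewrite sumrB sumr_const card_ord /c -[X in _ - X]mulr_natr divfK ?subrr //.
    by rewrite pnatr_eq0 -lt0n.
  have step i j : arc i j -> U i -> U j by move=> h hi; apply: connect_trans hi (connect1 h).
  have ry : inrec L0 (signs x) y.
    apply: inrec_map => e _; rewrite dy -/(s e); case se: (s e).
      have : U (edst e) -> U (esrc e).
        by apply: step; apply/existsP; exists e; rewrite !eqxx se orbT.
      by case: (U (edst e)); case: (U (esrc e)) => //= h; rewrite ?subrr ?subr0 ?ler01 //; have := h isT.
    have : U (esrc e) -> U (edst e).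
      by apply: step; apply/existsP; exists e; rewrite !eqxx se.
    case: (U (edst e)); case: (U (esrc e)) => //= h; rewrite ?subrr ?sub0r ?oppr_le0 ?ler01 //.
    by have := h isT.
  have /allP hl := rb y ly ry.
  have uw : u != w by apply: contraNneq nuw => ->; apply: connect0.
  have [e je] := edge_exists N_gt0 uw.
  have := hl _ (map_f edge_form (mem_enum {: E} e)); rewrite dy.
  have Uu : U u by apply: connect0.
  by case/orP: je => /andP[/eqP -> /eqP ->]; rewrite Uu /U (negbTE nuw) /= ?subr0 ?sub0r ?oppr_eq0 oner_eq0.
pose G : R := \sum_(e : E) `|(egain a e)%:~R|.
have G0 : 0 <= G by apply: sumr_ge0.
have gG e : `|(egain a e)%:~R : R| <= G.
  by rewrite /G (bigD1 e) //= lerDl; apply: sumr_ge0.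
(* A simple path has fewer than n arcs, and along each the coordinate rises by at most G. *)
pose D := n%:R * G; have D0 : 0 <= D by rewrite mulr_ge0.
exists D; split; first exact: num_real.
move=> M DM z cz; apply: le_trans (ltW DM); apply: norm_ler_entries => // i.
have sz e : (0 < ev (edge_form e) z^T) = s e.
  have /eq_in_map h := cell_signs cz; exact/esym/(h e (mem_enum {: E} e)).
have arcG u v : arc u v -> z ord0 v - z ord0 u <= G.
  case/existsP => e /orP[/and3P[/eqP <- /eqP <-]|/and3P[/eqP <- /eqP <-]]; rewrite -sz ev_edge_formT.
    by rewrite -leNgt => h; have := gG e; rewrite ler_norml => /andP[]; lra.
  by move=> h; have := gG e; rewrite ler_norml => /andP[]; lra.
have diff u v : z ord0 v - z ord0 u <= D.
  have /connectP[p0 hp0] := conn_arc u v; case: (shortenP hp0) => p hp uq _ ->.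
  apply: (@le_trans _ _ ((size p)%:R * G)).
    elim: p u {hp0 uq} hp => [|w p IHp] u /=; first by rewrite subrr mul0r.
    by case/andP => /arcG h1 /IHp h2; rewrite -nat1r mulrDl mul1r; lra.
  rewrite ler_wpM2r // ler_nat; apply: (@leq_trans (size (u :: p))) => //.
  by rewrite -(card_uniqP uq) -[X in (_ <= X)%N]card_ord; apply: max_card.
have nR : 0 < n%:R :> R by rewrite ltr0n.
have s0 : \sum_j z ord0 j = 0 by case/andP: cz; rewrite onflat_sumT => /eqP.
(* As the coordinates sum to zero, n times one of them is the sum of its differences from all of
   them. *)
have h1 : n%:R * z ord0 i <= n%:R * D.
  have -> : n%:R * z ord0 i = \sum_j (z ord0 i - z ord0 j).
    by rewrite sumrB s0 subr0 sumr_const card_ord mulr_natl.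
  have -> : n%:R * D = \sum_(j < n) D by rewrite sumr_const card_ord mulr_natl.
  by apply: ler_sum => j _.
have h2 : n%:R * - z ord0 i <= n%:R * D.
  have -> : n%:R * - z ord0 i = \sum_j (z ord0 j - z ord0 i).
    by rewrite sumrB s0 sub0r sumr_const card_ord mulr_natl mulNrn.
  have -> : n%:R * D = \sum_(j < n) D by rewrite sumr_const card_ord mulr_natl.
  by apply: ler_sum => j _.
rewrite ler_norml; apply/andP; split; first by rewrite lerNl -(ler_pM2l nR).
by rewrite -(ler_pM2l nR).
Qed.

Lemma card_bounded_regions :
  (@bounded_regions R n N a #= `I_(bounded_cells C0 L0))%card.
Proof.
pose gs := [seq sg <- sign_vectors (size L0) | `[< good C0 L0 sg >]].
have sgs : size gs = bounded_cells C0 L0 by rewrite size_filter.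
pose F (i : nat) := cell (nth [::] gs i).
have good_gs i : (i < size gs)%N -> good C0 L0 (nth [::] gs i).
  by move=> hi; have := mem_nth [::] hi; rewrite mem_filter => /andP[/asboolP].
have -> : @bounded_regions R n N a = (F @` `I_(size gs))%classic.
  apply/seteqP; split=> [Rg [[x [cx ->]]]|_ [i hi <-]].
    rewrite component_cell // => bd; have cc := compl_cell cx.
    have hin : signs x \in gs.
      rewrite mem_filter mem_sign_vectors !size_map eqxx andbT; apply/asboolP; split.
        by exists x^T.
      exact: cell_bounded_relbounded.
    by exists (index (signs x) gs); rewrite /F ?nth_index //= index_mem.
  have [[y hy] rb] := good_gs i hi.
  have cy : cell (nth [::] gs i) y^T by rewrite cellE trmxK.
  rewrite /F; have e := cell_signs cy; rewrite e in rb *.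
  have cx := cell_compl cy.
  split; first by exists y^T; split=> //; rewrite component_cell.
  exact: relbounded_cell_bounded.
rewrite -sgs; apply: inj_card_eq => i j; rewrite !inE => hi hj Fij.
have [[y hy] _] := good_gs i hi.
have cy : cell (nth [::] gs i) y^T by rewrite cellE trmxK.
have cy' : cell (nth [::] gs j) y^T by have := cy; rewrite -/(F i) Fij.
apply/eqP; rewrite -(nth_uniq [::] hi hj) ?filter_uniq ?uniq_sign_vectors //.
by rewrite (cell_signs cy) (cell_signs cy').
Qed.

End Regions.

Local Open Scope classical_set_scope.
Local Open Scope card_scope.

(* K_n^{[-k2, k1+k2]}: N = k1 + 2 k2 + 1 gains, starting at a = -k2.
   Trees: k = k1 + 1 + k2 colors, (k1+1, k2)-decreasing. *)
Theorem theorem4p3 (n k1 k2 : nat) (hn : (2 <= n)%N) :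
  (forall (ord : gedge n (k1 + k2.*2).+1 -> nat), injective ord ->
   forall alpha : nat, (alpha <= n - 1)%N ->
     #|[set B : {set gedge n (k1 + k2.*2).+1} |
         `[< NBC_basis (- (k2%:Z))%R ord B >] &&
         (activity ord B == alpha)]%SET|
     = #|[set T : {set 'I_n * 'I_n * 'I_(k1 + 1 + k2)} |
           [&& colored_rooted_tree T, decreasing (k1 + 1) T &
               n_edges_col1 T == alpha]]%SET|)
  /\
  (forall R : realType,
     @bounded_regions R n (k1 + k2.*2).+1 (- (k2%:Z))%R
     #= `I_(#|[set T : {set 'I_n * 'I_n * 'I_(k1 + 1 + k2)} |
               [&& colored_rooted_tree T, decreasing (k1 + 1) T &
                   n_edges_col1 T == 0]]%SET|)).
Proof.
move: hn; case: n => // m _; split=> [ord oi alpha _|R].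
  exact: card_NBC_bases_trees.
(* The regions involve no edge order; any injective one gives access to the count of bases of
   activity 0. *)
have oi : injective (fun e : gedge m.+1 (k1 + k2.*2).+1 => enum_rank e : nat).
  by move=> e f /val_inj/enum_rank_inj.
have := @card_bounded_regions R m.+1 (k1 + k2.*2).+1 (- (k2%:Z))%R (ltn0Sn _) (ltn0Sn _).
by rewrite (bounded_cells_NBC _ _ _ _ oi) // card_NBC_bases_trees.
Qed.
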